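(* Let $f\in L_2(\Omega)$ be given and let $\mathbf{u}\in\mathcal{U}_1$ be the solution of $$b_1(\mathbf{u};(v,\tau))=(f,v)\qquad\forall(v,\tau)\in\mathcal{V}_1.$$ For any finite-dimensional subspace $\mathcal{U}_{1,h}\subset\mathcal{U}_1$ there exists a unique $\mathbf{u}_h\in\mathcal{U}_{1,h}$ such that $$b_1(\mathbf{u}_h;(v,\tau))=(f,v)\qquad\forall (v,\tau)\in\mathcal{V}_{1,h}:=\mathrm{T}_1(\mathcal{U}_{1,h}).$$ It satisfies the quasi-optimal error estimate $$\|\mathbf{u}-\mathbf{u}_h\|_{\mathcal{U}_1}\le C\|\mathbf{u}-\mathbf{w}\|_{\mathcal{U}_1}\qquad\forall\mathbf{w}\in\mathcal{U}_{1,h}$$ with a constant $C>0$ that is independent of $f$, $\mathcal{T}$ and $\mathcal{U}_{1,h}$.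
   Context: Let $d\in\{2,3\}$ and let $\Omega\subset\mathbb{R}^d$ be a bounded simply connected Lipschitz domain. Let $\mathcal{T}$ be a mesh of $\Omega$: a finite collection of pairwise disjoint Lipschitz domains $T$ with $\overline\Omega=\bigcup_{T\in\mathcal{T}}\overline T$; $\mathcal{S}=\{\partial T: T\in\mathcal{T}\}$. $(\cdot,\cdot)_T$, $\|\cdot\|_T$ denote the $L_2(T)$ inner product and norm; without index they refer to $L_2(\Omega)$. $(\cdot,\cdot)_{\mathcal{T}}$ is the $L_2(\Omega)$ inner product with differential operators taken piecewise on each $T\in\mathcal{T}$. All functions are real-valued. $H(\Delta,T)$ (resp. $H(\Delta,\Omega)$) is the closure of $\mathcal{D}(\overline T)$ (resp. $\mathcal{D}(\overline\Omega)$), the functions smooth up to the boundary, with respect to $\|z\|_{\Delta,T}^2=\|z\|_T^2+\|\Delta z\|_T^2$ (resp. $\|z\|_\Delta^2=\|z\|^2+\|\Delta z\|^2$). $H(\Delta,\mathcal{T})=\{z\in L_2(\Omega): z|_T\in H(\Delta,T)\ \forall T\in\mathcal{T}\}$ with norm $\|z\|_{\Delta,\mathcal{T}}^2=\sum_{T}\|z|_T\|_{\Delta,T}^2$. Trace operator: $\mathrm{tr}^\Delta:H(\Delta,\Omega)\to H(\Delta,\mathcal{T})'$, $\langle\mathrm{tr}^\Delta(z),v\rangle_{\mathcal{S}}=\sum_{T\in\mathcal{T}}\big[(\Delta v,z)_T-(v,\Delta z)_T\big]$. Also $H_0(\Delta,\Omega)=\{z\in H(\Delta,\Omega): (z,\Delta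 v)-(\Delta z,v)=0\ \forall v\in H(\Delta,\Omega)\}$. Trace spaces: $\mathbf{H}^\Delta(\mathcal{S})=\mathrm{tr}^\Delta(H(\Delta,\Omega))$, $\mathbf{H}^\Delta_{00}(\mathcal{S})=\mathrm{tr}^\Delta(H_0(\Delta,\Omega))$, both with norm $\|\hat v\|_{\Delta,\mathcal{S}}=\inf\{\|v\|_\Delta: v\in H(\Delta,\Omega),\ \mathrm{tr}^\Delta(v)=\hat v\}$. As elements of $H(\Delta,\mathcal{T})'$ they are paired with $H(\Delta,\mathcal{T})$ through $\langle\cdot,\cdot\rangle_{\mathcal{S}}$. $\mathcal{U}_1=L_2(\Omega)\times L_2(\Omega)\times\mathbf{H}^\Delta_{00}(\mathcal{S})\times\mathbf{H}^\Delta(\mathcal{S})$ with $\|(u,\sigma,\hat u,\hat\sigma)\|_{\mathcal{U}_1}^2=\|u\|^2+\|\sigma\|^2+\|\hat u\|_{\Delta,\mathcal{S}}^2+\|\hat\sigma\|_{\Delta,\mathcal{S}}^2$; $\mathcal{V}_1=H(\Delta,\mathcal{T})\times H(\Delta,\mathcal{T})$ with $\|(v,\tau)\|_{\mathcal{V}_1}^2=\|v\|_{\Delta,\mathcal{T}}^2+\|\tau\|_{\Delta,\mathcal{T}}^2$ and the inner product $\langle\!\langle\cdot,\cdot\rangle\!\rangle_{\mathcal{V}_1}$ inducing this norm. $b_1(u,\sigma,\hat u,\hat\sigma;v,\tau)=(u,\Delta\tau)_{\mathcal{T}}+(\sigma,\Delta v-\tau)_{\mathcal{T}}-\langle\hat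 u,\tau\rangle_{\mathcal{S}}-\langle\hat\sigma,v\rangle_{\mathcal{S}}$. (The variational problem $b_1(\mathbf{u};(v,\tau))=(f,v)$ for all $(v,\tau)\in\mathcal{V}_1$ is uniquely solvable in $\mathcal{U}_1$.) The trial-to-test operator $\mathrm{T}_1:\mathcal{U}_1\to\mathcal{V}_1$ is defined by $\langle\!\langle\mathrm{T}_1(\mathbf{u}),\mathbf{v}\rangle\!\rangle_{\mathcal{V}_1}=b_1(\mathbf{u};\mathbf{v})$ for all $\mathbf{v}\in\mathcal{V}_1$. *)

(* Defs.v *)
From HB Require Import structures.
From mathcomp Require Import all_boot all_order all_algebra generic_quotient ring_quotient.
From mathcomp Require Import archimedean lra.
From mathcomp Require Import all_classical all_reals all_analysis measurable_realfun.

Set Implicit Arguments.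
Unset Strict Implicit.
Unset Printing Implicit Defensive.
Import Order.TTheory GRing.Theory Num.Theory.
Import numFieldNormedType.Exports.
Local Open Scope classical_set_scope.
Local Open Scope ring_scope.

(* R^d is 'rV[R]_d, with the sigma-algebra generated by the coordinates, i.e.
   the Borel sigma-algebra (see open_measurable_rV). *)
Fact rV_display : measure_display. Proof. exact: default_measure_display. Qed.

Section rV_measurable.
Context {R : realType} {n : nat}.

Definition rV_coord (i : 'I_n) (x : 'rV[R]_n) : measurableTypeR R := x ord0 i.

Let rV_set0 : g_sigma_preimage rV_coord set0.
Proof. exact: sigma_algebra0. Qed.

Let rV_setC A : g_sigma_preimage rV_coord A -> g_sigma_preimage rV_coord (~` A).
Proof. exact: sigma_algebraC. Qed.

Let rV_bigcup (F : (set 'rV[R]_n)^nat) :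
  (forall i, g_sigma_preimage rV_coord (F i)) ->
  g_sigma_preimage rV_coord (\bigcup_i F i).
Proof. exact: sigma_algebra_bigcup. Qed.

HB.instance Definition _ := @isMeasurable.Build rV_display 'rV[R]_n
  (g_sigma_preimage rV_coord) rV_set0 rV_setC rV_bigcup.

Lemma measurable_rV_coord i : measurable_fun [set: 'rV[R]_n] (rV_coord i).
Proof.
move=> _ Y mY; rewrite setTI; apply: sub_sigma_algebra => /=.
rewrite -bigcup_seq/=; exists i => /=; first by rewrite mem_index_enum.
by exists Y => //; rewrite setTI.
Qed.

Lemma measurable_fun_rVP d1 (T1 : measurableType d1) (f : T1 -> 'rV[R]_n) :
  (forall i, measurable_fun [set: T1] (rV_coord i \o f)) ->
  measurable_fun [set: T1] f.
Proof.
move=> mf _ A mA; rewrite setTI.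
suff : g_sigma_preimage rV_coord `<=` [set B | measurable (f @^-1` B)].
  by move=> /(_ A mA).
apply: smallest_sub.
  split => /=.
  - by rewrite preimage_set0; exact: measurable0.
  - by move=> B mB /=; rewrite setTD preimage_setC; exact: measurableC.
  - by move=> F mF /=; rewrite preimage_bigcup; exact: bigcupT_measurable.
rewrite -bigcup_seq; apply: bigcup_sub => i _ B [C mC <-] /=.
by rewrite setTI -comp_preimage -[X in measurable X]setTI; exact: mf.
Qed.

Lemma open_measurable_rV (A : set 'rV[R]_n) : open A -> measurable A.
Proof.
pose box (q : 'rV[rat]_n * nat) : set 'rV[R]_n :=
  [set x | forall i, ball (ratr (q.1 ord0 i) : R) q.2.+1%:R^-1 (x ord0 i)].
have mbox q : measurable (box q).
  have -> : box q = \bigcap_(i in [set: 'I_n])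
      (rV_coord i @^-1` ball (ratr (q.1 ord0 i) : R) q.2.+1%:R^-1).
    by apply/seteqP; split=> x /= h i; [move=> _; exact: h|exact: (h i I)].
  apply: fin_bigcap_measurable; first exact: finite_finset.
  move=> i _; rewrite -[X in measurable X]setTI; apply: measurable_rV_coord => //.
  exact: measurable_ball.
move=> oA.
have -> : A = \bigcup_(q : 'rV[rat]_n * nat)
    (if `[< box q `<=` A >] then box q else set0).
  apply/seteqP; split=> [x Ax|x [q _]]; last first.
    by case: asboolP => [h /h|_ []].
  have [e /= e0 xeA] : exists2 e : R, 0 < e & ball x e `<=` A.
    by have /nbhs_ballP[e /= e0 h] := open_nbhs_nbhs (conj oA Ax); exists e.
  pose k := Num.truncn (e / 2)^-1.
  have ke : k.+1%:R^-1 < e / 2 :> R.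
    rewrite -[ltRHS]invrK ltf_pV2 ?posrE ?invr_gt0 ?divr_gt0//.
    exact: truncnS_gt.
  have k0 : 0 < k.+1%:R^-1 :> R by rewrite invr_gt0.
  have hq i : exists q : rat, ball (ratr q : R) k.+1%:R^-1 (x ord0 i).
    have : x ord0 i - k.+1%:R^-1 < x ord0 i + k.+1%:R^-1.
      by rewrite ltrBlDr -addrA ltrDl addr_gt0.
    move=> /rat_in_itvoo[q]; rewrite in_itv/= => /andP[h1 h2]; exists q.
    by rewrite /ball/= ltr_norml; rewrite ltrBrDl h1 ltrBlDl h2.
  pose q : 'rV[rat]_n := \row_i sval (cid (hq i)).
  exists (q, k) => //.
  have bq : box (q, k) x by move=> i /=; rewrite mxE; exact: svalP (cid (hq i)).
  rewrite ifT//; apply/asboolP => y by_; apply: xeA; split => // i j.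
  rewrite ord1 (splitr e); apply: (@ball_triangle _ _ (ratr (q ord0 j) : R)).
    exact/ball_sym/(le_ball (ltW ke))/bq.
  exact/(le_ball (ltW ke))/by_.
apply: countable_bigcupT_measurable => [|q]; first exact: countableP.
by case: asboolP => _ //; exact: measurable0.
Qed.

End rV_measurable.

Section lebesgue_rV.
Context {R : realType}.

Definition rV_cons n (xt : 'rV[R]_n * measurableTypeR R) : 'rV[R]_n.+1 :=
  \row_i oapp (fun j => xt.1 ord0 j) xt.2 (unlift ord0 i).

Lemma measurable_rV_cons n : measurable_fun setT (@rV_cons n).
Proof.
apply: measurable_fun_rVP => i.
case: (unliftP ord0 i) => [j ->|->].
  rewrite (_ : _ \o _ = rV_coord j \o fst).
    by apply: measurableT_comp => //; exact: measurable_rV_coord.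
  by apply/funext => x; rewrite /= /rV_coord mxE liftK.
rewrite (_ : _ \o _ = snd) //.
by apply/funext => x; rewrite /= /rV_coord mxE unlift_none.
Qed.

Section step.
Variables (n : nat) (m : {measure set 'rV[R]_n -> \bar R}).

Definition lebesgue_rVS : set 'rV[R]_n.+1 -> \bar R :=
  pushforward (m \x @lebesgue_measure R)%E (@rV_cons n).

Let lebesgue_rVS0 : lebesgue_rVS set0 = 0%E.
Proof. by rewrite /lebesgue_rVS /pushforward preimage_set0 measure0. Qed.

Let lebesgue_rVS_ge0 A : (0 <= lebesgue_rVS A)%E.
Proof. by rewrite /lebesgue_rVS /pushforward; exact: measure_ge0. Qed.

Let lebesgue_rVS_sigma_additive : semi_sigma_additive lebesgue_rVS.
Proof.
move=> F mF tF mUF; rewrite /lebesgue_rVS /pushforward preimage_bigcup.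
have mc := @measurable_rV_cons n measurableT.
apply: measure_semi_sigma_additive.
- by move=> k; rewrite -[X in measurable X]setTI; exact: mc.
- apply/trivIsetP => /= i j _ _ ij; rewrite -preimage_setI.
  by move/trivIsetP : tF => /(_ _ _ _ _ ij) ->//; rewrite preimage_set0.
- by rewrite -preimage_bigcup -[X in measurable X]setTI; exact: mc.
Qed.

HB.instance Definition _ := isMeasure.Build _ _ _ lebesgue_rVS
  lebesgue_rVS0 lebesgue_rVS_ge0 lebesgue_rVS_sigma_additive.

End step.

(* Lebesgue measure on R^n: the n-fold product of lebesgue_measure, transported
   to row vectors (see lebesgue_rV_box). *)
Fixpoint lebesgue_rV n : {measure set 'rV[R]_n -> \bar R} :=
  if n is k.+1 then lebesgue_rVS (lebesgue_rV k) else \d_(0 : 'rV[R]_0).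

Lemma lebesgue_rV_box n (a b : 'I_n -> R) : (forall i, a i <= b i) ->
  lebesgue_rV n [set x | forall i, x ord0 i \in `]a i, b i] ] =
  (\prod_i (b i - a i))%:E.
Proof.
elim: n => [|n ih] in a b *  => ab.
  rewrite big_ord0 /= /dirac indicE mem_set//= => -[].
  by [].
have mab : lebesgue_measure `]a ord0, b ord0]%classic = (b ord0 - a ord0)%:E.
  rewrite lebesgue_measure_itv/= lte_fin.
  have := ab ord0; rewrite le_eqVlt => /orP[/eqP->|->]; last by rewrite EFinB.
  by rewrite ltxx subrr.
rewrite big_ord_recl /= /lebesgue_rVS /pushforward.
rewrite (_ : _ @^-1` _ =
   [set x : 'rV[R]_n | forall i, x ord0 i \in `]a (lift ord0 i), b (lift ord0 i)] ]
     `*` `]a ord0, b ord0]%classic).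
  rewrite product_measure1E//.
  - by rewrite ih// mulrC EFinM; congr (_ * _)%E.
  - rewrite (_ : [set x | _] = \bigcap_(i in [set: 'I_n]) (rV_coord i @^-1`
       `]a (lift ord0 i), b (lift ord0 i)]%classic)).
      apply: fin_bigcap_measurable; first exact: finite_finset.
      move=> i _; rewrite -[X in measurable X]setTI.
      by apply: measurable_rV_coord => //; exact: measurable_itv.
    by apply/seteqP; split=> x /= h i; [move=> _; exact: h|exact: (h i I)].
apply/seteqP; split=> [[x t] /= h|[x t] /= [h1 h2] i].
  split; last by have := h ord0; rewrite mxE unlift_none.
  by move=> i; have := h (lift ord0 i); rewrite mxE liftK.
by case: (unliftP ord0 i) => [j ->|->]; rewrite mxE ?liftK ?unlift_none //=.
Qed.

End lebesgue_rV.

Section L2_quotient.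
Context d (T : measurableType d) (R : realType).
Variable mu : {measure set T -> \bar R}.

Definition L2fun := LfunType mu (lee1n 2).

Definition null_L2fun : {pred L2fun} :=
  fun f => `[< \forall x \ae mu, (f : T -> R) x = 0 >].

Fact null_L2fun_zmod_closed : zmod_closed null_L2fun.
Proof.
split=> [|f g]; rewrite !unfold_in; first by apply/asboolP; exact: nearW.
move=> /asboolP f0 /asboolP g0; apply/asboolP.
by apply: filterS2 f0 g0 => x fx gx; rewrite -[LHS]/(f x - g x) fx gx subrr.
Qed.
HB.instance Definition _ := GRing.isZmodClosed.Build L2fun null_L2fun
  null_L2fun_zmod_closed.

(* L_2(mu) as a vector space: square integrable functions modulo a.e. equality *)
Definition L2 := @Quotient.quot L2fun null_L2fun.
HB.instance Definition _ := GRing.Zmodule.on L2.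

Definition L2_class (f : L2fun) : L2 := (\pi_(Quotient.quot null_L2fun) f)%qT.
Definition L2_repr (f : L2) : L2fun := repr f.

Lemma L2_reprK : cancel L2_repr L2_class.
Proof. exact: reprK. Qed.

Lemma L2_classP (f g : L2fun) :
  L2_class f = L2_class g <-> \forall x \ae mu, f x = g x.
Proof.
transitivity (f - g \in null_L2fun).
  by rewrite Quotient.idealrBE; split=> [/eqP|/eqP].
rewrite unfold_in; split=> [/asboolP|h]; last apply/asboolP.
  by apply: filterS => x /eqP; rewrite -[eqbLHS]/(f x - g x) subr_eq0 => /eqP.
by apply: filterS h => x /eqP fg; apply/eqP; rewrite -[eqbLHS]/(f x - g x) subr_eq0.
Qed.

Lemma L2_classD : {morph L2_class : f g / f + g}.
Proof. exact: raddfD. Qed.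

Let scale (a : R) (f : L2) : L2 := L2_class (a *: L2_repr f).

Let scale_class a f : scale a (L2_class f) = L2_class (a *: f).
Proof.
apply/L2_classP; have /L2_classP := L2_reprK (L2_class f).
apply: filterS => x fx.
rewrite -[LHS]/(a * L2_repr (L2_class f) x) -[RHS]/(a * f x).
by rewrite fx.
Qed.

Let scaleA a b f : scale a (scale b f) = scale (a * b) f.
Proof. by rewrite -[f]L2_reprK !scale_class scalerA. Qed.

Let scale1 : left_id 1 scale.
Proof. by move=> f; rewrite -[f]L2_reprK scale_class scale1r. Qed.

Let scaleDr : right_distributive scale +%R.
Proof.
move=> a f g; rewrite -[f]L2_reprK -[g]L2_reprK.
by rewrite -L2_classD !scale_class -L2_classD scalerDr.
Qed.

Let scaleDl f : {morph scale^~ f : a b / a + b}.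
Proof.
by move=> a b /=; rewrite -[f]L2_reprK !scale_class -L2_classD scalerDl.
Qed.

HB.instance Definition _ := GRing.Zmodule_isLmodule.Build R L2
  scaleA scale1 scaleDr scaleDl.

Lemma L2_classZ a f : L2_class (a *: f) = a *: L2_class f.
Proof. by rewrite -scale_class. Qed.

(* The coercion to functions is a choice of representative: it may only be used
   in expressions that do not depend on that choice. *)
Definition L2_fun (f : L2) : T -> R := L2_repr f.

End L2_quotient.
Coercion L2_fun : L2 >-> Funclass.

Section domains.
Context {R : realType} {d : nat}.
Implicit Types A D : set 'rV[R]_d.

(* Near each boundary point, in suitable orthonormal coordinates, D lies
   strictly below the graph of a Lipschitz function of the d - 1 coordinates
   other than the i-th one. *)
Definition lipschitz_boundary D := forall p, (closure D `\` D°) p ->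
  exists (V : set 'rV[R]_d) (Q : 'M[R]_d) (i : 'I_d) (phi : 'rV[R]_d.-1 -> R^o),
    [/\ open_nbhs p V, Q *m Q^T = 1%:M, lipschitz phi &
        forall y, V y -> D y <-> (y *m Q) ord0 i < phi (col' i (y *m Q))].

Record lipschitz_domain := LipschitzDomain {
  dom_set :> set 'rV[R]_d ;
  dom_nonempty : dom_set !=set0 ;
  dom_open : open dom_set ;
  dom_connected : connected dom_set ;
  dom_lipschitz : lipschitz_boundary dom_set
}.

Definition is_path A (g : R -> 'rV[R]_d) :=
  {within `[0, 1], continuous g} /\ (forall t, t \in `[0, 1] -> A (g t)).

Definition simply_connected A :=
  (forall x y, A x -> A y -> exists g, [/\ is_path A g, g 0 = x & g 1 = y]) /\
  (forall g, is_path A g -> g 0 = g 1 ->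
    exists H : R * R -> 'rV[R]_d,
      {within `[0, 1] `*` `[0, 1], continuous H} /\
      forall s t, s \in `[0, 1] -> t \in `[0, 1] ->
        [/\ A (H (s, t)), H (0, t) = g t, H (1, t) = g 0,
            H (s, 0) = g 0 & H (s, 1) = g 0]).

Lemma below_graph_open (Q : 'M[R]_d) (i : 'I_d) (phi : 'rV[R]_d.-1 -> R^o) :
  lipschitz phi ->
  open [set y | phi (col' i (y *m Q)) < (y *m Q) ord0 i].
Proof.
move=> /pinfty_ex_gt0[K K0 Kphi]; rewrite openE => y /= hy.
pose c := ((y *m Q) ord0 i - phi (col' i (y *m Q))) / (K + 2).
have K2 : 0 < K + 2 by rewrite addr_gt0.
have c0 : 0 < c by rewrite divr_gt0// subr_gt0.
pose S := \sum_k \sum_j `|Q k j|.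
have S0 : 0 <= S by apply: sumr_ge0 => k _; exact: sumr_ge0.
have S1 : 0 < S + 1 by rewrite ltr_wpDl.
apply/nbhs_ballP; exists (c / (S + 1)); first by rewrite /= divr_gt0.
move=> x [_ xy] /=.
have coordE j : `|(y *m Q) ord0 j - (x *m Q) ord0 j| < c.
  have -> : (y *m Q) ord0 j - (x *m Q) ord0 j =
      \sum_k (y ord0 k - x ord0 k) * Q k j.
    by rewrite !mxE -sumrB; apply: eq_bigr => k _; rewrite mulrBl.
  apply: (@le_lt_trans _ _ (c / (S + 1) * S)); last first.
    by rewrite mulrAC ltr_pdivrMr// ltr_pM2l// ltrDl.
  rewrite (le_trans (ler_norm_sum _ _ _))// mulr_sumr ler_sum// => k _.
  rewrite normrM ler_pM//; first by have := xy ord0 k; rewrite /ball/= => /ltW.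
  by rewrite (bigD1 j)//= lerDl sumr_ge0.
have phic : `|phi (col' i (y *m Q)) - phi (col' i (x *m Q))| <= K * c.
  apply: le_trans (Kphi (_, _) _) _ => //=.
  rewrite ler_pM2l// ltW//.
  suff : ball (col' i (y *m Q)) c (col' i (x *m Q)) by rewrite -ball_normE.
  by split=> // k j; rewrite ord1 !mxE; have := coordE (lift i j); rewrite !mxE.
have := coordE i; rewrite ltr_norml => /andP[_].
move: phic; rewrite ler_norml => /andP[+ _].
have : (K + 2) * c = (y *m Q) ord0 i - phi (col' i (y *m Q)).
  by rewrite /c mulrC divfK// gt_eqF.
rewrite mulrDl; set a := phi _; set b := phi _.
set a' := (y *m Q) _ _; set b' := (x *m Q) _ _.
move: (K * c) => Kc; lra.
Qed.

Record mesh (Omega : lipschitz_domain) := Mesh {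
  mesh_size : nat ;
  mesh_elt :> 'I_mesh_size -> lipschitz_domain ;
  mesh_disjoint : forall i j, i != j -> mesh_elt i `&` mesh_elt j = set0 ;
  mesh_cover :
    closure Omega = \bigcup_(i in [set: 'I_mesh_size]) closure (mesh_elt i)
}.

Lemma mesh_sub (Omega : lipschitz_domain) (M : mesh Omega) i : M i `<=` Omega.
Proof.
move=> p Tp; apply: contrapT => nOp.
have TO : M i `<=` closure Omega.
  by move=> x Tx; rewrite (@mesh_cover _ M); exists i => //; exact: subset_closure.
have [V [Q [j [phi [[oV Vp] QQ lphi VO]]]]] :
    exists (V : set 'rV[R]_d) (Q : 'M[R]_d) (i : 'I_d)
      (phi : 'rV[R]_d.-1 -> R^o),
    [/\ open_nbhs p V, Q *m Q^T = 1%:M, lipschitz phi &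
        forall y, V y -> dom_set Omega y <-> (y *m Q) ord0 i < phi (col' i (y *m Q))].
  apply: (@dom_lipschitz Omega); split; first exact: TO.
  by move/interior_subset.
have pphi : phi (col' j (p *m Q)) <= (p *m Q) ord0 j.
  by rewrite leNgt; apply/negP => /(VO _ Vp).
have /nbhs_ballP[e /= e0 peVT] : nbhs p (V `&` M i).
  by apply: filterI; apply: open_nbhs_nbhs; split=> //; exact: (@dom_open (M i)).
pose S := \sum_k `|Q k j|.
have S0 : 0 <= S by exact: sumr_ge0.
have S1 : 0 < S + 1 by rewrite ltr_wpDl.
pose t := e / (S + 1).
have t0 : 0 < t by rewrite divr_gt0.
pose y := p + t *: (delta_mx ord0 j *m Q^T).
have yQ : y *m Q = p *m Q + t *: delta_mx ord0 j.
  by rewrite mulmxDl -scalemxAl -mulmxA (mulmx1C QQ) mulmx1.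
have [Vy Ty] : (V `&` M i) y.
  apply: peVT; split=> // a b; rewrite ord1 /ball/= !mxE opprD addNKr normrN.
  rewrite (bigD1 j)//= big1 => [|k kj].
    rewrite !mxE !eqxx mul1r addr0 normrM gtr0_norm//.
    rewrite /t mulrAC ltr_pdivrMr// ltr_pM2l//.
    by rewrite (@le_lt_trans _ _ S) ?ltrDl// /S (bigD1 b)//= lerDl sumr_ge0.
  by rewrite !mxE (negbTE kj) andbF mul0r.
have := @below_graph_open Q j phi lphi; set G := [set _ | _] => oG.
have Gy : G y.
  rewrite /G/= yQ.
  have -> : col' j (p *m Q + t *: delta_mx ord0 j) = col' j (p *m Q).
    apply/rowP => k; rewrite !mxE [_ == j]eq_sym (negbTE (neq_lift _ _)) andbF mulr0.
    by rewrite addr0.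
  by rewrite (le_lt_trans pphi)// [ltRHS]mxE ltrDl !mxE !eqxx mulr1.
have [z [Oz [Vz Gz]]] : Omega `&` (V `&` G) !=set0.
  apply: (TO _ Ty); apply: filterI; apply: open_nbhs_nbhs; split=> //.
by move/(VO _ Vz) : Oz; rewrite ltNge ltW.
Qed.

Definition pderiv (i : 'I_d) (f : 'rV[R]_d -> R^o) : 'rV[R]_d -> R^o :=
  fun x => 'D_(delta_mx ord0 i) f x.

Definition smooth (f : 'rV[R]_d -> R^o) := forall s : seq 'I_d,
  continuous (foldr pderiv f s) /\
  forall i x, derivable (foldr pderiv f s) x (delta_mx ord0 i).

Definition laplacian (f : 'rV[R]_d -> R^o) : 'rV[R]_d -> R^o :=
  fun x => \sum_i pderiv i (pderiv i f) x.

Definition ip D (f g : 'rV[R]_d -> R) : R :=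
  \int[lebesgue_rV d]_(x in D) (f x * g x).

(* (z, g) is a limit in L_2(D) x L_2(D) of pairs (phi, laplacian phi), with phi
   (the restriction of) a smooth function on R^d: z lies in the closure of the
   functions smooth up to the boundary in the graph norm, and g is the Laplacian
   of z. *)
Definition has_laplacian D (z g : 'rV[R]_d -> R) :=
  exists phi : nat -> 'rV[R]_d -> R^o,
    [/\ forall n, smooth (phi n),
        (\int[lebesgue_rV d]_(x in D) ((phi n x - z x) ^+ 2)%:E)%E
          @[n --> \oo] --> 0%E &
        (\int[lebesgue_rV d]_(x in D) ((laplacian (phi n) x - g x) ^+ 2)%:E)%E
          @[n --> \oo] --> 0%E].

End domains.
Arguments lipschitz_domain : clear implicits.

Definition lebesgue_on {R : realType} {d : nat} (Omega : lipschitz_domain R d) :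
    {measure set 'rV[R]_d -> \bar R} :=
  mrestr (lebesgue_rV d) (open_measurable_rV (@dom_open _ _ Omega)).
Notation L2dom Omega := (L2 (lebesgue_on Omega)).

Section spaces.
Context {R : realType} {d : nat}.

Context {Omega : lipschitz_domain R d}.

Definition HDelta : set (L2dom Omega) :=
  [set z | exists g : L2dom Omega, has_laplacian Omega z g].

(* The Laplacian g is unique, since smooth compactly supported functions are
   dense and integration by parts passes to the limit; likewise for pwlap below,
   as the mesh elements cover Omega up to a null set. *)
Definition lap (z : L2dom Omega) : L2dom Omega :=
  xget 0 [set g : L2dom Omega | has_laplacian Omega z g].

Definition HDelta0 : set (L2dom Omega) :=
  [set z | HDelta z /\
    forall v, HDelta v -> ip Omega z (lap v) - ip Omega (lap z) v = 0].

Definition HDelta_norm (z : L2dom Omega) : R :=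
  Num.sqrt (ip Omega z z + ip Omega (lap z) (lap z)).

Variable M : mesh Omega.

(* Elements of L_2(T) are represented by their extensions to Omega (the elements
   T are subsets of Omega by mesh_sub). *)
Definition HDelta_mesh : set (L2dom Omega) :=
  [set z | forall i, exists g : L2dom Omega, has_laplacian (M i) z g].

Definition pwlap (z : L2dom Omega) : L2dom Omega :=
  xget 0 [set g : L2dom Omega | forall i, has_laplacian (M i) z g].

Lemma HDelta_mesh0 : HDelta_mesh 0.
Proof.
have smooth0 : smooth (0 : 'rV[R]_d -> R^o).
  have pd0 i : pderiv i (0 : 'rV[R]_d -> R^o) = 0.
    by apply/funext => x; exact: (@derive_cst _ _ _ (0 : R^o)).
  move=> s; have -> : foldr pderiv (0 : 'rV[R]_d -> R^o) s = 0.
    by elim: s => //= i s ->.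
  by split=> [x|i x]; [exact: (@cst_continuous _ _ (0 : R^o))|exact: (@derivable_cst _ _ _ (0 : R^o))].
have lap0 : laplacian (0 : 'rV[R]_d -> R^o) = 0.
  apply/funext => x; rewrite /laplacian big1// => i _.
  rewrite [pderiv i 0](_ : _ = 0); first exact: (@derive_cst _ _ _ (0 : R^o)).
  by apply/funext => y; exact: (@derive_cst _ _ _ (0 : R^o)).
have int0 i : (\int[lebesgue_rV d]_(x in M i)
    ((0 - (0 : L2dom Omega) x) ^+ 2)%:E = 0)%E.
  have mT : measurable (dom_set (M i)) by apply: open_measurable_rV; exact: dom_open.
  have mO : measurable (dom_set Omega) by apply: open_measurable_rV; exact: dom_open.
  have /L2_classP[N [mN N0 sN]] :
      L2_class (L2_repr (0 : L2dom Omega)) = L2_class 0.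
    by rewrite L2_reprK /L2_class raddf0.
  rewrite (ge0_ae_eq_integral (g := cst 0%E))//.
  - by rewrite integral0.
  - apply/measurable_EFinP; apply: measurable_funX; apply: measurable_funB => //.
    by apply: (@measurable_funS _ _ _ _ setT) => //; exact: measurable_funP.
  - by move=> x _; rewrite lee_fin sqr_ge0.
  - exists (N `&` Omega); split; [exact: measurableI|exact: N0|].
    move=> x /= /not_implyP[Tx fx]; split; last exact: (mesh_sub Tx).
    by apply: sN => /= fx0; apply: fx; rewrite /L2_fun fx0/= subrr expr0n.
move=> i; exists 0, (fun=> 0); rewrite lap0; split=> [n||].
- exact: smooth0.
- by under eq_fun do rewrite int0; exact: cvg_cst.
- by under eq_fun do rewrite int0; exact: cvg_cst.
Qed.

(* Real functions on H(Delta, mesh). The trace spaces below consist of values of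
   tr, which are bounded linear functionals, so equality and algebraic operations
   agree with those of the dual space. *)
Definition functional := HDelta_mesh -> R^o.

Definition tr (z : L2dom Omega) : functional :=
  fun v => \sum_i (ip (M i) (pwlap (val v)) z - ip (M i) (val v) (lap z)).

Definition trace_space : set functional := tr @` HDelta.
Definition trace_space00 : set functional := tr @` HDelta0.

Definition trace_norm (vh : functional) : R :=
  inf [set HDelta_norm v | v in [set v | HDelta v /\ tr v = vh]].

(* The components are (u, sigma, uh, sigmah). *)
Definition trial := (L2dom Omega * L2dom Omega * functional * functional)%type.

Definition U1 : set trial :=
  [set w | trace_space00 w.1.2 /\ trace_space w.2].

Definition U1_norm (w : trial) : R :=
  let: (u, sigma, uh, sigmah) := w in
  Num.sqrt (ip Omega u u + ip Omega sigma sigma +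
            trace_norm uh ^+ 2 + trace_norm sigmah ^+ 2).

Definition V1 := (HDelta_mesh * HDelta_mesh)%type.

Definition HDelta_mesh_ip (z w : L2dom Omega) : R :=
  \sum_i (ip (M i) z w + ip (M i) (pwlap z) (pwlap w)).

Definition V1_ip (x y : V1) : R :=
  HDelta_mesh_ip (val x.1) (val y.1) + HDelta_mesh_ip (val x.2) (val y.2).

Definition b1 (w : trial) (x : V1) : R :=
  let: (u, sigma, uh, sigmah) := w in
  let: (v, tau) := x in
  ip Omega u (pwlap (val tau)) + ip Omega sigma (pwlap (val v) - val tau : L2dom Omega)
  - uh tau - sigmah v.

Let V1_0 : V1 :=
  (exist _ 0 (mem_set HDelta_mesh0), exist _ 0 (mem_set HDelta_mesh0)).

(* The Riesz representative of b1 w. *)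
Definition T1 (w : trial) : V1 :=
  xget V1_0 [set t | forall x, V1_ip t x = b1 w x].

End spaces.

Definition finite_dim_subspace (R : realType) (E : lmodType R) (U : set E) :=
  [/\ U 0, forall (a : R) x y, U x -> U y -> U (a *: x + y) &
      exists n (e : 'I_n -> E), forall x, U x ->
        exists c : 'I_n -> R, x = \sum_i c i *: e i].

(* Main.v *)
(* With the energy form a(w, w') = <<T1 w, T1 w'>> = b1(w, T1 w'), the discrete
   problem is a Galerkin problem and the error bound is Cea's lemma, once a(w, w)
   is shown to be equivalent to |w|_U1^2 with constants depending on Omega only.

   Coercivity. Let w = (u, s, tr z0, tr z1) and T1 w = (v, t). Testing the
   definition of T1 with (0, x) shows that p = u - z0 - Delta t and
   r = s - Delta z0 + t satisfy (p, Delta x) = (r, x) for all x in H(Delta, mesh).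
   Hence p is in H_0(Delta, Omega), Delta p = r and tr p = 0, so z0 may be replaced
   by z0 + p: then z0 = u - Delta t and Delta z0 = s + t. In the same way
   z1 = s - Delta v and Delta z1 = v. Since z0 is in H_0,
     |Delta z0|^2 = (z1 + Delta v + t, Delta z0) = (v, z0) + (Delta v + t, Delta z0),
   and a Poincare inequality c |z0|^2 <= |Delta z0|^2 bounds all the components of w
   by the energy norm of (v, t).

   Regularity and Poincare. If (p, Delta phi) = (r, phi) for all smooth phi, expand
   the extensions of p and r by zero in the Dirichlet sine eigenfunctions of a cube
   containing Omega. The partial sums are smooth and converge to p, their Laplacians
   converge to r, so that p is in the closure defining H(Delta, Omega); the lowest
   eigenvalue of the cube gives the Poincare constant. Neither elliptic regularity
   nor boundary traces are needed.

   The Lipschitz boundaries only enter through their being null sets. *)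

From HB Require Import structures.
Require Import Defs.
From mathcomp Require Import all_boot all_order all_algebra.
From mathcomp Require Import all_classical all_reals all_analysis measurable_realfun.
From mathcomp Require Import ring lra.
Import Order.TTheory GRing.Theory Num.Theory.
Import numFieldNormedType.Exports.
Local Open Scope classical_set_scope.
Local Open Scope ring_scope.

Set Implicit Arguments.
Unset Strict Implicit.
Unset Printing Implicit Defensive.

(** * Hilbert spaces *)

(** [lap], [pwlap] and [T1] are chosen by [xget], so none of them can be computed before its
    defining relation is shown to be solvable and, for the Laplacians, uniquely solvable. This
    decides what must be built first. Uniqueness of the Laplacian is obtained on small cubes by
    testing with products of sines that vanish on the faces together with their normal derivatives,
    which reduces it to completeness of the sine system. That system thus serves three times: for
    uniqueness, for regularity and for the Poincare constant. Its completeness is elementary: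
    polynomials in the cosines, turned into step functions by Bernoulli's inequality, reach the
    indicators of boxes, and a Dynkin argument does the rest. Existence for [T1] is Riesz's theorem
    in the graph of the piecewise Laplacian, a closed subspace of L_2 x L_2, and for this L_2 is
    shown to be complete. The final constant is C = sqrt (25 K): 25 is the square of the number of
    terms of [b1], and K comes from coercivity and is fixed by a cube around Omega before any mesh
    appears. *)

Lemma discriminant_le0 (R : realType) (A B C : R) : 0 <= C ->
  (forall t, 0 <= A + 2 * t * B + t ^+ 2 * C) -> B ^+ 2 <= A * C.
Proof.
move=> C0 h; have [C00|Cn0] := eqVneq C 0.
  rewrite C00 mulr0; have [->|Bn0] := eqVneq B 0; first by rewrite expr0n.
  (* With C = 0 the expression is affine in t; this t gives it the value -1. *)
  have := h (- (A + 1) / (2 * B)).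
  have -> : A + 2 * (- (A + 1) / (2 * B)) * B + (- (A + 1) / (2 * B)) ^+ 2 * C = -1.
    by rewrite C00; field.
  by lra.
have Cp : 0 < C by rewrite lt_neqAle eq_sym Cn0.
have := h (- B / C).
have -> : A + 2 * (- B / C) * B + (- B / C) ^+ 2 * C = (A * C - B ^+ 2) / C.
  by field.
by rewrite pmulr_lge0 ?invr_gt0// subr_ge0.
Qed.

Lemma cvg_squeeze0 (R : realType) (u v : R^nat) : (forall n, 0 <= u n <= v n) ->
  v n @[n --> \oo] --> 0 -> u n @[n --> \oo] --> 0.
Proof. by move=> uv; apply: squeeze_cvgr (cvg_cst 0); exact: nearW. Qed.

Record inner_product (R : realType) (E : lmodType R) := InnerProduct {
  ip_op :> E -> E -> R ;
  ipC : forall x y, ip_op x y = ip_op y x ;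
  ipDl : forall x y z, ip_op (x + y) z = ip_op x z + ip_op y z ;
  ipZl : forall a x z, ip_op (a *: x) z = a * ip_op x z ;
  ip_ge0 : forall x, 0 <= ip_op x x ;
  ip_eq0 : forall x, ip_op x x = 0 -> x = 0 }.

Section inner_product.
Context {R : realType} {E : lmodType R} (b : inner_product E).

(** Convergence, completeness and most estimates are phrased with squared norms, which keeps square
    roots out of the algebra. *)
Definition nsq x := b x x.

Lemma ipDr x y z : b x (y + z) = b x y + b x z.
Proof. by rewrite ipC ipDl !(ipC _ x). Qed.

Lemma ipZr a x y : b x (a *: y) = a * b x y.
Proof. by rewrite ipC ipZl (ipC _ x). Qed.

Lemma ip0l x : b 0 x = 0.
Proof. by rewrite -(scale0r 0) ipZl mul0r. Qed.

Lemma ip0r x : b x 0 = 0. Proof. by rewrite ipC ip0l. Qed.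

Lemma ipNl x y : b (- x) y = - b x y.
Proof. by rewrite -scaleN1r ipZl mulN1r. Qed.

Lemma ipNr x y : b x (- y) = - b x y.
Proof. by rewrite ipC ipNl ipC. Qed.

Lemma ipBl x y z : b (x - y) z = b x z - b y z.
Proof. by rewrite ipDl ipNl. Qed.

Lemma ipBr x y z : b x (y - z) = b x y - b x z.
Proof. by rewrite ipDr ipNr. Qed.

Lemma ip_suml I (r : seq I) (F : I -> E) z :
  b (\sum_(i <- r) F i) z = \sum_(i <- r) b (F i) z.
Proof.
by elim/big_rec2 : _ => [|i y x _ <-]; rewrite ?ip0l ?ipDl.
Qed.

Lemma nsqZ a x : nsq (a *: x) = a ^+ 2 * nsq x.
Proof. by rewrite /nsq ipZl ipZr mulrA. Qed.

Lemma nsqN x : nsq (- x) = nsq x.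
Proof. by rewrite /nsq ipNl ipNr opprK. Qed.

Lemma nsqBC x y : nsq (x - y) = nsq (y - x).
Proof. by rewrite -nsqN opprB. Qed.

Lemma nsqD x y : nsq (x + y) = nsq x + 2 * b x y + nsq y.
Proof. by rewrite /nsq !ipDl !ipDr (ipC b y); ring. Qed.

Lemma nsqB x y : nsq (x - y) = nsq x - 2 * b x y + nsq y.
Proof. by rewrite nsqD nsqN ipNr; ring. Qed.

Lemma nsq_ge0 x : 0 <= nsq x. Proof. exact: ip_ge0. Qed.

Lemma nsqD_le x y : nsq (x + y) <= 2 * (nsq x + nsq y).
Proof. by have := nsq_ge0 (x - y); rewrite nsqB nsqD; lra. Qed.

Lemma cauchy_schwarz_sqr x y : b x y ^+ 2 <= nsq x * nsq y.
Proof.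
apply: discriminant_le0 => [|t]; first exact: ip_ge0.
by have := nsq_ge0 (x + t *: y); rewrite nsqD nsqZ ipZr mulrA.
Qed.

Lemma cauchy_schwarz x y : `|b x y| <= Num.sqrt (nsq x) * Num.sqrt (nsq y).
Proof.
by rewrite -sqrtrM ?nsq_ge0// -sqrtr_sqr ler_sqrt ?cauchy_schwarz_sqr// mulr_ge0 ?nsq_ge0.
Qed.

Definition ip_cvg (u : nat -> E) x := nsq (u n - x) @[n --> \oo] --> 0.

Definition ip_complete := forall u : nat -> E,
  (forall e, 0 < e -> exists N, forall m n,
    (N <= m)%N -> (N <= n)%N -> nsq (u m - u n) < e) ->
  exists x, ip_cvg u x.

Definition ip_closed (S : set E) :=
  forall u x, (forall n, S (u n)) -> ip_cvg u x -> S x.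

Definition subspace (S : set E) :=
  S 0 /\ forall a x y, S x -> S y -> S (a *: x + y).

Lemma ip_cvg_ip u x y : ip_cvg u x -> b (u n) y @[n --> \oo] --> b x y.
Proof.
move=> ux; apply/subr_cvg0; apply: norm_cvg0.
apply: (cvg_squeeze0 (v := fun n => Num.sqrt (nsq (u n - x)) * Num.sqrt (nsq y))).
  by move=> n; rewrite normr_ge0/= -ipBl; exact: cauchy_schwarz.
rewrite -[X in _ --> X](mul0r (Num.sqrt (nsq y))); apply: cvgM; last exact: cvg_cst.
by rewrite -sqrtr0; exact: (cvg_comp _ _ ux (@sqrt_continuous R 0)).
Qed.

Lemma ip_cvg_nsq u x : ip_cvg u x -> nsq (u n) @[n --> \oo] --> nsq x.
Proof.
move=> ux.
have -> : (fun n => nsq (u n)) = (fun n => nsq (u n - x) + (2 * b (u n) x - nsq x)).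
  by apply/funext => n /=; rewrite nsqB; ring.
rewrite -[X in _ --> X]add0r; apply: cvgD => //.
rewrite [X in _ --> X](_ : _ = 2 * b x x - nsq x); last by rewrite /nsq; ring.
by apply: cvgB; [apply: cvgM; [exact: cvg_cst|exact: ip_cvg_ip]|exact: cvg_cst].
Qed.

(** The representer is the minimizer of J x = |x|^2 - 2 l x on S: a minimizing sequence is Cauchy,
    and its limit satisfies the Euler equation. *)
Lemma riesz_closed (S : set E) (l : E -> R) K :
  ip_complete -> subspace S -> ip_closed S ->
  (forall a x y, S x -> S y -> l (a *: x + y) = a * l x + l y) ->
  (forall x, S x -> l x ^+ 2 <= K * nsq x) ->
  exists2 t, S t & forall x, S x -> b t x = l x.
Proof.
move=> cE [S0 SD] cS lD lK.
pose J x := nsq x - 2 * l x.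
have lZ a x : S x -> l (a *: x) = a * l x.
  by move=> Sx; rewrite -[a *: x]addr0 lD// -[l 0](_ : 0 = _) ?addr0// -[in RHS](scale0r x) -{1}(subrr (l 0)); have := lD 1 0 0 S0 S0; rewrite scale1r addr0 scale0r; lra.
have SZ a x : S x -> S (a *: x) by move=> Sx; rewrite -[a *: x]addr0; exact: SD.
(* (2 l x)^2 <= 4 |K| |x|^2 <= (|K| + |x|^2)^2, hence 2 l x <= |K| + |x|^2. *)
have Jlb x : S x -> - `|K| <= J x.
  move=> Sx; rewrite /J; have := lK _ Sx; have := nsq_ge0 x; have := ler_norm K.
  move: (nsq x) (l x) `|K| (normr_ge0 K) => n y k k0 Kk n0 yK.
  have {}yK : y ^+ 2 <= k * n by apply: le_trans yK _; exact: ler_wpM2r.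
  have : (2 * y) ^+ 2 <= (k + n) ^+ 2 by have := sqr_ge0 (k - n); nra.
  have : 2 * y <= k + n -> - k <= n - 2 * y by lra.
  by move=> + yk; apply; rewrite leNgt; apply/negP; nra.
pose m := inf [set J x | x in S].
have hinf : has_inf [set J x | x in S].
  by split; [exists (J 0), 0|exists (- `|K|) => _ [x Sx <-]; exact: Jlb].
have mJ x : S x -> m <= J x by move=> Sx; apply: ge_inf; [exact: hinf.2|exists x].
have /choice[u hu] n : exists x, S x /\ J x < m + n.+1%:R^-1.
  have n0 : 0 < n.+1%:R^-1 :> R by rewrite invr_gt0.
  by have [_ [x Sx <-] Jx] := inf_adherent n0 hinf; exists x.
have Su n : S (u n) by have [] := hu n.
(* Parallelogram identity, with J at least m at the midpoint of u p and u q. *)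
have ucauchy p q : nsq (u p - u q) <= 2 * (p.+1%:R^-1 + q.+1%:R^-1).
  have Spq : S (u p + u q) by rewrite -[u p]scale1r; exact: SD.
  have lpq : l (u p + u q) = l (u p) + l (u q).
    by rewrite -{1}[u p]scale1r lD// mul1r.
  have := mJ _ (SZ 2^-1 _ Spq); have := (hu p).2; have := (hu q).2.
  rewrite /J lZ// lpq nsqZ nsqB nsqD; move: p.+1%:R^-1 q.+1%:R^-1 => p' q'.
  by rewrite expr2; lra.
have [t ut] : exists t, ip_cvg u t.
  apply: cE => e e0.
  have : \forall n \near \oo, n.+1%:R^-1 < e / 4 :> R.
    have := @cvg_harmonic R; move/cvgrPdist_lt => /(_ (e / 4)).
    rewrite divr_gt0// => /(_ isT); apply: filterS => n.
    by rewrite sub0r normrN gtr0_norm ?harmonic_gt0.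
  move=> [N _ hN]; exists N => p q Np Nq.
  apply: le_lt_trans (ucauchy p q) _.
  have := hN _ Np; have := hN _ Nq => /=; move: p.+1%:R^-1 q.+1%:R^-1 => a c; lra.
exists t => [|x Sx]; first exact: (cS u).
(* J (s x + u n) exceeds J (u n) - 1 / (n + 1) for all s; the discriminant of this quadratic in s
   bounds the residual. *)
have key n : (b (u n) x - l x) ^+ 2 <= n.+1%:R^-1 * nsq x.
  apply: discriminant_le0 => [|s]; first exact: nsq_ge0.
  have := mJ _ (SD s _ _ Sx (Su n)); have := (hu n).2.
  rewrite /J lD// nsqD nsqZ ipZl (ipC b x); move: n.+1%:R^-1 => h.
  by lra.
apply/eqP; rewrite -subr_eq0 -sqrf_eq0 eq_le sqr_ge0 andbT.
have h1 : (b (u n) x - l x) ^+ 2 @[n --> \oo] --> (b t x - l x) ^+ 2.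
  by apply: cvgM; (apply: cvgB; [exact: ip_cvg_ip|exact: cvg_cst]).
have h2 : n.+1%:R^-1 * nsq x @[n --> \oo] --> (0 : R).
  by rewrite -[X in _ --> X](mul0r (nsq x)); apply: cvgM; [exact: cvg_harmonic|exact: cvg_cst].
by apply: ler_cvg_to h1 h2 _; exact: nearW.
Qed.

(** * Expansion in a total orthogonal sequence *)

Section orthogonal_expansion.
Variable e : nat -> E.
Hypothesis e_orth : forall i j, i != j -> b (e i) (e j) = 0.
Hypothesis e_total : forall x, (forall j, b x (e j) = 0) -> x = 0.

(** Some e j may be 0, as in a sequence padded with zeros; division by 0 then makes the coefficient
    0. *)
Definition fourier x j := b x (e j) / nsq (e j).

Definition fourier_sum x N := \sum_(j < N) fourier x j *: e j.

Lemma fourierM x j : fourier x j * nsq (e j) = b x (e j).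
Proof.
have [/ip_eq0 ->|e0] := eqVneq (nsq (e j)) 0; last by rewrite divfK.
by rewrite /nsq !ip0r mulr0.
Qed.

Lemma ip_combination (c : nat -> R) j N :
  b (\sum_(i < N) c i *: e i) (e j) = if (j < N)%N then c j * nsq (e j) else 0.
Proof.
rewrite ip_suml; case: ltnP => [jN|Nj].
  rewrite (bigD1 (Ordinal jN))//= ipZl big1 ?addr0// => i ij.
  by rewrite ipZl e_orth ?mulr0//; apply: contra ij => /eqP ?; apply/eqP/val_inj.
by rewrite big1// => i _; rewrite ipZl e_orth ?mulr0// neq_ltn (leq_trans _ Nj).
Qed.

Lemma nsq_combination (c : nat -> R) N :
  nsq (\sum_(i < N) c i *: e i) = \sum_(i < N) c i ^+ 2 * nsq (e i).
Proof.
rewrite {1}/nsq ip_suml; apply: eq_bigr => i _.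
by rewrite ipZl ipC ip_combination ltn_ord expr2 mulrA.
Qed.

(** Bessel's inequality bounds the nondecreasing sums B, so the partial sums are Cauchy. Their limit
    has the same products with all e j as x, and totality identifies the two. *)
Lemma fourier_sum_cvg x : ip_complete -> ip_cvg (fourier_sum x) x.
Proof.
move=> cE; pose B N := \sum_(i < N) fourier x i ^+ 2 * nsq (e i).
have BE N : nsq (fourier_sum x N) = B N by exact: nsq_combination.
have bB N : b x (fourier_sum x N) = B N.
  rewrite ipC ip_suml; apply: eq_bigr => i _.
  by rewrite ipZl ipC -fourierM expr2 mulrA.
have Bx N : B N <= nsq x.
  by have := nsq_ge0 (x - fourier_sum x N); rewrite nsqB bB BE; lra.
have ndB : nondecreasing_seq B.
  apply/nondecreasing_seqP => N; rewrite /B big_ord_recr/= lerDl mulr_ge0 ?nsq_ge0//.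
  exact: sqr_ge0.
have cB : cvgn B by apply: nondecreasing_is_cvgn => //; exists (nsq x) => _ [N _ <-].
have diff N M : (N <= M)%N -> nsq (fourier_sum x M - fourier_sum x N) = B M - B N.
  move=> NM; rewrite nsqB !BE [b _ _](_ : _ = B N); first by ring.
  rewrite ipC ip_suml; apply: eq_bigr => i _.
  rewrite ipZl ipC ip_combination (leq_trans (ltn_ord i) NM).
  by rewrite expr2 mulrA.
have [y xy] : exists y, ip_cvg (fourier_sum x) y.
  apply: cE => ep ep0.
  have := cB => /cvgrPdist_lt/(_ (ep / 2)); rewrite divr_gt0// => /(_ isT)[N _ hN].
  have hh p q : (N <= p)%N -> (p <= q)%N -> B q - B p < ep.
    move=> Np pq; have := hN _ Np; have := hN _ (leq_trans Np pq).
    by rewrite /= !ltr_norml => /andP[? ?] /andP[? ?]; lra.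
  exists N => p q Np Nq; case: (leqP p q) => pq.
    by rewrite nsqBC diff// hh.
  by rewrite diff ?hh// ltnW.
suff xE : x = y by rewrite {2}xE.
apply/eqP; rewrite -subr_eq0; apply/eqP/e_total => j; rewrite ipBl.
apply/eqP; rewrite subr_eq0; apply/eqP.
have h := ip_cvg_ip (y := e j) xy.
apply: cvg_unique h => //; apply: cvg_near_cst; exists j.+1 => // N /= jN.
by rewrite ip_combination jN fourierM.
Qed.

End orthogonal_expansion.
End inner_product.

Section product_inner_product.
Context {R : realType} {E : lmodType R} (b : inner_product E).

(** On pairs (z, Delta z) this is the graph inner product: closedness of the Laplacian becomes
    closedness of a subspace of E * E. *)
Definition prod_ip_op (x y : E * E) := b x.1 y.1 + b x.2 y.2.

Lemma prod_ipC x y : prod_ip_op x y = prod_ip_op y x.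
Proof. by rewrite /prod_ip_op !(ipC b y.1) !(ipC b y.2). Qed.

Lemma prod_ipDl x y z : prod_ip_op (x + y) z = prod_ip_op x z + prod_ip_op y z.
Proof. by rewrite /prod_ip_op !ipDl addrACA. Qed.

Lemma prod_ipZl a x z : prod_ip_op (a *: x) z = a * prod_ip_op x z.
Proof. by rewrite /prod_ip_op !ipZl mulrDr. Qed.

Lemma prod_ip_ge0 x : 0 <= prod_ip_op x x.
Proof. by rewrite /prod_ip_op addr_ge0 ?ip_ge0. Qed.

Lemma prod_ip_eq0 x : prod_ip_op x x = 0 -> x = 0.
Proof.
move=> /eqP; rewrite /prod_ip_op paddr_eq0 ?ip_ge0//= => /andP[/eqP/ip_eq0 + /eqP/ip_eq0].
by case: x => [x y] /= -> ->.
Qed.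

Definition prod_ip : inner_product (E * E)%type :=
  InnerProduct prod_ipC prod_ipDl prod_ipZl prod_ip_ge0 prod_ip_eq0.

Lemma prod_ip_complete : ip_complete b -> ip_complete prod_ip.
Proof.
move=> cb u cu.
have [x1 h1] : exists x, ip_cvg b (fst \o u) x.
  apply: cb => e /cu[N hN]; exists N => m n /hN /[apply].
  by apply: le_lt_trans; rewrite lerDl ip_ge0.
have [x2 h2] : exists x, ip_cvg b (snd \o u) x.
  apply: cb => e /cu[N hN]; exists N => m n /hN /[apply].
  by apply: le_lt_trans; rewrite lerDr ip_ge0.
exists (x1, x2); rewrite /ip_cvg -(addr0 0).
exact: (cvgD h1 h2).
Qed.

Lemma prod_ip_cvg u x : ip_cvg prod_ip u x ->
  ip_cvg b (fst \o u) x.1 /\ ip_cvg b (snd \o u) x.2.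
Proof.
move=> ux; split; apply: cvg_squeeze0 ux => n.
  by rewrite nsq_ge0/= lerDl ip_ge0.
by rewrite nsq_ge0/= lerDr ip_ge0.
Qed.

End product_inner_product.

(* The form is only assumed to be bilinear on [S]. *)
Section finite_dim_projection.
Context {R : realType} {E : lmodType R} (S : set E) (a : E -> E -> R).
Hypothesis S_sub : subspace S.
Hypothesis aC : forall x y, S x -> S y -> a x y = a y x.
Hypothesis aD : forall k x y z, S x -> S y -> S z ->
  a (k *: x + y) z = k * a x z + a y z.
Hypothesis a_ge0 : forall x, S x -> 0 <= a x x.

Let aDr k x y z : S x -> S y -> S z -> a z (k *: x + y) = k * a z x + a z y.
Proof.
move=> Sx Sy Sz; rewrite aC ?aD// ?(aC Sx)// ?(aC Sy)//.
exact: S_sub.2.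
Qed.

Lemma form_cauchy_schwarz x y : S x -> S y -> a x y ^+ 2 <= a x x * a y y.
Proof.
move=> Sx Sy; apply: discriminant_le0 => [|t]; first exact: a_ge0.
have Sz : S (t *: y + x) by exact: S_sub.2.
have := a_ge0 Sz; rewrite aDr// !aD// (aC Sy Sx).
by move=> h; apply: le_trans h _; rewrite le_eqVlt; apply/orP; left; apply/eqP; ring.
Qed.

(** Induction on the number of generators, which may lie outside U. The set U' collects the elements
    of U represented by the last n generators; either it is all of U, or a single further vector x
    spans the rest. The form may be degenerate, so only existence is claimed. *)
Lemma finite_dim_projection (U : set E) u :
  U `<=` S -> finite_dim_subspace U -> S u ->
  exists2 v, U v & forall w, U w -> a v w = a u w.
Proof.
move=> US [U0 UD [n [e]]] + Su; elim: n U e u US U0 UD Su => [|n ih] U e u US U0 UD Su Ue.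
  exists 0 => // w Uw; have [c ->] := Ue _ Uw; rewrite big_ord0.
  have a0 z : S z -> a z 0 = 0.
    move=> Sz; have := aDr 1 S_sub.1 S_sub.1 Sz.
    by rewrite scale1r addr0; lra.
  by rewrite !a0//; exact: S_sub.1.
pose U' := [set x | U x /\ exists c : 'I_n -> R, x = \sum_i c i *: e (lift ord0 i)].
have U'U : U' `<=` U by move=> x [].
have proj u' : S u' -> exists2 v, U' v & forall w, U' w -> a v w = a u' w.
  move=> Su'; apply: (ih U' (fun i => e (lift ord0 i))) => //.
  - by move=> x /U'U /US.
  - by split => //; exists (fun=> 0); rewrite big1// => i _; rewrite scale0r.
  - move=> k x y [Ux [c xE]] [Uy [c' yE]]; split; first exact: UD.
    exists (fun i => k * c i + c' i); rewrite {1}xE {1}yE scaler_sumr -big_split/=.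
    by apply: eq_bigr => i _; rewrite scalerDl scalerA.
  - by move=> x [].
have [v U'v hv] := proj _ Su.
have [[x [Ux [c [xE c0]]]]|noU] := pselect (exists x, U x /\ exists c : 'I_n.+1 -> R,
    x = \sum_i c i *: e i /\ c ord0 != 0); last first.
  exists v => [|w Uw]; first exact: U'U.
  apply: hv; split => //; have [c wE] := Ue _ Uw; exists (fun i => c (lift ord0 i)).
  rewrite {1}wE big_ord_recl [c ord0](_ : _ = 0) ?scale0r ?add0r//.
  by apply/eqP; apply: contra_notT noU => c0; exists w; split => //; exists c.
have Uv := U'U _ U'v.
have [y U'y hy] := proj _ (US _ Ux).
(* Subtracting the projection y of x makes p orthogonal to U', and U is the sum of U' and the line
   through p. *)
have Uy := U'U _ U'y; pose p := (- 1) *: y + x.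
have Up : U p by exact: UD.
have dec w : U w -> exists k w', U' w' /\ w = k *: p + w'.
  move=> Uw; have [cw wE] := Ue _ Uw; pose k := cw ord0 / c ord0.
  have U'z : U' (w - k *: x).
    split; first by rewrite addrC -scaleNr; exact: UD.
    exists (fun i => cw (lift ord0 i) - k * c (lift ord0 i)).
    rewrite wE {1}xE scaler_sumr -sumrB big_ord_recl scalerA divfK// subrr add0r.
    by apply: eq_bigr => i _; rewrite scalerA scalerBl.
  exists k, (k *: y + (w - k *: x)); split; last first.
    by rewrite scalerDr scalerA mulrN1 scaleNr addrACA addNr add0r addrCA subrr addr0.
  split; first by apply: UD => //; exact: U'U.
  have [_ [c1 yE]] := U'y; have [_ [c2 zE]] := U'z.
  exists (fun i => k * c1 i + c2 i); rewrite {1}yE zE scaler_sumr -big_split/=.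
  by apply: eq_bigr => i _; rewrite scalerDl scalerA.
have Sp := US _ Up; have Sv := US _ Uv.
have pU' w : U' w -> a p w = 0.
  by move=> U'w; rewrite aD ?hy ?mulN1r ?addNr//; [exact: US|exact: US|exact/US/U'U].
(* If a p p = 0, Cauchy-Schwarz makes p orthogonal to all of S, and [lE] holds with both sides 0. *)
pose l := (a u p - a v p) / a p p.
have lE : l * a p p = a u p - a v p.
  have [p0|p0] := eqVneq (a p p) 0; last by rewrite divfK.
  have ap0 z : S z -> a z p = 0.
    move=> Sz; have := form_cauchy_schwarz Sz Sp; rewrite p0 mulr0 => h.
    by apply/eqP; rewrite -sqrf_eq0 eq_le h sqr_ge0.
  by rewrite p0 mulr0 !ap0// subrr.
clearbody l; clearbody p.
exists (l *: p + v) => [|w /dec[k [w' [U'w' ->]]]]; first exact: UD.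
have Sw' := US _ (U'U _ U'w'); have Skw : S (k *: p + w') by exact: S_sub.2.
by rewrite aD// !aDr// (pU' w')// (hv w')// addr0 mulrCA lE; ring.
Qed.
End finite_dim_projection.

(** * The Hilbert space L_2 *)

Section L2_inner_product.
Context d (T : measurableType d) (R : realType) (mu : {measure set T -> \bar R}).
Implicit Types f g h : L2 mu.

Lemma eq_Rintegral_ae (D : set T) (f g : T -> R) : measurable D ->
  measurable_fun D f -> measurable_fun D g ->
  {ae mu, forall x, D x -> f x = g x} ->
  \int[mu]_(x in D) f x = \int[mu]_(x in D) g x.
Proof.
move=> mD mf mg fg; congr fine; apply: ae_eq_integral => //.
- exact/measurable_EFinP.
- exact/measurable_EFinP.
- by apply: filterS fg => x + Dx => ->.
Qed.

Lemma measurable_L2 f : measurable_fun setT (f : T -> R).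
Proof. exact: measurable_funP. Qed.
Hint Resolve measurable_L2 : core.

Lemma measurable_L2S f (D : set T) : measurable_fun D (f : T -> R).
Proof. exact: measurable_funS (measurable_L2 f). Qed.
Hint Resolve measurable_L2S : core.

(** The coercion of [L2] to functions picks representatives that do not respect the operations, so
    pointwise algebra is available only almost everywhere. *)
Lemma L2_classE (f : L2fun mu) : {ae mu, forall x, (L2_class f : T -> R) x = f x}.
Proof. by apply/L2_classP; rewrite [LHS]L2_reprK. Qed.

Lemma L2_ext f g : {ae mu, forall x, (f : T -> R) x = g x} -> f = g.
Proof. by move=> fg; rewrite -(L2_reprK f) -(L2_reprK g); apply/L2_classP. Qed.

Lemma L2_addE f g : {ae mu, forall x, (f + g : L2 mu) x = f x + g x}.
Proof.
have E : L2_class (L2_repr f + L2_repr g) = f + g by rewrite L2_classD !L2_reprK.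
by apply: filterS (L2_classE (L2_repr f + L2_repr g)) => x; rewrite E => ->.
Qed.

Lemma L2_scaleE a f : {ae mu, forall x, (a *: f : L2 mu) x = a * f x}.
Proof.
have E : L2_class (a *: L2_repr f) = a *: f by rewrite L2_classZ L2_reprK.
by apply: filterS (L2_classE (a *: L2_repr f)) => x; rewrite E => ->.
Qed.

Lemma L2_subE f g : {ae mu, forall x, (f - g : L2 mu) x = f x - g x}.
Proof.
apply: filterS2 (L2_addE f (-1 *: g)) (L2_scaleE (-1) g) => x.
by rewrite scaleN1r => -> ->; rewrite mulN1r.
Qed.

Lemma L2_0E : {ae mu, forall x, (0 : L2 mu) x = 0}.
Proof. by apply: filterS (L2_scaleE 0 0) => x; rewrite scale0r => ->; rewrite mul0r. Qed.

Lemma L2_integrable f g : mu.-integrable setT (EFin \o (fun x => f x * g x)).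
Proof. by apply/Lfun1_integrable/Lfun2_mul_Lfun1; exact: LfunP. Qed.

Definition L2dot_op f g : R := \int[mu]_x (f x * g x).

Lemma L2dotC f g : L2dot_op f g = L2dot_op g f.
Proof. by apply: eq_Rintegral => x _; rewrite mulrC. Qed.

Lemma L2dotDl f g h : L2dot_op (f + g) h = L2dot_op f h + L2dot_op g h.
Proof.
rewrite /L2dot_op -RintegralD//; try exact: L2_integrable.
apply: eq_Rintegral_ae => //.
- exact: measurable_funM.
- by apply: measurable_funD; exact: measurable_funM.
- by apply: filterS (L2_addE f g) => x -> _; rewrite mulrDl.
Qed.

Lemma L2dotZl a f h : L2dot_op (a *: f) h = a * L2dot_op f h.
Proof.
rewrite /L2dot_op -RintegralZl//; try exact: L2_integrable.
apply: eq_Rintegral_ae => //.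
- exact: measurable_funM.
- by apply: measurable_funM => //; exact: measurable_funM.
- by apply: filterS (L2_scaleE a f) => x -> _; rewrite mulrA.
Qed.

Lemma L2dot_ge0 f : 0 <= L2dot_op f f.
Proof. by apply: Rintegral_ge0 => x _; rewrite -expr2 sqr_ge0. Qed.

Lemma integral_sqrE f : (\int[mu]_x (f x ^+ 2)%:E)%E = (L2dot_op f f)%:E.
Proof.
rewrite /L2dot_op /Rintegral fineK; last exact: integrable_fin_num (L2_integrable f f).
by apply: eq_integral => x _; rewrite expr2.
Qed.

Lemma L2dot_eq0 f : L2dot_op f f = 0 -> f = 0.
Proof.
move=> f0; have := integral_sqrE f; rewrite f0 => i0.
have : (\int[mu]_x `|(f x ^+ 2)%:E| = 0)%E.
  by rewrite -[RHS]i0; apply: eq_integral => x _; rewrite gee0_abs// lee_fin sqr_ge0.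
move/ae_eq_integral_abs => /= h; apply: L2_ext.
have {}h : {ae mu, forall x : T, setT x -> (f x ^+ 2)%:E = 0%E}.
  by apply: h => //; apply/measurable_EFinP; exact: measurable_funX.
apply: filterS2 h L2_0E => x /(_ I)[/eqP]; rewrite sqrf_eq0 => /eqP -> ->//.
Qed.

Definition L2dot : inner_product (L2 mu) :=
  InnerProduct L2dotC L2dotDl L2dotZl L2dot_ge0 L2dot_eq0.

Lemma integral_sqr_nsq f : (\int[mu]_x (f x ^+ 2)%:E)%E = (nsq L2dot f)%:E.
Proof. exact: integral_sqrE. Qed.

Lemma integral_sqr_diff f g :
  (\int[mu]_x ((f x - g x) ^+ 2)%:E)%E = (nsq L2dot (f - g))%:E.
Proof.
rewrite -integral_sqr_nsq; apply: ge0_ae_eq_integral => //.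
- by apply/measurable_EFinP; apply: measurable_funX; exact: measurable_funB.
- by apply/measurable_EFinP; exact: measurable_funX.
- by move=> x _; rewrite lee_fin sqr_ge0.
- by move=> x _; rewrite lee_fin sqr_ge0.
- by apply: filterS (L2_subE f g) => x -> _.
Qed.

Lemma Lfun2P (f : T -> R) : measurable_fun setT f ->
  (\int[mu]_x (f x ^+ 2)%:E < +oo)%E -> f \in Lfun mu 2%:E.
Proof.
move=> mf foo; rewrite inE; apply/andP; split; rewrite inE//=.
rewrite /finite_norm unlock poweR_lty//; apply: le_lt_trans foo.
rewrite le_eqVlt; apply/orP; left; apply/eqP; apply: eq_integral => x _.
rewrite [X in (X `^ _)%E](_ : _ = `|f x|%:E)//.
by rewrite poweR_EFin powR_mulrn// -normrX ger0_norm ?sqr_ge0.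
Qed.

Lemma limn_einf_le (u : (\bar R)^nat) c : (forall n, u n <= c)%E -> (limn_einf u <= c)%E.
Proof.
move=> uc; rewrite limn_einf_lim; apply: lime_le; first exact: is_cvg_einfs.
by apply: nearW => n; apply: le_trans (uc n); apply: ereal_inf_lbound; exists n => /=.
Qed.

(** The increments are at most sqrt C * 2^-k, so the telescoping series converges absolutely. *)
Lemma weighted_series_cvg (v : R^nat) C :
  (forall k, 4 ^+ k * (v k.+1 - v k) ^+ 2 <= C) -> cvgn v.
Proof.
move=> vC; have C0 : 0 <= C by apply: le_trans (vC 0%N); rewrite expr0 mul1r sqr_ge0.
have h : cvgn (series (telescope v)).
  apply: normed_cvg; apply: (@series_le_cvg _ _ (geometric (Num.sqrt C) 2^-1)).
  - by move=> n /=.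
  - by move=> n; rewrite /= mulr_ge0 ?sqrtr_ge0 ?exprn_ge0.
  - move=> n; rewrite /= exprVn ler_pdivlMr ?exprn_gt0//.
    rewrite -[leLHS]ger0_norm ?mulr_ge0 ?exprn_ge0// -sqrtr_sqr ler_wsqrtr//.
    rewrite exprMn real_normK ?num_real// -exprM mulnC exprM mulrC.
    have -> : (2 ^+ 2 : R) = 4 by rewrite -natrX.
    by rewrite /telescope; exact: vC.
  - by apply: is_cvg_geometric_series; rewrite ger0_norm ?invf_lt1 ?ltr1n.
rewrite (_ : v = fun n => series (telescope v) n + v 0%N).
  by apply: is_cvgD => //; exact: is_cvg_cst.
by apply/funext => n; rewrite telescopeK /= subrK.
Qed.

(** Riesz-Fischer: a fast subsequence converges almost everywhere, and Fatou's lemma turns its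
    pointwise limit into a limit in norm. *)
Lemma L2_complete : ip_complete L2dot.
Proof.
move=> u cu.
have /choice[N hN] k : exists N, forall m n, (N <= m)%N -> (N <= n)%N ->
    nsq L2dot (u m - u n) < 8 ^- k by apply: cu; rewrite invr_gt0 exprn_gt0.
(* Partial sums turn the thresholds N k into nondecreasing indices. *)
pose S k := (\sum_(j < k.+1) N j)%N.
have NS k : (N k <= S k)%N by rewrite /S big_ord_recr/= leq_addl.
have SS k m : (S k <= S (k + m))%N.
  elim: m => [|m ih]; first by rewrite addn0.
  by rewrite addnS (leq_trans ih)// /S [leqRHS]big_ord_recr leq_addr.
pose v k : L2 mu := u (S k).
have hv k m : nsq L2dot (v k - v (k + m)%N) < 8 ^- k.
  by apply: hN => //; exact: leq_trans (NS k) (SS k m).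
(* The weight 4^k against the bound 8^-k leaves 2^-k, so the sum of all t k has integral at most 2
   and is finite almost everywhere. *)
pose t k x := (4 ^+ k * (v k.+1 x - v k x) ^+ 2)%:E.
have t0 k x : (0 <= t k x)%E by rewrite lee_fin mulr_ge0 ?sqr_ge0 ?exprn_ge0.
have mv2 k l : measurable_fun setT (fun x => (v k x - v l x) ^+ 2).
  by apply: measurable_funX; exact: measurable_funB.
have mt k : measurable_fun setT (t k).
  by apply/measurable_EFinP; exact: measurable_funM.
pose F x := (\sum_(k <oo) t k x)%E.
have mF : measurable_fun setT F by apply: ge0_emeasurable_sum.
have F0 x : (0 <= F x)%E by exact: nneseries_ge0.
have iF : mu.-integrable setT F.
  apply/integrableP; split => //.
  under eq_integral do rewrite gee0_abs//.
  rewrite integral_nneseries//; apply: (@le_lt_trans _ _ 2%:E); last exact: ltry.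
  apply: le_trans (@epsilon_trick0 _ 2 xpredT (ler0n _ 2)).
  apply: lee_nneseries => [k _ _|k _]; first exact: integral_ge0.
  rewrite (eq_integral (fun x => (4 ^+ k)%:E * ((v k.+1 x - v k x) ^+ 2)%:E)%E); last first.
    by move=> x _; rewrite -EFinM.
  rewrite ge0_integralZl//; last 2 first.
  - exact/measurable_EFinP.
  - by move=> x _; rewrite lee_fin sqr_ge0.
  rewrite integral_sqr_diff -EFinM lee_fin -(addn1 k) nsqBC.
  apply: le_trans (ler_wpM2l _ (ltW (hv k 1%N))) _; first exact: exprn_ge0.
  have -> : (8 : R) = 4 * 2 by rewrite -natrM.
  have -> : (2 ^ (k + 1))%:R = 2 * 2 ^+ k :> R by rewrite addn1 expnS natrM natrX.
  by rewrite exprMn !invfM !mulrA !divff ?expf_neq0 ?pnatr_eq0// !mul1r.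
have [Z [mZ Z0 FZ]] := integrable_ae measurableT iF.
(* Cutting off the exceptional null set makes the sequence converge everywhere, so that its limit is
   measurable. *)
pose w k x := v k x * \1_(~` Z) x.
have wE k : {ae mu, forall x, w k x = v k x}.
  exists Z; split => // x /=; rewrite /w indicE; apply: contra_notP => Zx.
  by rewrite mem_set ?mulr1.
have mw k : measurable_fun setT (w k).
  by apply: measurable_funM => //; apply: measurable_indic; exact: measurableC.
have cw x : cvgn (w ^~ x).
  have [Zx|Zx] := pselect (Z x).
    rewrite (_ : w ^~ x = cst 0); first exact: is_cvg_cst.
    by apply/funext => k; rewrite /w indicE memNset ?mulr0//; exact.
  rewrite (_ : w ^~ x = v ^~ x); last first.
    by apply/funext => k; rewrite /w indicE mem_set ?mulr1.
  have Fx : F x \is a fin_num by apply: contra_notT Zx => Fx; apply: FZ => /= /(_ Logic.I); rewrite (negbTE Fx).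
  apply: (@weighted_series_cvg _ (fine (F x))) => k.
  rewrite -lee_fin fineK// -/(t k x).
  apply: le_trans (nneseries_lim_ge k.+1 _) => //.
  by rewrite big_nat_recr//= leeDr// sume_ge0.
pose f x := limn (w ^~ x).
have mf : measurable_fun setT f by apply: measurable_fun_cvg mw _ => x _; exact: cw.
(* Fatou's lemma for w k - w (k + m), as m tends to infinity. *)
have wf k : (\int[mu]_x ((w k x - f x) ^+ 2)%:E <= (8 ^- k)%:E)%E.
  rewrite (eq_integral (fun x => limn_einf (fun m => ((w k x - w (k + m)%N x) ^+ 2)%:E))).
    apply: le_trans (fatou _ _ _ _) _ => //.
    - by move=> n; apply/measurable_EFinP; apply: measurable_funX; exact: measurable_funB.
    - by move=> n x _; rewrite lee_fin sqr_ge0.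
    apply: limn_einf_le => m; apply: (@le_trans _ _ (nsq L2dot (v k - v (k + m)%N))%:E); last first.
      by rewrite lee_fin; exact: ltW (hv k m).
    rewrite -integral_sqr_diff le_eqVlt; apply/orP; left; apply/eqP.
    apply: ge0_ae_eq_integral => //.
    - by apply/measurable_EFinP; apply: measurable_funX; exact: measurable_funB.
    - exact/measurable_EFinP.
    - by move=> x _; rewrite lee_fin sqr_ge0.
    - by move=> x _; rewrite lee_fin sqr_ge0.
    - by apply: filterS2 (wE k) (wE (k + m)%N) => x -> ->.
  move=> x _; apply/esym; apply: (cvg_limn_einf_sup _).1.
  apply: cvg_EFin; first exact: nearW.
  have wk : w (k + m)%N x @[m --> \oo] --> f x.
    have := cw x; rewrite -(cvg_shiftn k) => h.
    by under eq_fun do rewrite addnC.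
  by apply: cvgM; (apply: cvgB; [exact: cvg_cst|]).
(* The estimate controls the difference f - w 0, not f itself; the limit is therefore built as the
   class of this difference plus v 0. *)
have gL : (fun x => f x - w 0%N x) \in Lfun mu 2%:E.
  apply: Lfun2P; first exact: measurable_funB.
  apply: le_lt_trans (ltry (8 ^- 0)); apply: le_trans (wf 0%N).
  rewrite le_eqVlt; apply/orP; left; apply/eqP.
  by apply: eq_integral => x _; rewrite -sqrrN opprB.
pose g : L2fun mu := Lfun_Sub (lee1n 2) gL.
pose x0 : L2 mu := L2_class g + v 0%N.
have x0E : {ae mu, forall x, x0 x = f x}.
  apply: filterS3 (L2_addE (L2_class g) (v 0%N)) (L2_classE g) (wE 0%N) => x -> -> <-.
  exact: subrK.
have vx k : nsq L2dot (v k - x0) <= 8 ^- k.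
  rewrite -lee_fin -integral_sqr_diff; apply: le_trans (wf k).
  rewrite le_eqVlt; apply/orP; left; apply/eqP; apply: ge0_ae_eq_integral => //.
  - by apply/measurable_EFinP; apply: measurable_funX; exact: measurable_funB.
  - by apply/measurable_EFinP; apply: measurable_funX; exact: measurable_funB.
  - by move=> x _; rewrite lee_fin sqr_ge0.
  - by move=> x _; rewrite lee_fin sqr_ge0.
  - by apply: filterS2 (wE k) x0E => x -> ->.
exists x0; apply/cvgrPdist_lt => e e0.
have [k hk] : exists k, 4 * 8 ^- k < e.
  have h8 : `|8^-1 : R| < 1 by rewrite ger0_norm ?invf_lt1 ?ltr1n.
  have /cvgrPdist_lt/(_ _ e0) := cvg_geometric 4 h8.
  move=> [k _ /(_ k (leqnn k))] /=.
  by rewrite sub0r normrN exprVn ger0_norm// => h; exists k.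
exists (N k) => // n Nn; rewrite sub0r normrN ger0_norm; last exact: nsq_ge0.
rewrite -/(nsq L2dot (u n - x0)).
have -> : u n - x0 = (u n - v k) + (v k - x0) by rewrite addrA subrK.
apply: le_lt_trans (nsqD_le _ _ _) _.
have := hN k _ _ Nn (NS k); have := vx k; rewrite -/(v k).
move: hk; move: (8 ^- k) (nsq _ _) (nsq _ _) => a p q; lra.
Qed.

End L2_inner_product.

(** * Lebesgue measure on R^n *)

Section boxes.
Context {R : realType} {n : nat}.
Implicit Types a b : 'I_n -> R.

Definition box a b : set 'rV[R]_n := [set x | forall i, x ord0 i \in `]a i, b i]].

Definition boxes : set (set 'rV[R]_n) := [set A | exists a b, A = box a b].

Lemma measurable_box a b : measurable (box a b).
Proof.
rewrite (_ : box a b = \bigcap_(i in [set: 'I_n])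
    (rV_coord i @^-1` `]a i, b i]%classic)).
  apply: fin_bigcap_measurable; first exact: finite_finset.
  move=> i _; rewrite -[X in measurable X]setTI.
  by apply: measurable_rV_coord => //; exact: measurable_itv.
by apply/seteqP; split=> x /= h i; [move=> _; exact: h|exact: (h i Logic.I)].
Qed.

Lemma setI_closed_boxes : setI_closed boxes.
Proof.
move=> _ _ [a [b ->]] [a' [b' ->]].
exists (fun i => Num.max (a i) (a' i)), (fun i => Num.min (b i) (b' i)).
apply/seteqP; split=> x /= => [[h h'] i|h].
  by have := h i; have := h' i; rewrite !in_itv/= gt_max le_min => /andP[-> ->] /andP[-> ->].
by split=> i; have := h i; rewrite !in_itv/= gt_max le_min => /andP[/andP[? ?] /andP[? ?]]; apply/andP.
Qed.

Lemma box_cover : \bigcup_(k : nat) box (fun=> - k%:R) (fun=> k%:R) = setT.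
Proof.
apply/seteqP; split => // x _; pose s := \sum_i `|x ord0 i|.
have [k sk] : exists k : nat, s < k%:R.
  by exists (Num.truncn s).+1; exact: truncnS_gt.
exists k => // i; have : `|x ord0 i| < k%:R.
  by apply: le_lt_trans sk; rewrite /s (bigD1 i)//= lerDl sumr_ge0.
by rewrite in_itv/= ltr_norml => /andP[-> /ltW ->].
Qed.

(** The preimage of an interval under one coordinate is a countable union of boxes whose other sides
    grow. *)
Lemma measurable_boxesE : @measurable _ 'rV[R]_n = <<s boxes >>.
Proof.
apply/seteqP; split; last first.
  apply: smallest_sub; first exact: sigma_algebra_measurable.
  by move=> _ [a [b ->]]; exact: measurable_box.
apply: smallest_sub; first exact: smallest_sigma_algebra.
rewrite -bigcup_seq; apply: bigcup_sub => i _ B [C mC <-] /=; rewrite setTI.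
suff : @measurable _ (measurableTypeR R) `<=` [set Y | <<s boxes>> (rV_coord i @^-1` Y)].
  exact.
apply: smallest_sub.
  have sT : sigma_algebra setT (<<s boxes>>) by exact: smallest_sigma_algebra.
  have [s0 sC sU] := sT; split => /=.
  - by rewrite preimage_set0.
  - by move=> Y sY; rewrite setTD preimage_setC -setTD; exact: sC.
  - by move=> F sF; rewrite preimage_bigcup; exact: sU.
move=> _ [[c e] _ <-] /=.
rewrite (_ : _ @^-1` _ = \bigcup_(k : nat) box (fun j => if j == i then c else - k%:R)
    (fun j => if j == i then e else k%:R)).
  have [_ _ sU] : sigma_algebra setT (<<s boxes>>) by exact: smallest_sigma_algebra.
  by apply: sU => k; apply: sub_sigma_algebra; do 2 eexists.
apply/seteqP; split => x /=.
  move=> xi; have [k _ xk] : (\bigcup_(k : nat) box (fun=> - k%:R) (fun=> k%:R)) x.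
    by rewrite box_cover.
  by exists k => // j; case: eqVneq => [->//|_]; exact: xk.
by move=> [k _ /(_ i)]; rewrite eqxx.
Qed.

Lemma lebesgue_box_lty a b : (lebesgue_rV n (box a b) < +oo)%E.
Proof.
have [h|] := pselect (forall i, a i <= b i).
  by rewrite lebesgue_rV_box// ltry.
move=> /existsNP[i /negP]; rewrite -ltNge => ba.
rewrite (_ : box a b = set0) ?measure0//; apply/seteqP; split => // x /(_ i).
by rewrite in_itv/= => /andP[/lt_le_trans /[apply]]; rewrite ltNge (ltW ba).
Qed.

Lemma lebesgue_rV_sigma_finite : sigma_finite setT (lebesgue_rV n : set 'rV[R]_n -> \bar R).
Proof.
exists (fun k : nat => box (fun=> - k%:R) (fun=> k%:R)); first by rewrite box_cover.
by move=> k; split; [exact: measurable_box|exact: lebesgue_box_lty].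
Qed.

Lemma measurable_shift_rV (v : 'rV[R]_n) : measurable_fun setT (fun x : 'rV[R]_n => x + v).
Proof.
apply: measurable_fun_rVP => i.
rewrite (_ : _ \o _ = fun x => rV_coord i x + v ord0 i).
  by apply: measurable_funD => //; exact: measurable_rV_coord.
by apply/funext => x; rewrite /rV_coord /= !mxE.
Qed.

(** Two measures that agree on boxes coincide: boxes are stable under intersection, generate the
    sigma-algebra and exhaust the space with finite measure. *)
Lemma lebesgue_rV_shift (v : 'rV[R]_n) (A : set 'rV[R]_n) : measurable A ->
  lebesgue_rV n [set x | A (x + v)] = lebesgue_rV n A.
Proof.
move=> mA.
have [mm mmE] : exists mm : {measure set 'rV[R]_n -> \bar R},
    forall B, mm B = lebesgue_rV n [set x | B (x + v)].
  unshelve eexists (pushforward (lebesgue_rV n) (fun x : 'rV[R]_n => x + v)).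
    exact: measurable_shift_rV.
  by [].
rewrite -mmE; apply: (@measure_unique _ _ _ boxes
  (fun k : nat => box (fun=> - k%:R) (fun=> k%:R))) => //.
- exact: measurable_boxesE.
- exact: setI_closed_boxes.
- by move=> k; do 2 eexists.
- exact: box_cover.
- move=> _ [a [b ->]]; rewrite mmE.
  have -> : [set x | box a b (x + v)] =
      box (fun i => a i - v ord0 i) (fun i => b i - v ord0 i).
    apply/seteqP; split => x /= h i; have := h i;
      by rewrite !in_itv/= !mxE ltrBlDr lerBrDr.
  have [ab|] := pselect (forall i, a i <= b i).
    rewrite !lebesgue_rV_box// => [|i]; last by rewrite lerD2r.
    by congr EFin; apply: eq_bigr => i _; ring.
  move=> /existsNP[i /negP]; rewrite -ltNge => ba.
  have box0 (a' b' : 'I_n -> R) : b' i < a' i -> box a' b' = set0.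
    move=> ba'; apply/seteqP; split => // x /(_ i).
    by rewrite in_itv/= => /andP[/lt_le_trans /[apply]]; rewrite ltNge (ltW ba').
  by rewrite !box0// ltrD2r.
- move=> k; rewrite mmE.
  rewrite (_ : [set x | _] = box (fun i => - k%:R - v ord0 i) (fun i => k%:R - v ord0 i)).
    exact: lebesgue_box_lty.
  apply/seteqP; split => x /= h i; have := h i;
      by rewrite !in_itv/= !mxE ltrBlDr lerBrDr.
Qed.

End boxes.

(** * Integration along coordinate lines, and locally negligible sets *)

Section lines.
Context {R : realType}.

(* A head constant to which sigma-finiteness can be attached. *)
Definition lebesgue_sf n : set 'rV[R]_n -> \bar R := lebesgue_rV n.

HB.instance Definition _ n := Measure.copy (@lebesgue_sf n) (lebesgue_rV n).
HB.instance Definition _ n := @Measure_isSigmaFinite.Build _ _ _ (@lebesgue_sf n)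
  (@lebesgue_rV_sigma_finite R n).

Definition upd n (i : 'I_n) (x : 'rV[R]_n) (t : R) : 'rV[R]_n :=
  \row_j if j == i then t else x ord0 j.

Lemma rV_cons_upd0 n (x : 'rV[R]_n) s t :
  rV_cons (x, t) = upd ord0 (rV_cons (x, s)) t.
Proof.
apply/rowP => i; rewrite !mxE; case: (unliftP ord0 i) => [j ->|->] //=.
Qed.

Lemma rV_cons_upd n (x : 'rV[R]_n) j s t :
  rV_cons (upd j x s, t) = upd (lift ord0 j) (rV_cons (x, t)) s.
Proof.
apply/rowP => i; rewrite !mxE; case: (unliftP ord0 i) => [k ->|->] /=.
  by rewrite mxE (inj_eq (@lift_inj _ _)).
by [].
Qed.

Lemma integral_rVS n (F : 'rV[R]_n.+1 -> \bar R) :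
  (lebesgue_rV n.+1).-integrable setT F ->
  (@lebesgue_sf n \x @lebesgue_measure R)%E.-integrable setT (F \o @rV_cons R n) /\
  (\int[lebesgue_rV n.+1]_x F x =
   \int[@lebesgue_sf n \x @lebesgue_measure R]_z F (rV_cons z))%E.
Proof.
move=> iF; have mF := measurable_int _ iF.
have mc := @measurable_rV_cons R n.
have E (G : 'rV[R]_n.+1 -> \bar R) : (\int[lebesgue_rV n.+1]_x G x =
    \int[pushforward (@lebesgue_sf n \x @lebesgue_measure R)%E (@rV_cons R n)]_x G x)%E.
  apply: eq_measure_integral => A mA _ /=.
  by apply: eq_measure_integral.
have iF' : (@lebesgue_sf n \x @lebesgue_measure R)%E.-integrable setT (F \o @rV_cons R n).
  apply/integrableP; split; first exact: measurableT_comp.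
  move/integrableP : iF => [_]; rewrite E ge0_integral_pushforward ?preimage_setT//.
  exact: measurableT_comp.
split => //; rewrite E integral_pushforward ?preimage_setT//.
Qed.

(** Fubini, by induction on the dimension: the coordinate split off is either i, and is integrated
    first, or another one, and then the induction hypothesis applies to almost every slice. *)
Lemma integral_lines_eq0 n (i : 'I_n) (F : 'rV[R]_n -> \bar R) :
  (lebesgue_rV n).-integrable setT F ->
  (forall x, \int[lebesgue_measure]_t F (upd i x t) = 0)%E ->
  (\int[lebesgue_rV n]_x F x = 0)%E.
Proof.
elim: n i F => [[]//|n ih] i F iF F0; have [iF' ->] := integral_rVS iF.
case: (unliftP ord0 i) F0 => [j ->|->] F0.
  rewrite -(integral21_prod_meas1 iF').
  rewrite (ae_eq_integral (cst 0%E)) ?integral0//.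
    exact: (measurable_fubini_G iF').
  apply: filterS (ae_integrable2 iF') => t it _.
  rewrite /fubini_G; apply: (ih j) => [//|x].
  rewrite -[RHS](F0 (rV_cons (x, t))); apply: eq_integral => s _ /=.
  by rewrite rV_cons_upd.
rewrite -(integral12_prod_meas1 iF') (eq_integral (cst 0%E)) ?integral0// => x _.
rewrite /fubini_F /= -[RHS](F0 (rV_cons (x, 0))).
by apply: eq_integral => t _ /=; rewrite (rV_cons_upd0 _ 0).
Qed.

(** There are countably many cubes with rational centre and radius 1 / (k + 1), and each point of N
    lies in one that meets N in a negligible set. *)
Lemma locally_negligible n (N : set 'rV[R]_n) :
  (forall x, N x -> exists2 e : R, 0 < e & (lebesgue_rV n).-negligible (N `&` ball x e)) ->
  (lebesgue_rV n).-negligible N.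
Proof.
move=> locN; pose cube (q : 'rV[rat]_n * nat) : set 'rV[R]_n :=
  ball (\row_i (ratr (q.1 ord0 i) : R) : 'rV[R]_n) q.2.+1%:R^-1.
pose F k := if unpickle k is Some q then
  if `[< (lebesgue_rV n).-negligible (N `&` cube q) >] then N `&` cube q else set0 else set0.
suff NF : N `<=` \bigcup_k F k.
  apply: negligibleS NF _; apply: negligible_bigcup => k; rewrite /F.
  by case: unpickle => [q|]; [case: asboolP => // _|]; exact: negligible_set0.
move=> x Nx; have [e e0 xe] := locN _ Nx.
pose k := Num.truncn (e / 2)^-1.
have ke : k.+1%:R^-1 < e / 2 :> R.
  rewrite -[ltRHS]invrK ltf_pV2 ?posrE ?invr_gt0 ?divr_gt0//.
  exact: truncnS_gt.
have [r rE] : {r : R | r = k.+1%:R^-1} by eexists.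
have r0 : 0 < r by rewrite rE invr_gt0.
rewrite -rE in ke.
have /choice[q hq] (i : 'I_n) : exists q : rat, `|ratr q - x ord0 i| < r.
  have : x ord0 i - r < x ord0 i + r by lra.
  move=> /rat_in_itvoo[q]; rewrite in_itv/= => /andP[h1 h2]; exists q.
  by rewrite ltr_norml; apply/andP; split; lra.
pose Q : 'rV[rat]_n * nat := (\row_i q i, k).
have Qx : cube Q x by rewrite /cube/= -rE; split => // i j; rewrite (ord1 i) /ball/= !mxE; exact: hq.
exists (pickle Q) => //; rewrite /F pickleK asboolT//.
apply: negligibleS xe => y []; rewrite /cube/= -rE => Ny [_ Qy]; split => //; split => // i j.
rewrite (ord1 i); have := Qy ord0 j; have := hq j; rewrite /ball/= !mxE.
rewrite !ltr_norml => /andP[? ?] /andP[? ?]; apply/andP; split; lra.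
Qed.

End lines.

(** * Integration by parts on a cube *)

Lemma is_derive_continuous (R : realType) (f f' : R -> R^o) :
  (forall t : R, is_derive t 1 f (f' t)) -> continuous f.
Proof.
move=> df t; apply: differentiable_continuous; apply/derivable1_diffP.
exact: (@ex_derive _ _ _ _ _ _ _ (df t)).
Qed.

Section line_derivative.
Context {R : realType} {n : nat}.
Implicit Types (f : 'rV[R]_n -> R^o) (x : 'rV[R]_n) (i : 'I_n).

Lemma upd_id i x : upd i x (x ord0 i) = x.
Proof. by apply/rowP => j; rewrite mxE; case: eqVneq => // ->. Qed.

Lemma upd_shift i x t h : h *: delta_mx ord0 i + upd i x t = upd i x (h + t).
Proof.
apply/rowP => j; rewrite !mxE eqxx /=; case: eqVneq => _.
  by rewrite mulr1.
by rewrite mulr0 add0r.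
Qed.

Lemma line_quotient f i x t :
  (fun h : R => h^-1 *: ((f \o shift (upd i x t)) (h *: delta_mx ord0 i) - f (upd i x t))) =
  (fun h => h^-1 *: (((fun s : R => f (upd i x s)) \o shift t) (h *: 1) - f (upd i x t))).
Proof. by apply/funext => h /=; rewrite upd_shift [h *: 1]mulr1. Qed.

Lemma derivable_line f i x t :
  derivable f (upd i x t) (delta_mx ord0 i) = derivable (fun s => f (upd i x s)) t 1.
Proof. by rewrite /derivable line_quotient. Qed.

Lemma derive_line f i x t :
  pderiv i f (upd i x t) = 'D_1 (fun s => f (upd i x s)) t.
Proof. by rewrite /pderiv /derive line_quotient. Qed.

Lemma is_derive_line f i x t :
  derivable f (upd i x t) (delta_mx ord0 i) ->
  is_derive t 1 (fun s => f (upd i x s)) (pderiv i f (upd i x t)).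
Proof. by rewrite derivable_line derive_line => h; apply: DeriveDef. Qed.

Lemma continuous_upd i x : continuous (upd i x : R -> 'rV[R]_n).
Proof.
move=> t; apply/cvgrPdist_lt => e e0; near=> s.
have : `|t - s| < e by near: s; exact: cvgr_dist_lt.
move=> ts.
have : ball (upd i x t) e (upd i x s).
  by split => // a j; rewrite !mxE /ball/=; case: eqVneq => // _; rewrite subrr normr0.
by rewrite -ball_normE.
Unshelve. all: by end_near. Qed.

Lemma continuous_measurable_rV f (D : set 'rV[R]_n) : continuous f -> measurable_fun D f.
Proof.
move=> cf; apply: (@measurable_funS _ _ _ _ setT) => //.
apply: (measurability _ (RGenOInfty.measurableE R)) => _ [_ [y ->] <-].
rewrite setTI; apply: open_measurable_rV; apply: open_comp; last exact: interval_open.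
by move=> z _; exact: cf.
Qed.

End line_derivative.

Section cube.
Context {R : realType} {n : nat}.

Definition cube (a : 'rV[R]_n) (l : R) : set 'rV[R]_n :=
  [set x | forall i, x ord0 i \in `]a ord0 i, a ord0 i + l[].

Lemma measurable_cube a l : measurable (cube a l).
Proof.
rewrite (_ : cube a l = \bigcap_(i in [set: 'I_n])
    (rV_coord i @^-1` `]a ord0 i, a ord0 i + l[%classic)).
  apply: fin_bigcap_measurable; first exact: finite_finset.
  move=> i _; rewrite -[X in measurable X]setTI.
  by apply: measurable_rV_coord => //; exact: measurable_itv.
by apply/seteqP; split=> x /= h i; [move=> _; exact: h|exact: (h i Logic.I)].
Qed.

Lemma lebesgue_cube_lty a l : (lebesgue_rV n (cube a l) < +oo)%E.
Proof.
apply: le_lt_trans (lebesgue_box_lty (fun i => a ord0 i) (fun i => a ord0 i + l)).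
apply: le_measure; rewrite ?inE; [exact: measurable_cube|exact: measurable_box|].
by move=> x h i; have := h i; rewrite !in_itv/= => /andP[-> /ltW ->].
Qed.

Lemma cube_bounded (f : 'rV[R]_n -> R^o) a l : continuous f ->
  [bounded f x | x in cube a l].
Proof.
move=> cf; pose K := [set x : 'rV[R]_n | forall i, x ord0 i \in `[a ord0 i, a ord0 i + l]].
have cK : compact K.
  by apply: (@rV_compact R^o _ (fun i => `[a ord0 i, a ord0 i + l]%classic)) => i; exact: segment_compact.
have : compact (f @` K) by apply: continuous_compact => //; exact: continuous_subspaceT.
move/compact_bounded => [M [Mr hM]]; exists M; split => // N MN x Qx; apply: (hM N MN).
by exists x => // i; have := Qx i; rewrite !in_itv/= => /andP[/ltW -> /ltW ->].
Qed.

Lemma cube_integrable (f : 'rV[R]_n -> R^o) a l : continuous f ->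
  (lebesgue_rV n).-integrable (cube a l) (EFin \o f).
Proof.
move=> cf; apply: measurable_bounded_integrable.
- exact: measurable_cube.
- exact: lebesgue_cube_lty.
- exact: continuous_measurable_rV.
- exact: cube_bounded.
Qed.

Definition C2_along (i : 'I_n) (f : 'rV[R]_n -> R^o) :=
  [/\ continuous f, continuous (pderiv i f), continuous (pderiv i (pderiv i f)),
      (forall x, derivable f x (delta_mx ord0 i)) &
      (forall x, derivable (pderiv i f) x (delta_mx ord0 i))].

(** g1 p - g p1 is a primitive of the integrand, and the last two hypotheses say that it vanishes at
    a and b. *)
Lemma green_line (g g1 g2 p p1 p2 : R -> R^o) (a b : R) : a < b ->
  (forall t : R, is_derive t 1 g (g1 t)) -> (forall t : R, is_derive t 1 g1 (g2 t)) ->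
  (forall t : R, is_derive t 1 p (p1 t)) -> (forall t : R, is_derive t 1 p1 (p2 t)) ->
  continuous g2 -> continuous p2 ->
  (g1 a * p a = g a * p1 a) -> (g1 b * p b = g b * p1 b) ->
  (\int[lebesgue_measure]_(t in `]a, b[) (g2 t * p t - g t * p2 t)%:E = 0)%E.
Proof.
move=> ab dg dg1 dp dp1 cg2 cp2 Ea Eb.
pose W t : R^o := g1 t * p t - g t * p1 t.
pose w t : R^o := g2 t * p t - g t * p2 t.
have dW (t : R) : is_derive t 1 W (w t).
  have := dg t; have := dg1 t; have := dp t; have := dp1 t => *.
  apply: is_derive_eq; rewrite /GRing.scale/= /w; ring.
have cw : continuous w.
  move=> t; apply: cvgB; apply: cvgM; try exact: cg2; try exact: cp2.
    exact: is_derive_continuous dp _.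
  exact: is_derive_continuous dg _.
rewrite -(@integral_itv_bndoo _ a b _ true false); last first.
  by apply/measurable_EFinP; apply: measurable_funTS; exact: continuous_measurable_fun.
rewrite (@continuous_FTC2 _ w W)//.
- by rewrite -EFinB /W Ea Eb !subrr.
- exact: continuous_subspaceT.
- have cW := is_derive_continuous dW; split.
  + by move=> t _; exact: (@ex_derive _ _ _ _ _ _ _ (dW t)).
  + by apply: cvg_at_right_filter; exact: cW.
  + by apply: cvg_at_left_filter; exact: cW.
- by move=> t _; rewrite derive1E; exact: (@derive_val _ _ _ _ _ _ _ (dW t)).
Qed.

(** The condition on the faces covers both later uses: f and g both vanish there (two sines), or g
    vanishes there with its normal derivative (a bump against a smooth function). *)
Lemma green_cube (a : 'rV[R]_n) (l : R) i (f g : 'rV[R]_n -> R^o) : 0 < l ->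
  C2_along i f -> C2_along i g ->
  (forall x : 'rV[R]_n, x ord0 i = a ord0 i \/ x ord0 i = a ord0 i + l ->
    pderiv i f x * g x = f x * pderiv i g x) ->
  \int[lebesgue_rV n]_(x in cube a l)
    (pderiv i (pderiv i f) x * g x - f x * pderiv i (pderiv i g) x) = 0.
Proof.
move=> l0 [cf cf1 cf2 df df1] [cg cg1 cg2 dg dg1] fg.
pose w x : R^o := pderiv i (pderiv i f) x * g x - f x * pderiv i (pderiv i g) x.
have cw : continuous w.
  by move=> x; exact: (cvgB (cvgM (cf2 x) (cg x)) (cvgM (cf x) (cg2 x))).
rewrite /Rintegral integral_mkcond.
rewrite (@integral_lines_eq0 _ _ i)//.
  by apply/(integrable_mkcond _ (measurable_cube a l)); exact: (cube_integrable a l cw).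
move=> x.
(* The coordinates other than i decide whether the line through x meets the cube; if it does not,
   the integrand extended by zero vanishes along it. *)
pose in' := forall j, j != i -> x ord0 j \in `]a ord0 j, a ord0 j + l[.
have [hx|hx] := pselect in'; last first.
  rewrite (eq_integral (cst 0%E)) ?integral0// => t _; rewrite patchE ifF//.
  apply/negP => /set_mem Qx; apply: hx => j ji.
  by have := Qx j; rewrite mxE (negbTE ji).
rewrite -[RHS](@green_line (fun t => f (upd i x t)) (fun t => pderiv i f (upd i x t))
   (fun t => pderiv i (pderiv i f) (upd i x t)) (fun t => g (upd i x t))
   (fun t => pderiv i g (upd i x t)) (fun t => pderiv i (pderiv i g) (upd i x t))
   (a ord0 i) (a ord0 i + l)).
- rewrite [RHS]integral_mkcond; apply: eq_integral => t _; rewrite !patchE.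
  have -> : (upd i x t \in cube a l) = (t \in `]a ord0 i, a ord0 i + l[%classic).
    apply/idP/idP; rewrite !inE/= => h; first by have := h i; rewrite mxE eqxx.
    by move=> j; rewrite mxE; case: eqVneq => [->//|]; exact: hx.
  by case: ifP.
- by rewrite ltrDl.
- by move=> t; exact: is_derive_line.
- by move=> t; exact: is_derive_line.
- by move=> t; exact: is_derive_line.
- by move=> t; exact: is_derive_line.
- by move=> t; apply: continuous_comp; [exact: continuous_upd|exact: cf2].
- by move=> t; apply: continuous_comp; [exact: continuous_upd|exact: cg2].
- by apply: fg; left; rewrite mxE eqxx.
- by apply: fg; right; rewrite mxE eqxx.
Qed.

End cube.

Lemma cvgr_prod (R : realType) T (F : set_system T) {FF : Filter F} I (r : seq I)
    (f : I -> T -> R) (l : I -> R) :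
  (forall i, f i x @[x --> F] --> l i) ->
  (fun x => \prod_(i <- r) f i x) @ F --> \prod_(i <- r) l i.
Proof.
move=> fl; elim: r => [|i r ih].
  have -> : (fun x => \prod_(i <- [::]) f i x) = cst 1 by apply/funext => y; rewrite big_nil.
  by rewrite big_nil; exact: cvg_cst.
have -> : (fun x => \prod_(j <- i :: r) f j x) = fun x => f i x * \prod_(j <- r) f j x.
  by apply/funext => y; rewrite big_cons.
by rewrite big_cons; exact: (cvgM (fl i) ih).
Qed.

(** * Products of functions of one coordinate *)

Section products.
Context {R : realType} {n : nat}.
Implicit Types (g : 'I_n -> R -> R^o) (x : 'rV[R]_n) (i : 'I_n).

Definition prodf g : 'rV[R]_n -> R^o := fun x => \prod_i g i (x ord0 i).

Definition subst_factor g i (h : R -> R^o) : 'I_n -> R -> R^o :=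
  fun j => if j == i then h else g j.

Lemma subst_factorK g i h h' : subst_factor (subst_factor g i h) i h' = subst_factor g i h'.
Proof. by apply/funext => j; rewrite /subst_factor; case: eqP. Qed.

Lemma subst_factorE g i h : subst_factor g i h i = h.
Proof. by rewrite /subst_factor eqxx. Qed.

Lemma prodf_subst g i h x :
  prodf (subst_factor g i h) x = h (x ord0 i) * \prod_(j | j != i) g j (x ord0 j).
Proof.
rewrite /prodf (bigD1 i)//= subst_factorE; congr (_ * _).
by apply: eq_bigr => j ji; rewrite /subst_factor (negbTE ji).
Qed.

Lemma subst_factor_id g i : subst_factor g i (g i) = g.
Proof. by apply/funext => j; rewrite /subst_factor; case: eqVneq => // ->. Qed.

Lemma prodfD1 g i x : prodf g x = g i (x ord0 i) * \prod_(j | j != i) g j (x ord0 j).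
Proof. by rewrite -{1}(subst_factor_id g i) prodf_subst. Qed.

Lemma is_derive_prodf g i (g' : R -> R^o) : (forall t : R, is_derive t 1 (g i) (g' t)) ->
  (forall x, derivable (prodf g) x (delta_mx ord0 i)) /\
  pderiv i (prodf g) = prodf (subst_factor g i g').
Proof.
move=> dg.
have E x t : prodf g (upd i x t) = (\prod_(j | j != i) g j (x ord0 j)) *: g i t.
  rewrite (prodfD1 g i) mxE eqxx mulrC; congr (_ * _).
  by apply: eq_bigr => j ji; rewrite mxE (negbTE ji).
have D x (t : R) : is_derive t 1 (fun s => prodf g (upd i x s))
    ((\prod_(j | j != i) g j (x ord0 j)) *: g' t).
  rewrite (_ : (fun s => _) = (\prod_(j | j != i) g j (x ord0 j)) \*: g i).
    exact: is_deriveZ.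
  by apply/funext => s; exact: E.
split => [x|].
  by rewrite -(upd_id i x) derivable_line; exact: (@ex_derive _ _ _ _ _ _ _ (D x _)).
apply/funext => x; rewrite -{1}(upd_id i x) derive_line.
by rewrite (@derive_val _ _ _ _ _ _ _ (D x _)) prodf_subst mulrC.
Qed.

Lemma continuous_prodf g : (forall i, continuous (g i)) -> continuous (prodf g).
Proof.
move=> cg x; rewrite /prodf.
have cgi i : (fun y : 'rV[R]_n => g i (y ord0 i)) @ x --> g i (x ord0 i).
  by apply: continuous_comp; [exact: coord_continuous|exact: cg].
exact: (@cvgr_prod R _ _ _ _ (index_enum _) (fun i (y : 'rV[R]_n) => g i (y ord0 i))
  (fun i => g i (x ord0 i)) cgi).
Qed.

Lemma C2_along_prodf g i (g1 g2 : R -> R^o) : (forall j, continuous (g j)) ->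
  (forall t : R, is_derive t 1 (g i) (g1 t)) ->
  (forall t : R, is_derive t 1 g1 (g2 t)) -> continuous g2 ->
  [/\ C2_along i (prodf g), pderiv i (prodf g) = prodf (subst_factor g i g1) &
      pderiv i (pderiv i (prodf g)) = prodf (subst_factor g i g2)].
Proof.
move=> cg dg dg1 cg2.
have [d1 e1] := is_derive_prodf dg.
have dg1' (t : R) : is_derive t 1 (subst_factor g i g1 i) (g2 t).
  by rewrite subst_factorE; exact: dg1.
have [d2 e2] := is_derive_prodf dg1'; rewrite subst_factorK in e2.
have cs h : continuous h -> continuous (prodf (subst_factor g i h)).
  by move=> ch; apply: continuous_prodf => j; rewrite /subst_factor; case: eqP.
rewrite /C2_along e1 e2; split => //; split => //.
- exact: continuous_prodf.
- exact: cs (is_derive_continuous dg1).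
- exact: cs.
Qed.

Lemma sin_nat_pi (k : nat) : sin (k%:R * pi) = 0 :> R.
Proof.
elim: k => [|k ih]; first by rewrite mul0r sin0.
by rewrite -natr1 mulrDl mul1r sinDpi ih oppr0.
Qed.

(** The phases c make the family stable under differentiation up to constant factors, since cos s =
    sin (s + pi / 2); smoothness then needs only continuity and derivability of its members. *)
Definition trig (k c : 'I_n -> R) : 'rV[R]_n -> R^o :=
  prodf (fun i t => sin (k i * t + c i)).

Lemma is_derive_sin_affine (k c t : R) :
  is_derive t 1 (fun s => sin (k * s + c) : R^o) (k * cos (k * t + c)).
Proof.
by apply: is_derive_eq; rewrite /GRing.scale/=; ring.
Qed.

Lemma is_derive_cos_affine (k c t : R) :
  is_derive t 1 (fun s => k * cos (k * s + c) : R^o) (- k ^+ 2 * sin (k * t + c)).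
Proof.
by apply: is_derive_eq; rewrite /GRing.scale/=; ring.
Qed.

Lemma C2_along_trig k c i : C2_along i (trig k c) /\
  pderiv i (pderiv i (trig k c)) = fun x => - k i ^+ 2 * trig k c x.
Proof.
have [||//||h _ ->] := @C2_along_prodf (fun i t => sin (k i * t + c i)) i
  (fun s => k i * cos (k i * s + c i)) (fun s => - k i ^+ 2 * sin (k i * s + c i)).
- by move=> j; exact: (is_derive_continuous (is_derive_sin_affine (k j) (c j))).
- exact: is_derive_sin_affine.
- exact: is_derive_cos_affine.
- move=> t; apply: cvgM; first exact: cvg_cst.
  exact: (is_derive_continuous (is_derive_sin_affine (k i) (c i))).
- split => //; apply/funext => x; rewrite prodf_subst.
  by rewrite [in RHS]/trig (prodfD1 _ i) mulrA.
Qed.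

Lemma pderiv_trig k c i : exists c', pderiv i (trig k c) = fun x => k i * trig k c' x.
Proof.
exists (fun j => if j == i then c i + pi / 2 else c j).
have [_ ->] := @is_derive_prodf (fun i t => sin (k i * t + c i)) i _ (is_derive_sin_affine (k i) (c i)).
apply/funext => x; rewrite prodf_subst [in RHS]/trig (prodfD1 _ i) eqxx mulrA.
rewrite addrA sinDpihalf; congr (_ * _).
by apply: eq_bigr => j ji; rewrite (negbTE ji).
Qed.

Lemma pderivZ (f : 'rV[R]_n -> R^o) (r : R) i :
  (forall x, derivable f x (delta_mx ord0 i)) ->
  pderiv i (fun x => r * f x) = fun x => r * pderiv i f x.
Proof. by move=> df; apply/funext => x; rewrite /pderiv; exact: (@deriveZ _ _ _ f r x). Qed.

Lemma smooth_trig k c : smooth (trig k c).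
Proof.
move=> s; have [r [c' ->]] : exists r c', foldr (@pderiv R n) (trig k c) s =
    fun x => r * trig k c' x.
  elim: s => [|i s [r [c' ih]]] /=; first by exists 1, c; apply/funext => x; rewrite mul1r.
  have [[_ _ _ df _] _] := C2_along_trig k c' i.
  rewrite ih pderivZ//; have [c2 ->] := pderiv_trig k c' i.
  by exists (r * k i), c2; apply/funext => x; rewrite mulrA.
have h i := (C2_along_trig k c' i).1.
split => [x|i x]; last first.
  by have [_ _ _ df _] := h i; exact: (@derivableZ _ _ _ (trig k c') r x).
have ct : continuous (trig k c').
  by apply: continuous_prodf => j; exact: (is_derive_continuous (is_derive_sin_affine (k j) (c' j))).
by apply: (@cvgM R _ _ _ (fun=> r) (trig k c') r _ _ (ct x)); exact: cvg_cst.
Qed.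

Lemma laplacian_trig k c : laplacian (trig k c) = fun x => - (\sum_i k i ^+ 2) * trig k c x.
Proof.
apply/funext => x; rewrite /laplacian -sumrN mulr_suml; apply: eq_bigr => i _.
by have [_ ->] := C2_along_trig k c i.
Qed.

End products.

(** * Completeness of the sine system *)

Section threshold.
Context {R : realType}.
Implicit Types (t : R) (n : nat).

(* Bernoulli's inequality makes this tend to 1 for t < 1/2 and to 0 for t > 1/2. *)
Definition step_approx n t : R := (1 - t ^+ n) ^+ (n * 2 ^ n).

Lemma bernoulli_le n (x : R) : -1 <= x -> 1 + n%:R * x <= (1 + x) ^+ n.
Proof.
move=> x1; elim: n => [|n ih]; first by rewrite mul0r addr0 expr0.
rewrite exprS; apply: (@le_trans _ _ ((1 + x) * (1 + n%:R * x))); last first.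
  by rewrite ler_wpM2l// -lerBlDl sub0r.
rewrite -natr1; have := sqr_ge0 x; have : 0 <= n%:R :> R by exact: ler0n.
move: n%:R => m m0 x2; have : 0 <= m * x ^+ 2 by exact: mulr_ge0.
rewrite expr2; lra.
Qed.

Lemma step_approx_itv n t : 0 <= t <= 1 -> 0 <= step_approx n t <= 1.
Proof.
move=> /andP[t0 t1]; rewrite /step_approx.
have h0 : 0 <= 1 - t ^+ n by rewrite subr_ge0 exprn_ile1.
by rewrite exprn_ge0//= exprn_ile1// lerBlDr lerDl exprn_ge0.
Qed.

(** With y = sqrt x, n y^n is at most the geometric sum of the y^i, hence at most 1 / (1 - y), and a
    factor y^n tending to 0 remains. *)
Lemma cvg_natr_expr (x : R) : 0 <= x < 1 -> n%:R * x ^+ n @[n --> \oo] --> 0.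
Proof.
move=> /andP[x0 x1]; pose y := Num.sqrt x.
have y0 : 0 <= y by exact: sqrtr_ge0.
have y1 : y < 1 by rewrite -sqrtr1 ltr_sqrt.
have yx : x = y ^+ 2 by rewrite sqr_sqrtr.
have ny n : n%:R * y ^+ n <= (1 - y)^-1.
  rewrite -[leRHS]mul1r ler_pdivlMr ?subr_gt0//.
  have -> : n%:R * y ^+ n = \sum_(i < n) y ^+ n.
    by rewrite sumr_const card_ord mulr_natl.
  apply: (@le_trans _ _ ((\sum_(i < n) y ^+ i) * (1 - y))).
    rewrite ler_wpM2r ?subr_ge0 ?(ltW y1)//; apply: ler_sum => i _.
    by apply: ler_wiXn2l; rewrite ?(ltW y1)// ltnW.
  rewrite mulrC -opprB mulNr -subrX1 opprB lerBlDr lerDl; exact: exprn_ge0.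
apply: (@cvg_squeeze0 _ _ (fun n => (1 - y)^-1 * y ^+ n)).
  move=> n; rewrite mulr_ge0 ?exprn_ge0//= yx -exprM mulnC exprM expr2 mulrA.
  by rewrite ler_wpM2r// exprn_ge0.
rewrite -[X in _ --> X](mulr0 (1 - y)^-1); apply: cvgM; first exact: cvg_cst.
by apply: cvg_expr; rewrite ger0_norm.
Qed.

(** Write N = n 2^n. Below 1/2, Bernoulli gives 1 - (1 - t^n)^N <= n (2 t)^n. From 1/2 on, (1 -
    t^n)^N (1 + t^n)^N <= 1, and Bernoulli bounds the second factor below by 1 + n (2 t)^n >= n + 1.
    The limit at 1/2 is 0, so no exceptional point remains. *)
Lemma step_approx_cvg t : 0 <= t <= 1 ->
  step_approx n t @[n --> \oo] --> ((t < 2^-1)%R%:R : R).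
Proof.
move=> /[dup] t01 /andP[t0 t1]; case: ltP => ht.
  have h : 1 - step_approx n t @[n --> \oo] --> 0.
    apply: (@cvg_squeeze0 _ _ (fun n => n%:R * (2 * t) ^+ n)).
      move=> n; have /andP[_ q1] := step_approx_itv n t01.
      rewrite subr_ge0 q1/= lerBlDr addrC -lerBlDr.
      have tn : t ^+ n <= 1 by exact: exprn_ile1.
      have := @bernoulli_le (n * 2 ^ n) (- t ^+ n); rewrite lerN2 => /(_ tn).
      by rewrite /step_approx natrM natrX exprMn mulrN mulrA.
    by apply: cvg_natr_expr; rewrite mulr_ge0//=; lra.
  rewrite (_ : (fun n => _) = fun n => 1 - (1 - step_approx n t)); last first.
    by apply/funext => n; rewrite opprB addrC subrK.
  by rewrite -[X in _ --> X]subr0; apply: cvgB => //; exact: cvg_cst.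
apply: (@cvg_squeeze0 _ _ (@harmonic R)); last exact: cvg_harmonic.
move=> n; have /andP[-> _] /= := step_approx_itv n t01.
have tn0 : 0 <= t ^+ n by exact: exprn_ge0.
have tn : t ^+ n <= 1 by exact: exprn_ile1.
have b : n.+1%:R <= (1 + t ^+ n) ^+ (n * 2 ^ n).
  apply: le_trans (bernoulli_le _ _); last by lra.
  rewrite natrM natrX -mulrA -exprMn -natr1 addrC lerD2l ler_peMr//.
  by rewrite exprn_ege1//; lra.
have : step_approx n t * (1 + t ^+ n) ^+ (n * 2 ^ n) <= 1.
  rewrite -exprMn exprn_ile1//; last by nra.
  by rewrite mulr_ge0//; lra.
have /andP[q0 _] := step_approx_itv n t01.
have n0 : 0 < n.+1%:R :> R by rewrite ltr0n.
move=> h; rewrite /harmonic/= -[X in _ <= X]mul1r ler_pdivlMr//.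
by apply: le_trans h; rewrite ler_wpM2l.
Qed.

End threshold.

Section sine_basis.
Context {R : realType} {n : nat} (a : 'rV[R]_n) (l : R).
Hypothesis l0 : 0 < l.

Let Q := cube a l.
Let mu := lebesgue_rV n : {measure set 'rV[R]_n -> \bar R}.

Definition angle i (x : 'rV[R]_n) : R := pi / l * (x ord0 i - a ord0 i).

Definition sine (k : 'I_n -> nat) : 'rV[R]_n -> R^o :=
  trig (fun i => (k i).+1%:R * (pi / l)) (fun i => - ((k i).+1%:R * (pi / l)) * a ord0 i).

Lemma sineE k x : sine k x = \prod_i sin ((k i).+1%:R * angle i x).
Proof. by apply: eq_bigr => i _; rewrite /angle; congr sin; ring. Qed.

Lemma angle_itv i x : Q x -> 0 < angle i x < pi.
Proof.
move=> /(_ i); rewrite in_itv/= => /andP[h1 h2]; have p0 := @pi_gt0 R.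
rewrite /angle mulr_gt0 ?divr_gt0 ?subr_gt0//= mulrAC ltr_pdivrMr// ltr_pM2l//.
by rewrite ltrBlDl.
Qed.

Definition sine_span (f : R -> R) := exists s : seq (R * nat),
  forall t, f t = \sum_(p <- s) p.1 * sin (p.2.+1%:R * t).

Lemma sine_spanD f g : sine_span f -> sine_span g -> sine_span (fun t => f t + g t).
Proof. by move=> [s fs] [s' gs']; exists (s ++ s') => t; rewrite big_cat fs gs'. Qed.

(* sin (k t) cos t = (sin ((k + 1) t) + sin ((k - 1) t)) / 2 *)
Lemma sine_span_cos f : sine_span f -> sine_span (fun t => f t * cos t).
Proof.
(* Index k stands for frequency k + 1. For k = 0 the lower neighbour would be sin 0, hence the
   coefficient 0. *)
move=> [s fs]; exists (flatten [seq [:: (p.1 / 2, p.2.+1); 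
  (if p.2 == 0%N then 0 else p.1 / 2, p.2.-1)] | p <- s]) => t.
rewrite fs {fs}; elim: s => [|[c k] s ih] /=; first by rewrite !big_nil mul0r.
rewrite big_cons mulrDl ih !big_cons addrA; congr (_ + _).
case: k => [|k] /=.
  by rewrite mul0r addr0 mul1r -natr1 mulrDl !mul1r sinD; field.
rewrite -(natr1 k.+2) -(natr1 k.+1) -(natr1 k).
have -> : (k%:R + 1 + 1 + 1) * t = (k%:R + 1 + 1) * t + t by ring.
have -> : (k%:R + 1) * t = (k%:R + 1 + 1) * t - t by ring.
by rewrite sinD sinB; field.
Qed.

Lemma sine_span_poly (p : {poly R}) : sine_span (fun t => sin t * p.[cos t]).
Proof.
elim/poly_ind: p => [|p c ih].
  by exists [::] => t; rewrite big_nil horner0 mulr0.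
rewrite (_ : (fun t => _) = fun t => sin t * p.[cos t] * cos t + c * sin t); last first.
  by apply/funext => t; rewrite !hornerE; ring.
apply: sine_spanD; first exact: sine_span_cos.
by exists [:: (c, 0%N)] => t; rewrite big_seq1 mul1r.
Qed.

Section test.
Variable h : 'rV[R]_n -> R.
Hypothesis ih : mu.-integrable Q (EFin \o h).

Lemma integrableM_bounded (g : 'rV[R]_n -> R) :
  measurable_fun Q g -> (forall x, Q x -> `|g x| <= 1) ->
  mu.-integrable Q (EFin \o (fun x => h x * g x)).
Proof.
move=> mg g1; apply: le_integrable ih => //; first exact: measurable_cube.
  apply/measurable_EFinP; apply: measurable_funM => //.
  by apply/measurable_EFinP; exact: (measurable_int _ ih).
move=> x Qx /=; rewrite lee_fin normrM ler_piMr//; exact: g1.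
Qed.

Lemma sine_le1 k x : `|sine k x| <= 1.
Proof.
rewrite sineE normr_prod; apply: prodr_ile1 => i _.
by rewrite normr_ge0 sin_max.
Qed.

Lemma continuous_sine k : continuous (sine k).
Proof. by apply: continuous_prodf => j; exact: (is_derive_continuous (is_derive_sin_affine _ _)). Qed.

Hypothesis h_sine : forall k, \int[mu]_(x in Q) (h x * sine k x) = 0.

(** Expanding the product of sums yields one term for each choice of a summand in every coordinate;
    each is a multiple of some [sine k], to which h is orthogonal. *)
Lemma integral_sine_span (f : 'I_n -> R -> R) : (forall i, sine_span (f i)) ->
  (\int[mu]_(x in Q) (h x * \prod_i f i (angle i x))%:E = 0)%E.
Proof.
(* All the sums are padded with zero coefficients to the common length N, so that the choices range
   over functions into 'I_N. *)
move=> /choice[s fs]; pose N := (\sum_i size (s i))%N.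
pose c i (j : 'I_N) := nth (0, 0%N) (s i) j.
have fE i t : f i t = \sum_j (c i j).1 * sin ((c i j).2.+1%:R * t).
  rewrite fs (big_nth (0, 0%N)) big_mkord.
  rewrite (big_ord_widen N (fun j => (nth (0, 0%N) (s i) j).1 *
    sin ((nth (0, 0%N) (s i) j).2.+1%:R * t))); last by rewrite /N (bigD1 i)//= leq_addr.
  rewrite big_mkcond; apply: eq_bigr => j _; case: ltnP => // sj.
  by rewrite /c nth_default// mul0r.
rewrite (eq_integral (fun x => (\sum_(phi : {ffun 'I_n -> 'I_N})
    ((\prod_i (c i (phi i)).1)%:E * (h x * sine (fun i => (c i (phi i)).2) x)%:E))%E)); last first.
  move=> x _; under eq_bigr do rewrite fE.
  rewrite bigA_distr_bigA/= mulr_sumr -sumEFin; apply: eq_bigr => phi _.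
  by rewrite -EFinM big_split/= -sineE; congr EFin; ring.
have mQ : measurable Q by exact: measurable_cube.
have ihs k : mu.-integrable Q (fun x => (h x * sine k x)%:E).
  apply: integrableM_bounded => [|x _]; last exact: sine_le1.
  exact: continuous_measurable_rV (@continuous_sine k).
rewrite integral_sum//; last by move=> phi; exact: integrableZl.
apply: big1 => phi _; rewrite integralZl//.
rewrite -[X in (_ * X)%E]fineK; last exact: integrable_fin_num.
by rewrite -/(Rintegral _ _ _) h_sine mule0.
Qed.

(** Truncating c to the side of the cube keeps the angle of the threshold in [0, pi], where cos
    decreases, and changes nothing in the comparison of c with points of the cube. *)
Definition clamp i (c : R) : R := Num.min (Num.max c (a ord0 i)) (a ord0 i + l).

Definition cut i (c : R) : R := cos (pi / l * (clamp i c - a ord0 i)).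

Lemma cos_angle_cut i c x : Q x -> (cos (angle i x) < cut i c) = (c < x ord0 i).
Proof.
move=> Qx; have /andP[h1 h2] := angle_itv i Qx.
have p0 := @pi_gt0 R; have pl0 : 0 < pi / l :> R by rewrite divr_gt0.
have := Qx i; rewrite in_itv/= => /andP[ax xb].
have al : a ord0 i <= a ord0 i + l by rewrite lerDl ltW.
have c1 : a ord0 i <= clamp i c by rewrite /clamp le_min le_max lexx orbT al.
have c2 : clamp i c <= a ord0 i + l by rewrite /clamp ge_min lexx orbT.
rewrite /cut ltr_cos ?in_itv/= ?(ltW h1) ?(ltW h2)//; last first.
  rewrite mulr_ge0 ?(ltW pl0) ?subr_ge0//= mulrAC ler_pdivrMr// ler_pM2l//.
  by rewrite lerBlDl.
rewrite /angle ltr_pM2l// ltrD2r /clamp gt_min gt_max ax andbT.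
by rewrite [_ + l < _]ltNge (ltW xb) orbF.
Qed.

Lemma cut_itv i c : -1 <= cut i c <= 1.
Proof. by rewrite cos_geN1 cos_le1. Qed.

(* A polynomial in cos (angle i x) approximating the indicator of c < x_i: on the
   cube, the angle is in ]0, pi[, where cos decreases. *)
Definition cut_poly i c m : {poly R} :=
  ((1 - 'X ^+ m) ^+ (m * 2 ^ m)) \Po ((2^-1 - cut i c / 4)%:P + 4^-1 *: 'X).

Lemma cut_polyE i c m t :
  (cut_poly i c m).[t] = step_approx m (2^-1 + (t - cut i c) / 4).
Proof.
rewrite /cut_poly horner_comp !hornerE /step_approx.
by congr ((1 - _ ^+ _) ^+ _); ring.
Qed.

(** The difference of two cosines lies in [-2, 2]; dividing by 4 and adding 1/2 fits it into [0, 1]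
    with the threshold at 1/2, where [step_approx] jumps. *)
Lemma cut_arg_itv i c t : -1 <= t <= 1 -> 0 <= 2^-1 + (t - cut i c) / 4 <= 1.
Proof. by have := cut_itv i c => /andP[? ?] /andP[? ?]; apply/andP; split; lra. Qed.

Lemma cut_poly_cvg i c x : Q x ->
  (cut_poly i c m).[cos (angle i x)] @[m --> \oo] --> ((c < x ord0 i)%R%:R : R).
Proof.
move=> Qx; under eq_fun do rewrite cut_polyE.
have := @step_approx_cvg R (2^-1 + (cos (angle i x) - cut i c) / 4).
rewrite cut_arg_itv ?cos_geN1 ?cos_le1// => /(_ isT).
rewrite (_ : (_ < 2^-1) = (c < x ord0 i))// -(cos_angle_cut _ _ Qx).
by rewrite gtrDl pmulr_llt0 ?invr_gt0// subr_lt0.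
Qed.

Lemma cut_poly_bound i c c' x m :
  `|(cut_poly i c m - cut_poly i c' m).[cos (angle i x)]| <= 1.
Proof.
rewrite hornerD hornerN !cut_polyE.
have c1 : -1 <= cos (angle i x) <= 1 by rewrite cos_geN1 cos_le1.
have /andP[p0 p1] := step_approx_itv m (cut_arg_itv i c c1).
have /andP[q0 q1] := step_approx_itv m (cut_arg_itv i c' c1).
by rewrite ler_norml; apply/andP; split; lra.
Qed.

(* Products of sin t * p(cos t) lie in the span of the sines: the weight makes the
   approximations of indicators of boxes available as test functions. *)
Definition weight x : R := \prod_i sin (angle i x).

Lemma weight_gt0 x : Q x -> 0 < weight x.
Proof. by move=> Qx; apply: prodr_gt0 => i _; apply: sin_gt0_pi; exact: angle_itv. Qed.

Lemma weight_sine : weight = sine (fun=> 0%N).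
Proof. by apply/funext => x; rewrite sineE; apply: eq_bigr => i _; rewrite mul1r. Qed.

Let hw x := h x * weight x.

Lemma integrable_weight : mu.-integrable Q (EFin \o hw).
Proof.
apply: integrableM_bounded => [|x _]; rewrite weight_sine; last exact: sine_le1.
exact: continuous_measurable_rV (@continuous_sine _).
Qed.

(** In each coordinate the difference of two approximate steps tends to the indicator of ]c i, c'
    i]. Times the sine factors of the weight, these differences are in the sine span, hence have
    integral 0 against h; dominated convergence with bound |h weight| concludes. *)
Lemma integral_weight_box (c c' : 'I_n -> R) :
  (\int[mu]_(x in Q `&` box c c') (hw x)%:E = 0)%E.
Proof.
have mQ : measurable Q by exact: measurable_cube.
have [cc|] := pselect (forall i, c i <= c' i); last first.
  move=> /existsNP[i /negP]; rewrite -ltNge => ba.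
  rewrite (_ : box c c' = set0) ?setI0 ?integral_set0//.
  apply/seteqP; split => // x /(_ i).
  by rewrite in_itv/= => /andP[/lt_le_trans /[apply]]; rewrite ltNge (ltW ba).
pose p i m := cut_poly i (c i) m - cut_poly i (c' i) m.
pose f m x := h x * \prod_i (sin (angle i x) * (p i m).[cos (angle i x)]).
have f0 m : (\int[mu]_(x in Q) (f m x)%:E = 0)%E.
  by apply: (integral_sine_span (f := fun i t => sin t * (p i m).[cos t])) => i; exact: sine_span_poly.
have fE m x : f m x = hw x * \prod_i (p i m).[cos (angle i x)].
  by rewrite /f /hw /weight big_split mulrA.
have mP m : measurable_fun Q (fun x => \prod_i (p i m).[cos (angle i x)]).
  apply: (@continuous_measurable_rV _ _ (prodf (fun i t => (p i m).[cos (pi / l * (t - a ord0 i))]))).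
  apply: continuous_prodf => i t; apply: (@continuous_comp _ _ _ _ (fun s => (p i m).[s])).
    apply: (@continuous_comp _ _ _ (fun s => pi / l * (s - a ord0 i)) cos t).
      by apply: cvgM; [exact: cvg_cst|apply: cvgB; [exact: cvg_id|exact: cvg_cst]].
    exact: continuous_cos.
  exact: continuous_horner.
have P1 m x : `|\prod_i (p i m).[cos (angle i x)]| <= 1.
  rewrite normr_prod; apply: prodr_ile1 => i _.
  by rewrite normr_ge0 cut_poly_bound.
have mhw : measurable_fun Q hw.
  by apply/measurable_EFinP; exact: (measurable_int _ integrable_weight).
have mg : measurable_fun Q (EFin \o hw) by exact/measurable_EFinP.
rewrite integral_mkcondr.
have [|||||_ _] := @dominated_convergence _ _ _ mu Q mQ (fun m x => (f m x)%:E)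
  ((EFin \o hw) \_ (box c c')) (fun x => `|(hw x)%:E|%E).
- move=> m; apply/measurable_EFinP.
  by rewrite (funext (fE m)); exact: measurable_funM.
- apply/measurable_restrict => //; first exact: measurable_box.
  exact: measurable_funS mg.
- apply: nearW => x Qx; rewrite patchE.
  have lim : f m x @[m --> \oo] -->
      hw x * \prod_i ((c i < x ord0 i)%R%:R - (c' i < x ord0 i)%R%:R).
    rewrite (funext (fE ^~ x)).
    apply: cvgM; first exact: cvg_cst.
    apply: cvgr_prod => i; rewrite /p.
    rewrite (_ : (fun m => _) = fun m => (cut_poly i (c i) m).[cos (angle i x)] -
        (cut_poly i (c' i) m).[cos (angle i x)]).
      by apply: cvgB; exact: cut_poly_cvg.
    by apply/funext => m; rewrite hornerD hornerN.
  have -> : (if x \in box c c' then (EFin \o hw) x else 0%E) =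
      (hw x * \prod_i ((c i < x ord0 i)%R%:R - (c' i < x ord0 i)%R%:R))%:E.
    case: ifPn => [/set_mem xb|xb].
      rewrite big1 ?mulr1// => i _; have := xb i; rewrite in_itv/= => /andP[-> h2].
      by rewrite ltNge h2 subr0.
    suff [i /negP] : exists i, ~ (x ord0 i \in `]c i, c' i]).
      rewrite in_itv/= negb_and => xi.
      have z : (c i < x ord0 i)%R%:R - (c' i < x ord0 i)%R%:R = 0 :> R.
        case/orP: xi => xi.
          by rewrite -leNgt in xi; rewrite !ltNge xi (le_trans xi (cc i)) subrr.
        by rewrite -ltNge in xi; rewrite xi (le_lt_trans (cc i) xi) subrr.
      by rewrite (bigD1 i)//= z mul0r mulr0.
    by apply/existsNP => h'; move/negP: xb; apply; rewrite inE.
  apply: cvg_EFin; first exact: nearW.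
  exact: lim.
- exact: integrable_abse integrable_weight.
- apply: nearW => x m Qx; rewrite fE !abse_EFin lee_fin normrM ler_piMr//.
rewrite (_ : [sequence _]_m = cst 0%E); last by apply/funext => m /=; rewrite f0.
by move=> lim0; apply: cvg_unique lim0 (cvg_cst _).
Qed.

(** A Dynkin argument: for the signed density h weight, the sets of integral 0 are stable under
    proper differences and increasing unions, and contain the boxes. *)
Lemma integral_weight0 E : measurable E -> (\int[mu]_(x in Q `&` E) (hw x)%:E = 0)%E.
Proof.
have mQ : measurable Q by exact: measurable_cube.
have mhw : measurable_fun Q (EFin \o hw) by exact: (measurable_int _ integrable_weight).
pose H := [set A | measurable A /\ (\int[mu]_(x in Q `&` A) (hw x)%:E = 0)%E].
have ndH : ndseq_closed H.
  move=> F ndF HF; have mF k : measurable (F k) by have [] := HF k.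
  have mU : measurable (\bigcup_k F k) by exact: bigcupT_measurable.
  split => //; rewrite integral_mkcondr.
  have [|||||_ _] := @dominated_convergence _ _ _ mu Q mQ (fun m => (EFin \o hw) \_ (F m))
    ((EFin \o hw) \_ (\bigcup_k F k)) (fun x => `|(hw x)%:E|%E).
  - move=> m; apply/measurable_restrict => //; exact: measurable_funS mhw.
  - by apply/measurable_restrict => //; exact: measurable_funS mhw.
  - apply: nearW => x Qx; apply: cvg_near_cst; rewrite patchE.
    case: ifPn => [/set_mem[k _ Fkx]|xU].
      exists k => // m /= km; rewrite patchE mem_set//.
      by move: Fkx; exact/subsetPset/ndF.
    apply: nearW => m; rewrite patchE memNset// => Fmx.
    by move/negP: xU; apply; rewrite inE; exists m.
  - exact: integrable_abse integrable_weight.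
  - apply: nearW => x m Qx; rewrite patchE; case: ifP => //= _.
    by rewrite lee_fin normr0.
  rewrite (_ : [sequence _]_m = cst 0%E); last first.
    by apply/funext => m /=; rewrite -integral_mkcondr; exact: (HF m).2.
  by move=> lim0; apply: cvg_unique lim0 (cvg_cst _).
have boxH : boxes `<=` H.
  move=> _ [c [c' ->]]; split; first exact: measurable_box.
  exact: integral_weight_box.
have lH : lambda_system setT H.
  split => //.
  - rewrite -(@box_cover R n); apply: ndH => [j k jk|k]; last by apply: boxH; do 2 eexists.
    apply/subsetPset => x xj i; have := xj i; rewrite !in_itv/= => /andP[h1 h2].
    have jk' : j%:R <= k%:R :> R by rewrite ler_nat.
    by rewrite (le_lt_trans _ h1) ?lerN2// (le_trans h2).
  - move=> A B BA [mA A0] [mB B0]; split; first exact: measurableD.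
    have := A0; rewrite (_ : Q `&` A = (Q `&` B) `|` (Q `&` (A `\` B))).
      rewrite integral_setU_EFin ?B0 ?add0e//.
      - exact: measurableI.
      - by apply: measurableI => //; exact: measurableD.
      - apply/measurable_EFinP; apply: measurable_funS mhw => //.
        by move=> x [[]|[]].
      - by apply/disj_setPS => x [[_ Bx] [_ [_ nBx]]].
    rewrite -setIUr; congr (_ `&` _).
    by rewrite setDUK.
rewrite measurable_boxesE => sE.
have : H E; last by case.
apply: (lambda_system_subset setI_closed_boxes lH boxH) sE => X _ x _; exact: Logic.I.
Qed.

Lemma sine_complete : {ae mu, forall x, Q x -> h x = 0}.
Proof.
have mQ : measurable Q by exact: measurable_cube.
have hw0 : ae_eq mu Q (EFin \o hw) (cst 0%E).
  apply: integral_ae_eq => //; first exact: integrable_weight.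
  move=> E EQ mE; rewrite integral0 -[E](setIidr EQ); exact: integral_weight0.
apply: filterS hw0 => x h0 Qx; have := h0 Qx => -[] /eqP.
by rewrite mulf_eq0 (gt_eqF (weight_gt0 Qx)) orbF => /eqP.
Qed.

End test.
End sine_basis.

(** * Restricted measures *)

Section restriction.
Context d (T : measurableType d) (R : realType) (mu : {measure set T -> \bar R}).
Variables (D : set T) (mD : measurable D).

Let nu : {measure set T -> \bar R} := mrestr mu mD.

Lemma mrestr_setC : nu (~` D) = 0%E.
Proof. by rewrite /nu /= /mrestr setICl measure0. Qed.

Lemma ge0_integral_mrestr (f : T -> \bar R) : measurable_fun setT f ->
  (forall x, 0 <= f x)%E -> (\int[nu]_x f x = \int[mu]_(x in D) f x)%E.
Proof.
move=> mf f0.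
rewrite (ge0_negligible_integral (measurableC mD) measurableT)// ?mrestr_setC//.
rewrite setTD setCK; apply: eq_measure_integral => A mA AD.
by rewrite /nu /= /mrestr setIidl.
Qed.

Lemma integral_mrestr (f : T -> \bar R) : measurable_fun setT f ->
  (\int[nu]_x f x = \int[mu]_(x in D) f x)%E.
Proof.
move=> mf; rewrite integralE [RHS]integralE !ge0_integral_mrestr//.
- exact: measurable_funeneg.
- exact: measurable_funepos.
Qed.

Lemma Rintegral_mrestr (f : T -> R) : measurable_fun setT f ->
  \int[nu]_x f x = \int[mu]_(x in D) f x.
Proof. by move=> mf; rewrite /Rintegral integral_mrestr//; exact/measurable_EFinP. Qed.

Lemma integrable_mrestr (f : T -> \bar R) : measurable_fun setT f ->
  nu.-integrable setT f <-> mu.-integrable D f.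
Proof.
move=> mf; have E : (\int[nu]_x `|f x| = \int[mu]_(x in D) `|f x|)%E.
  by apply: integral_mrestr; exact: measurableT_comp.
split=> /integrableP[_ h]; apply/integrableP; split => //; rewrite -?E// ?E//.
exact: measurable_funS mf.
Qed.

Lemma ae_mrestr (P : T -> Prop) :
  {ae nu, forall x, P x} <-> {ae mu, forall x, D x -> P x}.
Proof.
split=> [[N [mN N0 PN]]|[N [mN N0 PN]]].
  exists (N `&` D); split => //; first exact: measurableI.
  by move=> x /= /not_implyP[Dx Px]; split => //; exact: PN.
exists (N `|` ~` D); split.
- by apply: measurableU => //; exact: measurableC.
- rewrite /nu /= /mrestr setIUl setICl setU0.
  by apply/eqP; rewrite -measure_le0 -N0 le_measure// inE//; exact: measurableI.
- move=> x /= Px; have [Dx|] := pselect (D x); last by right.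
  by left; apply: PN => /= h; apply: Px; exact: h.
Qed.

End restriction.

(** * Square integrable functions as elements of L_2 *)

Section L2cl.
Context d (T : measurableType d) (R : realType) (nu : {measure set T -> \bar R}).

(** Total, with value 0 outside L_2, so that a class can be named without carrying a proof of square
    integrability. *)
Definition L2cl (f : T -> R) : L2 nu :=
  if pselect (f \in Lfun nu 2%:E) is left h then L2_class (Lfun_Sub (lee1n 2) h) else 0.

Lemma L2clE f : f \in Lfun nu 2%:E -> {ae nu, forall x, L2cl f x = f x}.
Proof. by move=> fL; rewrite /L2cl; case: pselect => // h; exact: L2_classE. Qed.

Lemma L2clP f (u : L2 nu) : measurable_fun setT f -> {ae nu, forall x, f x = u x} ->
  L2cl f = u.
Proof.
move=> mf fu; have fL : f \in Lfun nu 2%:E.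
  apply: Lfun2P => //; apply: (@le_lt_trans _ _ (nsq (L2dot nu) u)%:E); last exact: ltry.
  rewrite -integral_sqr_nsq le_eqVlt; apply/orP; left; apply/eqP.
  apply: ge0_ae_eq_integral => //.
  - by apply/measurable_EFinP; exact: measurable_funX.
  - by apply/measurable_EFinP; apply: measurable_funX; exact: measurable_L2.
  - by move=> x _; rewrite lee_fin sqr_ge0.
  - by move=> x _; rewrite lee_fin sqr_ge0.
  - by apply: filterS fu => x ->.
by apply: L2_ext; apply: filterS2 (L2clE fL) fu => x -> ->.
Qed.

Lemma L2cl_dot f (u : L2 nu) : f \in Lfun nu 2%:E ->
  L2dot nu (L2cl f) u = \int[nu]_x (f x * u x).
Proof.
move=> fL; apply: eq_Rintegral_ae => //.
- by apply: measurable_funM; exact: measurable_L2.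
- apply: measurable_funM; last exact: measurable_L2.
  by move: fL => /andP[]; rewrite inE.
- by apply: filterS (L2clE fL) => x ->.
Qed.

Lemma L2cl_nsqB f (u : L2 nu) : f \in Lfun nu 2%:E ->
  (nsq (L2dot nu) (L2cl f - u))%:E = (\int[nu]_x ((f x - u x) ^+ 2)%:E)%E.
Proof.
move=> fL; have mf : measurable_fun setT f by move: fL => /andP[]; rewrite inE.
rewrite -integral_sqr_diff; apply: ge0_ae_eq_integral => //.
- by apply/measurable_EFinP; apply: measurable_funX; apply: measurable_funB; exact: measurable_L2.
- by apply/measurable_EFinP; apply: measurable_funX; apply: measurable_funB => //; exact: measurable_L2.
- by move=> x _; rewrite lee_fin sqr_ge0.
- by move=> x _; rewrite lee_fin sqr_ge0.
- by apply: filterS (L2clE fL) => x ->.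
Qed.

End L2cl.

Lemma ge0_integral_sqrD d (T : measurableType d) (R : realType)
    (mu : {measure set T -> \bar R}) (D : set T) (f g : T -> R) : measurable D ->
  measurable_fun D f -> measurable_fun D g ->
  (\int[mu]_(x in D) ((f x + g x) ^+ 2)%:E <=
   2%:E * (\int[mu]_(x in D) (f x ^+ 2)%:E + \int[mu]_(x in D) (g x ^+ 2)%:E))%E.
Proof.
move=> mD mf mg.
have mf2 : measurable_fun D (fun x => (f x ^+ 2)%:E) by apply/measurable_EFinP; exact: measurable_funX.
have mg2 : measurable_fun D (fun x => (g x ^+ 2)%:E) by apply/measurable_EFinP; exact: measurable_funX.
have s0 (h : T -> R) x : D x -> (0 <= (h x ^+ 2)%:E)%E by rewrite lee_fin sqr_ge0.
rewrite -ge0_integralD//; try exact: s0.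
rewrite -ge0_integralZl//; last 2 first.
- exact: emeasurable_funD.
- by move=> x Dx; apply: adde_ge0; exact: s0.
apply: ge0_le_integral => //.
- by move=> x _; rewrite lee_fin sqr_ge0.
- by apply/measurable_EFinP; apply: measurable_funX; exact: measurable_funD.
- by apply: measurable_funeM; exact: emeasurable_funD.
- move=> x _; rewrite -EFinD -EFinM lee_fin.
  by have := sqr_ge0 (f x - g x); rewrite !expr2; nra.
Qed.

(** * Lipschitz boundaries are null *)

Section boundary.
Context {R : realType} {d : nat}.
Implicit Types Omega : lipschitz_domain R d.

Lemma measurable_closure_rV (A : set 'rV[R]_d) : measurable (closure A).
Proof.
rewrite -(setCK (closure A)); apply: measurableC; apply: open_measurable_rV.
by rewrite openC; exact: closed_closure.
Qed.

Lemma measurable_dom Omega : measurable (dom_set Omega).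
Proof. exact: open_measurable_rV (@dom_open _ _ Omega). Qed.

(* Infinitely many disjoint translates of B by multiples of e fit in a bounded box. *)
Lemma translates_null (B : set 'rV[R]_d) (e c : 'rV[R]_d) (r : R) :
  measurable B -> B `<=` ball c r ->
  (forall x t, B x -> B (x + t *: e) -> t = 0) -> lebesgue_rV d B = 0%E.
Proof.
move=> mB Br Be.
(* Infinitely many distinct multiples, all in [0, 1], so that one box contains all the
   translates. *)
pose t (j : nat) : R := j.+1%:R^-1.
pose F j := [set x | B (x + - t j *: e)].
have mF j : measurable (F j).
  by rewrite -[X in measurable X]setTI; exact: measurable_shift_rV.
have t_inj j k : t j = t k -> j = k.
  by move=> /invr_inj /eqP; rewrite eqr_nat => /eqP[].
have trF : trivIset setT F.
  apply/trivIsetP => j k _ _ jk; apply/seteqP; split => // x [Fj Fk].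
  move/eqP: jk; apply; apply: t_inj; apply/eqP; rewrite -subr_eq0; apply/eqP.
  apply: (Be _ _ Fj); rewrite -addrA -scalerDl.
  by have -> : - t j + (t j - t k) = - t k by ring.
pose s := r + \sum_i `|e ord0 i|.
have Fs j : F j `<=` box (fun i => c ord0 i - s) (fun i => c ord0 i + s).
  move=> x /Br[_ h] i; have := h ord0 i; rewrite /ball/= !mxE ltr_norml => /andP[h1 h2].
  have ei : `|t j * e ord0 i| <= \sum_i `|e ord0 i|.
    rewrite normrM ger0_norm; last by rewrite invr_ge0.
    apply: (@le_trans _ _ `|e ord0 i|).
      by rewrite ler_piMl// invf_le1// ler1n.
    by rewrite (bigD1 i)//= lerDl sumr_ge0.
  move: ei; rewrite ler_norml => /andP[e1 e2]; rewrite in_itv/= /s.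
  by apply/andP; split; lra.
have Bfin : (lebesgue_rV d B < +oo)%E.
  have : (lebesgue_rV d (F 0%N) < +oo)%E.
    apply: le_lt_trans (lebesgue_box_lty _ _).
    by apply: le_measure (Fs 0%N); rewrite inE//; exact: measurable_box.
  by rewrite lebesgue_rV_shift.
have Bfn : lebesgue_rV d B \is a fin_num by rewrite ge0_fin_numE.
pose M := fine (lebesgue_rV d (box (fun i => c ord0 i - s) (fun i => c ord0 i + s))).
have bM n : n%:R * fine (lebesgue_rV d B) <= M.
  rewrite -lee_fin EFinM fineK// /M fineK; last first.
    by rewrite ge0_fin_numE ?lebesgue_box_lty.
  apply: (@le_trans _ _ (lebesgue_rV d (\big[setU/set0]_(j < n) F j))); last first.
    apply: le_measure; rewrite ?inE; [by apply: bigsetU_measurable|exact: measurable_box|].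
    by rewrite -bigcup_mkord => x [j _ /Fs].
  rewrite measure_bigsetU//.
  rewrite (eq_bigr (fun=> lebesgue_rV d B)); last by move=> i _; exact: (lebesgue_rV_shift (- t i *: e) mB).
  by rewrite -(fineK Bfn) sumEFin sumr_const card_ord -EFinM mulr_natl.
apply/eqP; rewrite -(fineK Bfn) eqe eq_le; apply/andP; split; last exact: fine_ge0.
rewrite leNgt; apply/negP => b0.
have := bM (Num.truncn (M / fine (lebesgue_rV d B))).+1.
by rewrite leNgt -ltr_pdivrMr// truncnS_gt.
Qed.

(** Near a boundary point, closure Omega minus Omega lies on the graph of phi: a point below it
    would be in Omega, and a point above it has a neighbourhood free of Omega. A graph meets each
    line in its vertical direction at most once, so [translates_null] applies. *)
Lemma lipschitz_boundary_null Omega :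
  (lebesgue_rV d).-negligible (closure Omega `\` Omega).
Proof.
apply: locally_negligible => p [cp np].
have [V [Q [i [phi [[oV Vp] QQ lphi VO]]]]] : exists (V : set 'rV[R]_d) (Q : 'M[R]_d)
    (i : 'I_d) (phi : 'rV[R]_d.-1 -> R^o), [/\ open_nbhs p V, Q *m Q^T = 1%:M, lipschitz phi &
    forall y, V y -> dom_set Omega y <-> (y *m Q) ord0 i < phi (col' i (y *m Q))].
  by apply: (@dom_lipschitz _ _ Omega); split => // /interior_subset.
have /nbhs_ballP[r /= r0 prV] := open_nbhs_nbhs (conj oV Vp).
exists r => //; set B := _ `&` _.
have mB : measurable B.
  apply: measurableI.
    by apply: measurableD; [exact: measurable_closure_rV|exact: measurable_dom].
  by apply: open_measurable_rV; exact: ball_open.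
have Bgraph y : B y -> (y *m Q) ord0 i = phi (col' i (y *m Q)).
  move=> [[cy nOy] /prV Vy]; apply/eqP; rewrite eq_le !leNgt; apply/andP; split; last first.
    by apply/negP => /(VO _ Vy).
  apply/negP => yG.
  have := @below_graph_open R d Q i phi lphi; set G := [set _ | _] => oG.
  have [z [Oz [Vz Gz]]] : dom_set Omega `&` (V `&` G) !=set0.
    by apply: cy; apply: filterI; apply: open_nbhs_nbhs.
  by move/(VO _ Vz) : Oz; rewrite ltNge ltW.
apply/negligibleP => //.
apply: (@translates_null B (delta_mx ord0 i *m Q^T) p r) => //; first by move=> x [].
move=> x t Bx Bxt; have := Bgraph _ Bxt; have := Bgraph _ Bx.
rewrite mulmxDl -scalemxAl -mulmxA (mulmx1C QQ) mulmx1.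
have -> : col' i (x *m Q + t *: delta_mx ord0 i) = col' i (x *m Q).
  apply/rowP => k; rewrite !mxE [_ == i]eq_sym (negbTE (neq_lift _ _)) andbF mulr0.
  by rewrite addr0.
move=> Ex /eqP; rewrite -Ex !mxE !eqxx mulr1 -subr_eq0 addrAC subrr add0r.
by move/eqP.
Qed.

(** Since the closed elements cover Omega, a point outside all the open ones lies on the boundary of
    one of them. *)
Lemma mesh_null Omega (M : mesh Omega) :
  (lebesgue_rV d).-negligible (Omega `\` \bigcup_i M i).
Proof.
pose F k := if insub k is Some i then closure (M i) `\` M i else set0.
apply: (@negligibleS _ _ _ _ (\bigcup_k F k)); last first.
  apply: negligible_bigcup => k; rewrite /F; case: insub => [i|]; last exact: negligible_set0.
  exact: lipschitz_boundary_null.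
move=> x [Ox nM]; have : closure Omega x by exact: subset_closure.
rewrite (@mesh_cover _ _ _ M) => -[i _ cx]; exists i => //=.
by rewrite /F valK; split => // Mx; apply: nM; exists i.
Qed.

End boundary.

(** * The Laplacian as a closed operator *)

Lemma cvgr_sum (R : realType) T (F : set_system T) {FF : Filter F} I (r : seq I)
    (f : I -> T -> R) (l : I -> R) :
  (forall i, f i x @[x --> F] --> l i) ->
  (fun x => \sum_(i <- r) f i x) @ F --> \sum_(i <- r) l i.
Proof.
move=> fl; elim: r => [|i r ih].
  have -> : (fun x => \sum_(i <- [::]) f i x) = cst 0 by apply/funext => y; rewrite big_nil.
  by rewrite big_nil; exact: cvg_cst.
have -> : (fun x => \sum_(j <- i :: r) f j x) = fun x => f i x + \sum_(j <- r) f j x.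
  by apply/funext => y; rewrite big_cons.
by rewrite big_cons; exact: (cvgD (fl i) ih).
Qed.

Section smooth_functions.
Context {R : realType} {d : nat}.
Implicit Types f g : 'rV[R]_d -> R^o.

Lemma smooth_continuous f : smooth f -> continuous f.
Proof. by move=> sf; exact: (sf [::]).1. Qed.

Lemma smooth_C2_along f i : smooth f -> C2_along i f.
Proof.
move=> sf; split.
- exact: (sf [::]).1.
- exact: (sf [:: i]).1.
- exact: (sf [:: i; i]).1.
- by move=> x; exact: (sf [::]).2.
- by move=> x; exact: (sf [:: i]).2.
Qed.

Lemma continuous_laplacian f : smooth f -> continuous (laplacian f).
Proof.
move=> sf x; apply: (@cvgr_sum R 'rV[R]_d (nbhs x) (nbhs_filter x) _ (index_enum _) (fun i y => pderiv i (pderiv i f) y)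
  (fun i => pderiv i (pderiv i f) x)) => i.
exact: (sf [:: i; i]).1.
Qed.

Lemma pderiv_lin f g a i : (forall x, derivable f x (delta_mx ord0 i)) ->
  (forall x, derivable g x (delta_mx ord0 i)) ->
  pderiv i (fun x => a * f x + g x) = fun x => a * pderiv i f x + pderiv i g x.
Proof.
move=> df dg; apply/funext => x; rewrite /pderiv.
have h := @deriveD R _ _ (a \*: f) g x (delta_mx ord0 i) 
  (@derivableZ R _ _ f a x (delta_mx ord0 i) (df x)) (dg x).
by rewrite [LHS]h deriveZ.
Qed.

Lemma foldr_pderiv_lin f g a s : smooth f -> smooth g ->
  foldr (@pderiv R d) (fun x => a * f x + g x) s =
  fun x => a * foldr (@pderiv R d) f s x + foldr (@pderiv R d) g s x.
Proof.
move=> sf sg; elim: s => //= i s ->; rewrite pderiv_lin// => x.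
  exact: (sf s).2.
exact: (sg s).2.
Qed.

Lemma smooth_lin f g a : smooth f -> smooth g -> smooth (fun x => a * f x + g x).
Proof.
move=> sf sg s; rewrite foldr_pderiv_lin//; split => [x|i x].
  have h := @cvgM R _ _ _ (fun=> a) _ a _ (cvg_cst _) ((sf s).1 x).
  exact: (cvgD (h (nbhs_filter x) (nbhs_filter x)) ((sg s).1 x)).
exact: (derivableD (@derivableZ R _ _ _ a x _ ((sf s).2 i x)) ((sg s).2 i x)).
Qed.

Lemma laplacian_lin f g a : smooth f -> smooth g ->
  laplacian (fun x => a * f x + g x) = fun x => a * laplacian f x + laplacian g x.
Proof.
move=> sf sg; apply/funext => x; rewrite /laplacian mulr_sumr -big_split/=.
apply: eq_bigr => i _.
by have := @foldr_pderiv_lin f g a [:: i; i] sf sg => /= ->.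
Qed.

End smooth_functions.

Section has_laplacian.
Context {R : realType} {d : nat} (D : set 'rV[R]_d) (mD : measurable D).
Implicit Types z g : 'rV[R]_d -> R.

Let mu := lebesgue_rV d : {measure set 'rV[R]_d -> \bar R}.

(** In this form, limits of pairs (z, g) are handled without extracting diagonal sequences. *)
Lemma has_laplacianP z g : has_laplacian D z g <-> forall e : R, 0 < e ->
  exists phi, [/\ smooth phi,
    (\int[mu]_(x in D) ((phi x - z x) ^+ 2)%:E < e%:E)%E &
    (\int[mu]_(x in D) ((laplacian phi x - g x) ^+ 2)%:E < e%:E)%E].
Proof.
split=> [[phi [sphi h1 h2]] e e0|h].
  have near_lt (u : (\bar R)^nat) : u n @[n --> \oo] --> 0%E ->
      \forall n \near \oo, (u n < e%:E)%E.
    by move=> u0; apply: (u0 [set x | (x < e%:E)%E]); apply: open_ereal_lt'; rewrite lte_fin.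
  have [n [] hn1 hn2] : exists n,
      (\int[mu]_(x in D) ((phi n x - z x) ^+ 2)%:E < e%:E)%E /\
      (\int[mu]_(x in D) ((laplacian (phi n) x - g x) ^+ 2)%:E < e%:E)%E.
    have [N _ hN] : \forall n \near \oo,
      (\int[mu]_(x in D) ((phi n x - z x) ^+ 2)%:E < e%:E)%E /\
      (\int[mu]_(x in D) ((laplacian (phi n) x - g x) ^+ 2)%:E < e%:E)%E.
      by apply: filterI; exact: near_lt.
    by exists N; apply: hN => /=.
  by exists (phi n).
have /choice[phi hphi] (n : nat) : exists phi, [/\ smooth phi,
    (\int[mu]_(x in D) ((phi x - z x) ^+ 2)%:E < (n.+1%:R^-1)%:E)%E &
    (\int[mu]_(x in D) ((laplacian phi x - g x) ^+ 2)%:E < (n.+1%:R^-1)%:E)%E].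
  by apply: h; rewrite invr_gt0.
have lim0 (u : (\bar R)^nat) : (forall n, (0 <= u n)%E) ->
    (forall n, (u n < (n.+1%:R^-1)%:E)%E) -> u n @[n --> \oo] --> 0%E.
  move=> u0 un; apply: (@squeeze_cvge _ _ _ _ (cst 0%E) _ (fun n => (n.+1%:R^-1)%:E)).
  - by apply: nearW => n; rewrite u0/= ltW.
  - exact: cvg_cst.
  - by apply: cvg_EFin; [exact: nearW|exact: cvg_harmonic].
have s0 (f : 'rV[R]_d -> R) : (0 <= \int[mu]_(x in D) (f x ^+ 2)%:E)%E.
  by apply: integral_ge0 => x _; rewrite lee_fin sqr_ge0.
exists phi; split => [n||].
- by have [] := hphi n.
- by apply: lim0 => n; [exact: s0|have [] := hphi n].
- by apply: lim0 => n; [exact: s0|have [] := hphi n].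
Qed.

Lemma integral_sqrD_lt (f g : 'rV[R]_d -> R) e :
  measurable_fun D f -> measurable_fun D g ->
  (\int[mu]_(x in D) (f x ^+ 2)%:E < (e / 4)%:E)%E ->
  (\int[mu]_(x in D) (g x ^+ 2)%:E < (e / 4)%:E)%E ->
  (\int[mu]_(x in D) ((f x + g x) ^+ 2)%:E < e%:E)%E.
Proof.
move=> mf mg hf hg; apply: le_lt_trans (ge0_integral_sqrD mu mD mf mg) _.
have -> : e%:E = (2%:E * ((e / 4)%:E + (e / 4)%:E))%E.
  by rewrite -EFinD -EFinM; congr EFin; field.
by rewrite lte_pmul2l// lteD.
Qed.

Lemma integral_sqrZ (f : 'rV[R]_d -> R) a : measurable_fun D f ->
  (\int[mu]_(x in D) ((a * f x) ^+ 2)%:E = (a ^+ 2)%:E * \int[mu]_(x in D) (f x ^+ 2)%:E)%E.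
Proof.
move=> mf; rewrite -ge0_integralZl ?lee_fin ?sqr_ge0//.
- by apply: eq_integral => x _; rewrite exprMn EFinM.
- by apply/measurable_EFinP; exact: measurable_funX.
- by move=> x _; rewrite lee_fin sqr_ge0.
Qed.

Lemma has_laplacian_lin z g z' g' a :
  measurable_fun D z -> measurable_fun D g -> measurable_fun D z' -> measurable_fun D g' ->
  has_laplacian D z g -> has_laplacian D z' g' ->
  has_laplacian D (fun x => a * z x + z' x) (fun x => a * g x + g' x).
Proof.
move=> mz mg mz' mg' /has_laplacianP h /has_laplacianP h'; apply/has_laplacianP => e e0.
(* Then a^2 e1 < e / 4, also when a = 0. *)
pose e1 := e / 4 / (a ^+ 2 + 1).
have a1 : 0 < a ^+ 2 + 1 by rewrite ltr_wpDl ?sqr_ge0.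
have e10 : 0 < e1 by rewrite !divr_gt0.
have [phi [sphi p1 p2]] := h _ e10.
have e4 : 0 < e / 4 by rewrite divr_gt0.
have [psi [spsi q1 q2]] := h' _ e4.
have small (f : 'rV[R]_d -> R) : measurable_fun D f ->
    (\int[mu]_(x in D) (f x ^+ 2)%:E < e1%:E)%E ->
    (\int[mu]_(x in D) ((a * f x) ^+ 2)%:E < (e / 4)%:E)%E.
  move=> mf fe; rewrite integral_sqrZ//.
  apply: (@le_lt_trans _ _ ((a ^+ 2)%:E * e1%:E)%E).
    by apply: lee_wpmul2l; [rewrite lee_fin sqr_ge0|exact: ltW].
  rewrite -EFinM lte_fin /e1 mulrCA gtr_pMr// ltr_pdivrMr// mul1r ltrDl.
  exact: ltr01.
have mphi := continuous_measurable_rV (D := D) (smooth_continuous sphi).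
have mpsi := continuous_measurable_rV (D := D) (smooth_continuous spsi).
have mlphi := continuous_measurable_rV (D := D) (continuous_laplacian sphi).
have mlpsi := continuous_measurable_rV (D := D) (continuous_laplacian spsi).
have comb (p q f f' : 'rV[R]_d -> R) : measurable_fun D p -> measurable_fun D q ->
    measurable_fun D f -> measurable_fun D f' ->
    (\int[mu]_(x in D) ((p x - f x) ^+ 2)%:E < e1%:E)%E ->
    (\int[mu]_(x in D) ((q x - f' x) ^+ 2)%:E < (e / 4)%:E)%E ->
    (\int[mu]_(x in D) ((a * p x + q x - (a * f x + f' x)) ^+ 2)%:E < e%:E)%E.
  move=> mp mq mf mf' hp hq.
  rewrite (eq_integral (fun x => ((a * (p x - f x) + (q x - f' x)) ^+ 2)%:E)); last first.
    by move=> x _; congr ((_ ^+ 2)%:E); ring.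
  apply: integral_sqrD_lt => //.
  - by apply: measurable_funM => //; exact: measurable_funB.
  - exact: measurable_funB.
  - by apply: small => //; exact: measurable_funB.
exists (fun x => a * phi x + psi x); split; first exact: smooth_lin.
  exact: comb.
by rewrite laplacian_lin//; exact: comb.
Qed.

Lemma has_laplacian_closed z g : measurable_fun D z -> measurable_fun D g ->
  (forall e : R, 0 < e -> exists z' g', [/\ measurable_fun D z', measurable_fun D g',
    has_laplacian D z' g',
    (\int[mu]_(x in D) ((z' x - z x) ^+ 2)%:E < e%:E)%E &
    (\int[mu]_(x in D) ((g' x - g x) ^+ 2)%:E < e%:E)%E]) ->
  has_laplacian D z g.
Proof.
move=> mz mg h; apply/has_laplacianP => e e0.
have e4 : 0 < e / 4 by rewrite divr_gt0.
have [z' [g' [mz' mg' /has_laplacianP/(_ _ e4)[phi [sphi p1 p2]] h1 h2]]] := h _ e4.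
have mphi := continuous_measurable_rV (D := D) (smooth_continuous sphi).
have mlphi := continuous_measurable_rV (D := D) (continuous_laplacian sphi).
have comb (p f f' : 'rV[R]_d -> R) : measurable_fun D p ->
    measurable_fun D f -> measurable_fun D f' ->
    (\int[mu]_(x in D) ((p x - f x) ^+ 2)%:E < (e / 4)%:E)%E ->
    (\int[mu]_(x in D) ((f x - f' x) ^+ 2)%:E < (e / 4)%:E)%E ->
    (\int[mu]_(x in D) ((p x - f' x) ^+ 2)%:E < e%:E)%E.
  move=> mp mf mf' hp hq.
  rewrite (eq_integral (fun x => ((p x - f x + (f x - f' x)) ^+ 2)%:E)); last first.
    by move=> x _; rewrite addrA subrK.
  by apply: integral_sqrD_lt => //; exact: measurable_funB.
by exists phi; split => //; [exact: (comb phi z' z)|exact: (comb (laplacian phi) g' g)].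
Qed.

(** The pair (z, g) approximates (z', g') with error 0, so this is a case of closedness. *)
Lemma has_laplacian_ae z g z' g' :
  measurable_fun D z -> measurable_fun D g -> measurable_fun D z' -> measurable_fun D g' ->
  {ae mu, forall x, D x -> z x = z' x} -> {ae mu, forall x, D x -> g x = g' x} ->
  has_laplacian D z g -> has_laplacian D z' g'.
Proof.
move=> mz mg mz' mg' zz gg h; apply: has_laplacian_closed => // e e0.
have z0 (f f' : 'rV[R]_d -> R) : measurable_fun D f -> measurable_fun D f' ->
    {ae mu, forall x, D x -> f x = f' x} ->
    (\int[mu]_(x in D) ((f x - f' x) ^+ 2)%:E < e%:E)%E.
  move=> mf mf' ff; rewrite (ge0_ae_eq_integral (g := cst 0%E))//.
  - by rewrite integral0 lte_fin.
  - by apply/measurable_EFinP; apply: measurable_funX; exact: measurable_funB.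
  - by move=> x _; rewrite lee_fin sqr_ge0.
  - by apply: filterS ff => x + Dx => ->//; rewrite subrr expr0n.
by exists z, g; split => //; exact: z0.
Qed.

Lemma has_laplacianS (D' : set 'rV[R]_d) z g : measurable D' -> D' `<=` D ->
  measurable_fun D z -> measurable_fun D g ->
  has_laplacian D z g -> has_laplacian D' z g.
Proof.
move=> mD' sD mz mg [phi [sphi h1 h2]]; exists phi; split => //.
  apply: (@squeeze_cvge _ _ _ _ (cst 0%E) _ _ _ _ _ h1); last exact: cvg_cst.
  apply: nearW => n; rewrite integral_ge0/=; last by move=> x _; rewrite lee_fin sqr_ge0.
  apply: ge0_subset_integral => //.
    apply/measurable_EFinP; apply: measurable_funX; apply: measurable_funB => //.
    exact: continuous_measurable_rV (smooth_continuous (sphi n)).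
  by move=> x _; rewrite lee_fin sqr_ge0.
apply: (@squeeze_cvge _ _ _ _ (cst 0%E) _ _ _ _ _ h2); last exact: cvg_cst.
apply: nearW => n; rewrite integral_ge0/=; last by move=> x _; rewrite lee_fin sqr_ge0.
apply: ge0_subset_integral => //.
  apply/measurable_EFinP; apply: measurable_funX; apply: measurable_funB => //.
  exact: continuous_measurable_rV (continuous_laplacian (sphi n)).
by move=> x _; rewrite lee_fin sqr_ge0.
Qed.

End has_laplacian.

(** * Green's formula for L_2 Laplacians on a cube *)

Section cube_L2.
Context {R : realType} {d : nat} (a : 'rV[R]_d) (l : R).
Hypothesis l0 : 0 < l.

Let mu := lebesgue_rV d : {measure set 'rV[R]_d -> \bar R}.
Let Q := cube a l.
Let mQ := measurable_cube a l.
Let nu : {measure set 'rV[R]_d -> \bar R} := mrestr mu mQ.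

Lemma Lfun_cube (f : 'rV[R]_d -> R^o) : continuous f -> f \in Lfun nu 2%:E.
Proof.
move=> cf; have mf : measurable_fun setT f by exact: continuous_measurable_rV.
apply: Lfun2P => //; rewrite integral_mrestr; last first.
  by apply/measurable_EFinP; exact: measurable_funX.
have cf2 : continuous (fun x => f x ^+ 2 : R^o).
  by move=> x; exact: (cvgM (cf x) (cf x)).
exact: integrable_lty (cube_integrable a l cf2).
Qed.

Lemma Rintegral_cube_sum I (r : seq I) (f : I -> 'rV[R]_d -> R^o) :
  (forall i, continuous (f i)) ->
  \int[mu]_(x in Q) (\sum_(i <- r) f i x) = \sum_(i <- r) \int[mu]_(x in Q) f i x.
Proof.
move=> cf; elim: r => [|i r ih].
  rewrite big_nil -[RHS](Rintegral_set0 mu (fun=> 0)).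
  by rewrite /Rintegral integral_set0; under eq_integral do rewrite big_nil; rewrite integral0.
rewrite big_cons -ih -RintegralD//.
- by apply: eq_Rintegral => x _; rewrite big_cons.
- exact: (cube_integrable a l (cf i)).
- apply: (@cube_integrable _ _ (fun x => \sum_(i <- r) f i x)) => x.
  exact: (@cvgr_sum R 'rV[R]_d (nbhs x) (nbhs_filter x) _ r f (fun i => f i x) (fun i => cf i x)).
Qed.

Lemma green_laplacian (f g : 'rV[R]_d -> R^o) :
  (forall i, C2_along i f) -> (forall i, C2_along i g) ->
  (forall i (x : 'rV[R]_d), x ord0 i = a ord0 i \/ x ord0 i = a ord0 i + l ->
    pderiv i f x * g x = f x * pderiv i g x) ->
  continuous f -> continuous g -> continuous (laplacian f) -> continuous (laplacian g) ->
  \int[mu]_(x in Q) (laplacian f x * g x) = \int[mu]_(x in Q) (f x * laplacian g x).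
Proof.
move=> f2 g2 fg cf cg clf clg; apply/eqP; rewrite -subr_eq0 -RintegralB//; last 2 first.
- by apply: (@cube_integrable _ _ (fun x => laplacian f x * g x)) => x; exact: (cvgM (clf x) (cg x)).
- by apply: (@cube_integrable _ _ (fun x => f x * laplacian g x)) => x; exact: (cvgM (cf x) (clg x)).
rewrite (@eq_Rintegral _ _ _ _ _ (fun x => \sum_i
    (pderiv i (pderiv i f) x * g x - f x * pderiv i (pderiv i g) x))); last first.
  by move=> x _; rewrite sumrB -mulr_suml -mulr_sumr.
rewrite (Rintegral_cube_sum (index_enum _)
  (f := fun i x => pderiv i (pderiv i f) x * g x - f x * pderiv i (pderiv i g) x)); last first.
  move=> i x; have [cf0 _ cf2 _ _] := f2 i; have [cg0 _ cg2 _ _] := g2 i.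
  exact: (cvgB (cvgM (cf2 x) (cg0 x)) (cvgM (cf0 x) (cg2 x))).
by rewrite big1// => i _; apply: green_cube => //; exact: fg.
Qed.

Lemma L2cl_dot2 (f g : 'rV[R]_d -> R) : f \in Lfun nu 2%:E -> g \in Lfun nu 2%:E ->
  L2dot nu (L2cl nu f) (L2cl nu g) = \int[mu]_(x in Q) (f x * g x).
Proof.
move=> fL gL; rewrite L2cl_dot//.
have mf : measurable_fun setT f by move: fL => /andP[]; rewrite inE.
have mg : measurable_fun setT g by move: gL => /andP[]; rewrite inE.
rewrite (@eq_Rintegral_ae _ _ _ _ _ _ (fun x => f x * g x))//.
- by rewrite Rintegral_mrestr//; exact: measurable_funM.
- by apply: measurable_funM => //; exact: measurable_L2.
- exact: measurable_funM.
- by apply: filterS (L2clE gL) => x ->.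
Qed.

Lemma L2cl_nsqB2 (f g : 'rV[R]_d -> R) : f \in Lfun nu 2%:E -> g \in Lfun nu 2%:E ->
  (\int[mu]_(x in Q) ((f x - g x) ^+ 2)%:E)%E =
  (nsq (L2dot nu) (L2cl nu f - L2cl nu g))%:E.
Proof.
move=> fL gL; have mf : measurable_fun setT f by move: fL => /andP[]; rewrite inE.
have mg : measurable_fun setT g by move: gL => /andP[]; rewrite inE.
rewrite L2cl_nsqB// -(ge0_integral_mrestr mu mQ).
- apply: ge0_ae_eq_integral => //.
  + by apply/measurable_EFinP; apply: measurable_funX; exact: measurable_funB.
  + by apply/measurable_EFinP; apply: measurable_funX; apply: measurable_funB => //; exact: measurable_L2.
  + by move=> x _; rewrite lee_fin sqr_ge0.
  + by move=> x _; rewrite lee_fin sqr_ge0.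
  + by apply: filterS (L2clE gL) => x ->.
- by apply/measurable_EFinP; apply: measurable_funX; exact: measurable_funB.
- by move=> x; rewrite lee_fin sqr_ge0.
Qed.

Lemma L2cl_cvg (phi : nat -> 'rV[R]_d -> R^o) z : z \in Lfun nu 2%:E ->
  (forall n, continuous (phi n)) ->
  (\int[mu]_(x in Q) ((phi n x - z x) ^+ 2)%:E)%E @[n --> \oo] --> 0%E ->
  ip_cvg (L2dot nu) (fun n => L2cl nu (phi n)) (L2cl nu z).
Proof.
move=> zL cphi h.
rewrite (funext (fun n => L2cl_nsqB2 (Lfun_cube (cphi n)) zL)) in h.
by move/fine_cvgP: h => [_].
Qed.

(** The smooth functions that approximate z satisfy no boundary condition, so psi has to vanish on
    the faces with its normal derivative. Green's formula then passes to the limit. *)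
Lemma has_laplacian_test z g psi :
  z \in Lfun nu 2%:E -> g \in Lfun nu 2%:E -> has_laplacian Q z g ->
  (forall i, C2_along i psi) -> continuous psi -> continuous (laplacian psi) ->
  (forall i (x : 'rV[R]_d), x ord0 i = a ord0 i \/ x ord0 i = a ord0 i + l ->
    psi x = 0 /\ pderiv i psi x = 0) ->
  \int[mu]_(x in Q) (g x * psi x) = \int[mu]_(x in Q) (z x * laplacian psi x).
Proof.
move=> zL gL [phi [sphi h1 h2]] psi2 cpsi clpsi psi0.
have /L2cl_cvg := h1 => /(_ zL (fun n => smooth_continuous (sphi n)))/ip_cvg_ip k1.
have /L2cl_cvg := h2 => /(_ gL (fun n => continuous_laplacian (sphi n)))/ip_cvg_ip k2.
have pL := Lfun_cube cpsi; have lpL := Lfun_cube clpsi.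
have pL' n := Lfun_cube (smooth_continuous (sphi n)).
have lpL' n := Lfun_cube (continuous_laplacian (sphi n)).
rewrite -(L2cl_dot2 gL pL) -(L2cl_dot2 zL lpL).
have := k2 (L2cl nu psi); have := k1 (L2cl nu (laplacian psi)).
have E n : L2dot nu (L2cl nu (laplacian (phi n))) (L2cl nu psi) =
    L2dot nu (L2cl nu (phi n)) (L2cl nu (laplacian psi)).
  rewrite (L2cl_dot2 (lpL' n) pL) (L2cl_dot2 (pL' n) lpL).
  apply: green_laplacian.
  - by move=> i; exact: smooth_C2_along.
  - exact: psi2.
  - by move=> i x xi; have [-> ->] := psi0 i x xi; rewrite !mulr0.
  - exact: smooth_continuous.
  - exact: cpsi.
  - exact: continuous_laplacian.
  - exact: clpsi.
by rewrite (funext E) => c1 c2; exact: cvg_unique c2 c1.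
Qed.

End cube_L2.

(** * Test functions vanishing on the faces with their normal derivatives *)

Section bump.
Context {R : realType} {d : nat} (a : 'rV[R]_d) (l : R).
Hypothesis l0 : 0 < l.

Let freq (k : nat) : R := k.+1%:R * (pi / l).
Let phase (k : nat) i : R := - freq k * a ord0 i.

Lemma sine_factor_boundary k i t : t = a ord0 i \/ t = a ord0 i + l ->
  sin (freq k * t + phase k i) = 0.
Proof.
rewrite /phase mulNr => -[->|->]; first by rewrite subrr sin0.
rewrite mulrDr addrAC subrr add0r /freq -mulrA divfK ?gt_eqF//.
exact: sin_nat_pi.
Qed.

Lemma sine_boundary k i (x : 'rV[R]_d) : x ord0 i = a ord0 i \/ x ord0 i = a ord0 i + l ->
  sine a l k x = 0.
Proof.
by move=> xi; rewrite /sine /trig (prodfD1 _ i) sine_factor_boundary// mul0r.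
Qed.

(** Both sines vanish at the ends of the side, so the product vanishes there with its derivative.
    The first one does not depend on k: it yields the common positive factor [weight], which can be
    cancelled in the end. *)
Definition bump_factor (k : 'I_d -> nat) i (t : R) : R^o :=
  sin (freq 0 * t + phase 0 i) * sin (freq (k i) * t + phase (k i) i).

Definition bump k : 'rV[R]_d -> R^o := prodf (bump_factor k).

Lemma bumpE k x : bump k x = weight a l x * sine a l k x.
Proof. by rewrite weight_sine /bump /prodf big_split. Qed.

Lemma continuous_bump k : continuous (bump k).
Proof.
apply: continuous_prodf => j.
have c m : continuous (fun t => sin (freq m * t + phase m j) : R^o).
  exact: (is_derive_continuous (is_derive_sin_affine (freq m) (phase m j))).
by move=> t; exact: (cvgM (c 0%N t) (c (k j) t)).
Qed.

Lemma C2_along_bump k i : [/\ C2_along i (bump k), continuous (pderiv i (pderiv i (bump k))) &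
  forall x : 'rV[R]_d, x ord0 i = a ord0 i \/ x ord0 i = a ord0 i + l ->
    bump k x = 0 /\ pderiv i (bump k) x = 0].
Proof.
pose S0 j t := sin (freq 0 * t + phase 0 j); pose S1 j t := sin (freq (k j) * t + phase (k j) j).
pose C0 j t := cos (freq 0 * t + phase 0 j); pose C1 j t := cos (freq (k j) * t + phase (k j) j).
pose g1 j (t : R) : R^o := freq 0 * C0 j t * S1 j t + freq (k j) * S0 j t * C1 j t.
pose g2 j (t : R) : R^o := - (freq 0 ^+ 2 + freq (k j) ^+ 2) * (S0 j t * S1 j t) +
  2 * freq 0 * freq (k j) * (C0 j t * C1 j t).
(* The derivative of g2, introduced to obtain continuity of g2. *)
pose g3 j (t : R) : R^o := - (freq 0 ^+ 2 + freq (k j) ^+ 2) *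
    (freq 0 * C0 j t * S1 j t + S0 j t * (freq (k j) * C1 j t)) +
  2 * freq 0 * freq (k j) * (- freq 0 * S0 j t * C1 j t - C0 j t * (freq (k j) * S1 j t)).
have d1 j (t : R) : is_derive t 1 (bump_factor k j) (g1 j t).
  by rewrite /bump_factor; apply: is_derive_eq; rewrite /GRing.scale/= /g1 /S0 /S1 /C0 /C1; ring.
have d2 j (t : R) : is_derive t 1 (g1 j) (g2 j t).
  by rewrite /g1 /S0 /S1 /C0 /C1; apply: is_derive_eq;
    rewrite /GRing.scale/= /g2 /S0 /S1 /C0 /C1; ring.
have d3 j (t : R) : is_derive t 1 (g2 j) (g3 j t).
  by rewrite /g2 /S0 /S1 /C0 /C1; apply: is_derive_eq;
    rewrite /GRing.scale/= /g3 /g1 /S0 /S1 /C0 /C1; ring.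
have [h e1 _] := @C2_along_prodf _ _ (bump_factor k) i (g1 i) (g2 i)
  (fun j => is_derive_continuous (d1 j)) (d1 i) (d2 i) (is_derive_continuous (d3 i)).
split => //; first by have [] := h.
move=> x xi; split; first by rewrite bumpE (sine_boundary _ xi) mulr0.
rewrite e1 prodf_subst /g1 /S0 /S1 !sine_factor_boundary//.
by rewrite !(mulr0, mul0r, addr0).
Qed.

Lemma continuous_laplacian_bump k : continuous (laplacian (bump k)).
Proof.
move=> x; apply: (@cvgr_sum R 'rV[R]_d (nbhs x) (nbhs_filter x) _ (index_enum _)
  (fun i y => pderiv i (pderiv i (bump k)) y) (fun i => pderiv i (pderiv i (bump k)) x)) => i.
by have [_ + _] := C2_along_bump k i; apply.
Qed.

End bump.

(** * Uniqueness of the Laplacian *)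

Section unique.
Context {R : realType} {d : nat}.
Let mu := lebesgue_rV d : {measure set 'rV[R]_d -> \bar R}.

Lemma Lfun_mrestrS (D Q : set 'rV[R]_d) (mD : measurable D) (mQ : measurable Q)
    (f : 'rV[R]_d -> R) : Q `<=` D ->
  f \in Lfun (mrestr mu mD) 2%:E -> f \in Lfun (mrestr mu mQ) 2%:E.
Proof.
move=> QD fL; have mf : measurable_fun setT f by move: fL => /andP[]; rewrite inE.
have mf2 : measurable_fun setT (fun x => (f x ^+ 2)%:E).
  by apply/measurable_EFinP; exact: measurable_funX.
have := integrable_lty measurableT (Lfun2_integrable_sqr fL); rewrite integral_mrestr// => foo.
apply: Lfun2P => //; rewrite integral_mrestr//; apply: le_lt_trans foo.
apply: ge0_subset_integral => //; first exact: measurable_funS mf2.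
by move=> x _; rewrite lee_fin sqr_ge0.
Qed.

(* On a small cube, weight * sine vanishes on the boundary together with its normal
   derivatives, so that g - g' is orthogonal to it; the sines are complete. *)
Lemma has_laplacian_unique (D : set 'rV[R]_d) (oD : open D) (mD : measurable D) z g g' :
  z \in Lfun (mrestr mu mD) 2%:E -> g \in Lfun (mrestr mu mD) 2%:E ->
  g' \in Lfun (mrestr mu mD) 2%:E -> has_laplacian D z g -> has_laplacian D z g' ->
  {ae mu, forall x, D x -> g x = g' x}.
Proof.
move=> zL gL gL' hg hg'.
have mL f : f \in Lfun (mrestr mu mD) 2%:E -> measurable_fun setT f.
  by move=> /andP[]; rewrite inE.
have mLS f A : f \in Lfun (mrestr mu mD) 2%:E -> measurable_fun A f.
  by move=> /mL mf; exact: measurable_funS mf.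
suff : mu.-negligible (~` [set x | D x -> g x = g' x]) by [].
apply: locally_negligible => x /= /not_implyP[Dx _].
have /nbhs_ballP[e /= e0 xeD] := open_nbhs_nbhs (conj oD Dx).
exists e => //; pose a : 'rV[R]_d := \row_j (x ord0 j - e); pose Q := cube a (2 * e).
have e20 : 0 < 2 * e by rewrite mulr_gt0.
pose mQ : measurable Q := measurable_cube a (2 * e).
(* Balls of the maximum norm are cubes. *)
have QE : Q = ball x e.
  apply/seteqP; split => y.
    move=> Qy; split => // i j; have := Qy j; rewrite (ord1 i) in_itv/= /ball/= !mxE.
    by rewrite ltr_norml => /andP[h1 h2]; apply/andP; split; lra.
  move=> [_ Qy] j; have := Qy ord0 j; rewrite in_itv/= /ball/= !mxE ltr_norml => /andP[h1 h2].
  by apply/andP; split; lra.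
have QD : Q `<=` D by rewrite QE.
have LQ f := @Lfun_mrestrS D Q mD mQ f QD.
have hQ f : f \in Lfun (mrestr mu mD) 2%:E -> has_laplacian D z f -> has_laplacian Q z f.
  by move=> fL; apply: has_laplacianS => //; exact: mLS.
have wL := @Lfun_cube _ _ a (2 * e) _ (@continuous_sine R d a (2 * e) (fun=> 0%N)).
have ifw f k : f \in Lfun (mrestr mu mD) 2%:E ->
    mu.-integrable Q (EFin \o (fun x => f x * bump a (2 * e) k x)).
  move=> fL; have cb : continuous (bump a (2 * e) k) by exact: continuous_bump.
  have bL := @Lfun_cube _ _ a (2 * e) _ cb.
  have mfb : measurable_fun setT (fun x => f x * bump a (2 * e) k x).
    by apply: measurable_funM; [exact: mL|exact: continuous_measurable_rV].
  apply/(integrable_mrestr mu mQ); first exact/measurable_EFinP.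
  by apply/Lfun1_integrable; exact: Lfun2_mul_Lfun1 (LQ _ fL) bL.
have test f k : f \in Lfun (mrestr mu mD) 2%:E -> has_laplacian D z f ->
    \int[mu]_(x in Q) (f x * bump a (2 * e) k x) =
    \int[mu]_(x in Q) (z x * laplacian (bump a (2 * e) k) x).
  move=> fL hf; have b2 i := C2_along_bump a e20 k i.
  apply: (has_laplacian_test e20 (LQ _ zL) (LQ _ fL) (hQ _ fL hf)).
  - by move=> i; have [] := b2 i.
  - exact: continuous_bump.
  - exact: continuous_laplacian_bump.
  - by move=> i; have [] := b2 i.
pose h y := (g y - g' y) * weight a (2 * e) y.
have hE k y : h y * sine a (2 * e) k y = g y * bump a (2 * e) k y - g' y * bump a (2 * e) k y.
  by rewrite /h bumpE mulrBl mulrBl !mulrA.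
have ih : mu.-integrable Q (EFin \o h).
  have gwL : (fun y => g y - g' y) \in Lfun (mrestr mu mD) 2%:E.
    exact: (LfunP (Lfun_Sub (lee1n 2) gL - Lfun_Sub (lee1n 2) gL')).
  have mfb : measurable_fun setT h.
    by apply: measurable_funM; [exact: mL gwL|rewrite (weight_sine a (2 * e)); exact: continuous_measurable_rV (@continuous_sine R d a (2 * e) _)].
  apply/(integrable_mrestr mu mQ); first exact/measurable_EFinP.
  apply/Lfun1_integrable; apply: Lfun2_mul_Lfun1 (LQ _ gwL) _.
  by rewrite (weight_sine a (2 * e)).
have hs k : \int[mu]_(y in Q) (h y * sine a (2 * e) k y) = 0.
  under eq_Rintegral do rewrite hE.
  rewrite RintegralB//; [|exact: ifw|exact: ifw].
  by rewrite !test// subrr.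
have := sine_complete e20 ih hs; rewrite -/mu => h0.
have : mu.-negligible (~` [set y | Q y -> h y = 0]) by exact: h0.
apply: negligibleS => y [] /= /not_implyP[Dy gy]; rewrite -QE => Qy.
apply/not_implyP; split => // hy; apply: gy; apply/eqP; rewrite -subr_eq0.
move/eqP: hy; rewrite /h mulf_eq0 => /orP[//|].
by rewrite (gt_eqF (weight_gt0 e20 Qy)).
Qed.

End unique.

(** * Regularity by sine expansion *)

Section smooth0.
Context {R : realType} {d : nat}.

Lemma smooth0_laplacian0 : smooth (fun _ : 'rV[R]_d => 0 : R^o) /\
  laplacian (fun _ : 'rV[R]_d => 0 : R^o) = fun=> 0.
Proof.
pose f := trig (fun _ : 'I_d => 0 : R) (fun _ : 'I_d => 0).
have sf : smooth f by exact: smooth_trig.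
have E : (fun _ : 'rV[R]_d => 0 : R^o) = fun x => - 1 * f x + f x.
  by apply/funext => x; rewrite mulN1r addNr.
rewrite E; split; first exact: smooth_lin.
by rewrite laplacian_lin//; apply/funext => x; rewrite mulN1r addNr mulN1r addNr.
Qed.

Lemma smooth_sum (c : nat -> R) (b : nat -> 'rV[R]_d -> R^o) N : (forall j, smooth (b j)) ->
  smooth (fun x => \sum_(j < N) c j * b j x) /\
  laplacian (fun x => \sum_(j < N) c j * b j x) =
    fun x => \sum_(j < N) c j * laplacian (b j) x.
Proof.
move=> sb; elim: N => [|N [ih1 ih2]].
  have [s0 l0] := smooth0_laplacian0.
  have E (f : nat -> 'rV[R]_d -> R^o) :
      (fun x => \sum_(j < 0) c j * f j x) = fun _ : 'rV[R]_d => 0 : R^o.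
    by apply/funext => x; rewrite big_ord0.
  by rewrite (E b) (E (fun j => laplacian (b j))).
have E (f : nat -> 'rV[R]_d -> R^o) : (fun x => \sum_(j < N.+1) c j * f j x) =
    fun x => c N * f N x + \sum_(j < N) c j * f j x.
  by apply/funext => x; rewrite big_ord_recr/= addrC.
rewrite (E b) (E (fun j => laplacian (b j))) (laplacian_lin (c N) (sb N) ih1) ih2.
by split; [exact: smooth_lin (sb N) ih1|].
Qed.

End smooth0.

Section sine_expansion.
Context {R : realType} {d : nat} (a : 'rV[R]_d) (l : R).
Hypothesis l0 : 0 < l.

Let mu := lebesgue_rV d : {measure set 'rV[R]_d -> \bar R}.
Let Q := cube a l.
Let mQ := measurable_cube a l.
Let nu : {measure set 'rV[R]_d -> \bar R} := mrestr mu mQ.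

Let freq (k : 'I_d -> nat) i : R := (k i).+1%:R * (pi / l).

(** Each sine is an eigenfunction of every second coordinate derivative. In a coordinate where k and
    k' differ so do the eigenvalues, and Green's formula in that direction forces the integral to be
    0. *)
Lemma sine_orthogonal k k' : k <> k' ->
  \int[mu]_(x in Q) (sine a l k x * sine a l k' x) = 0.
Proof.
move=> kk; have [i ki] : exists i, k i <> k' i.
  by apply/existsNP => h; apply: kk; apply/funext.
have [c1 e1] := C2_along_trig (freq k) (fun i => - freq k i * a ord0 i) i.
have [c2 e2] := C2_along_trig (freq k') (fun i => - freq k' i * a ord0 i) i.
have := @green_cube _ _ a l i _ _ l0 c1 c2; rewrite e1 e2 => h.
have ip : mu.-integrable Q (EFin \o (fun x => sine a l k x * sine a l k' x)).
  apply: (@cube_integrable _ _ (fun x => sine a l k x * sine a l k' x)) => x.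
  exact: (cvgM (@continuous_sine _ _ a l k x) (@continuous_sine _ _ a l k' x)).
have : (freq k' i ^+ 2 - freq k i ^+ 2) * \int[mu]_(x in Q) (sine a l k x * sine a l k' x) = 0.
  rewrite -(RintegralZl _ mQ ip).
  rewrite -[RHS]h; last first.
    move=> x xi; have s0 q := @sine_boundary _ _ a l l0 q i x xi.
    by rewrite -/(sine a l k) -/(sine a l k') !s0 mulr0 mul0r.
  by apply: eq_Rintegral => x _; rewrite -/(sine a l k) -/(sine a l k'); ring.
move=> /eqP; rewrite mulf_eq0 => /orP[|/eqP//].
have pl0 : 0 < pi / l by rewrite divr_gt0// pi_gt0.
rewrite subr_eq0 eqrXn2// ?mulr_ge0 ?pi_ge0 ?invr_ge0 ?(ltW l0)// => /eqP/(mulIf (lt0r_neq0 pl0))/eqP.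
by rewrite eqr_nat eqSS eq_sym => /eqP.
Qed.

(* Zero at the codes of no multi-index, hence the arbitrary eigenvalue there. *)
Definition sine_seq (j : nat) : 'rV[R]_d -> R^o :=
  if pickle_inv j is Some k then sine a l (k : {ffun 'I_d -> nat}) else fun=> 0.

(** The default is the common lower bound, so that [sine_eigenvalue_ge] holds at every index. *)
Definition sine_eigenvalue (j : nat) : R :=
  if pickle_inv j is Some k then \sum_i freq (k : {ffun 'I_d -> nat}) i ^+ 2 else (pi / l) ^+ 2.

Lemma sine_seq_smooth j : smooth (sine_seq j) /\
  laplacian (sine_seq j) = fun x => - sine_eigenvalue j * sine_seq j x.
Proof.
rewrite /sine_seq /sine_eigenvalue; case: pickle_inv => [k|].
  by split; [exact: smooth_trig|exact: laplacian_trig].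
by have [s0 ->] := @smooth0_laplacian0 R d; split => //; apply/funext => x; rewrite mulr0.
Qed.

Lemma sine_seqL j : sine_seq j \in Lfun nu 2%:E.
Proof. exact: Lfun_cube (smooth_continuous (sine_seq_smooth j).1). Qed.

Lemma sine_eigenvalue_ge j : (0 < d)%N -> (pi / l) ^+ 2 <= sine_eigenvalue j.
Proof.
move=> d0; rewrite /sine_eigenvalue; case: pickle_inv => [k|//].
rewrite (bigD1 (Ordinal d0))//= ler_wpDr ?sumr_ge0// => [i _|]; first exact: sqr_ge0.
have pl0 : 0 <= pi / l by rewrite divr_ge0 ?pi_ge0// ltW.
have f0 : 0 <= freq k (Ordinal d0) by rewrite mulr_ge0.
by rewrite lerXn2r ?nnegrE// /freq ler_peMl// ler1n.
Qed.

Let e j : L2 nu := L2cl nu (sine_seq j).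

Lemma sine_seq_orth i j : i != j -> L2dot nu (e i) (e j) = 0.
Proof.
move=> ij; rewrite (L2cl_dot2 (sine_seqL i) (sine_seqL j)) /sine_seq.
have z (f : 'rV[R]_d -> R) : (forall x, f x = 0) -> \int[mu]_(x in Q) f x = 0.
  move=> f0; rewrite -[RHS](mul0r (fine (mu Q))) -Rintegral_cst//.
  exact: eq_Rintegral.
case Ei : (pickle_inv i) => [k|]; last by rewrite z// => x; rewrite mul0r.
case Ej : (pickle_inv j) => [k'|]; last by rewrite z// => x; rewrite mulr0.
apply: sine_orthogonal => kk; move/eqP: ij; apply.
have {}kk : k = k' by apply/ffunP => q; exact: (congr1 (@^~ q) kk).
have := @pickle_invK {ffun 'I_d -> nat} i; have := @pickle_invK {ffun 'I_d -> nat} j.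
by rewrite Ei Ej /= kk => -> ->.
Qed.

Lemma sine_seq_total (x : L2 nu) : (forall j, L2dot nu x (e j) = 0) -> x = 0.
Proof.
move=> x0; apply: L2_ext.
have ix : mu.-integrable Q (EFin \o (fun y => x y)).
  have cL : (fun=> 1) \in Lfun nu 2%:E.
    by apply: (@Lfun_cube _ _ a l (fun=> 1)); exact: (@cst_continuous _ R^o 1).
  apply/(integrable_mrestr mu mQ); first exact/measurable_EFinP/measurable_L2.
  have := Lfun2_mul_Lfun1 (LfunP (L2_repr x)) cL => /Lfun1_integrable.
  by apply: eq_integrable => // y _ /=; rewrite mulr1.
have hs k : \int[mu]_(y in Q) (x y * sine a l k y) = 0.
  have := x0 (pickle [ffun i => k i]); rewrite ipC /e L2cl_dot; last exact: sine_seqL.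
  rewrite Rintegral_mrestr; last first.
    apply: measurable_funM; last exact: measurable_L2.
    exact: continuous_measurable_rV (smooth_continuous (sine_seq_smooth _).1).
  move=> h; rewrite -[RHS]h; apply: eq_Rintegral => y _.
  rewrite /sine_seq pickleK_inv mulrC; congr (sine _ _ _ _ * _).
  by apply/funext => i; rewrite ffunE.
have := sine_complete l0 ix hs => /(ae_mrestr mu mQ).
by apply: filterS2 (L2_0E nu) => y -> ->.
Qed.

Variables (D : set 'rV[R]_d) (mD : measurable D).
Hypothesis DQ : D `<=` Q.

Lemma Rintegral_patch (f g : 'rV[R]_d -> R) :
  \int[mu]_(x in Q) ((f \_ D) x * g x) = \int[mu]_(x in D) (f x * g x).
Proof.
rewrite -[X in \int[mu]_(x in X) (f x * g x)](setIidr DQ) Rintegral_mkcondr.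
by apply: eq_Rintegral => x _; rewrite !patchE; case: ifP => //; rewrite mul0r.
Qed.

Lemma Lfun_patch (f : 'rV[R]_d -> R) : f \in Lfun (mrestr mu mD) 2%:E ->
  (f \_ D) \in Lfun nu 2%:E.
Proof.
move=> fL; have mf : measurable_fun setT f by move: fL => /andP[]; rewrite inE.
have mfD : measurable_fun setT (f \_ D).
  by apply/(measurable_restrictT f mD); exact: measurable_funS mf.
have mf2 : measurable_fun setT (fun x => (f x ^+ 2)%:E).
  by apply/measurable_EFinP; exact: measurable_funX.
apply: Lfun2P => //; rewrite integral_mrestr; last first.
  by apply/measurable_EFinP; exact: measurable_funX.
have := integrable_lty measurableT (Lfun2_integrable_sqr fL); rewrite integral_mrestr//.
rewrite -[X in (\int[_]_(x in X) _)%E](setIidr DQ) integral_mkcondr.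
apply: le_lt_trans; rewrite le_eqVlt; apply/orP; left; apply/eqP.
by apply: eq_integral => x _; rewrite !patchE; case: ifP => //= _; rewrite expr0n.
Qed.

(** Read on the cube, the hypothesis says that the coefficients of [G] are - lambda_j times those of
    [Z], so the Laplacian of a partial sum of [Z] is the partial sum of [G]. Passing from the cube
    to D only decreases the errors. The power 4 arises because squared norms are compared termwise,
    with lambda_j >= (pi / l)^2. *)
Lemma adjoint_laplacian z g : (0 < d)%N ->
  z \in Lfun (mrestr mu mD) 2%:E -> g \in Lfun (mrestr mu mD) 2%:E ->
  (forall k, \int[mu]_(x in D) (z x * laplacian (sine a l k) x) =
             \int[mu]_(x in D) (g x * sine a l k x)) ->
  has_laplacian D z g /\
  (pi / l) ^+ 4 * \int[mu]_(x in D) (z x * z x) <= \int[mu]_(x in D) (g x * g x).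
Proof.
move=> d0 zL gL zg.
pose Z := L2cl nu (z \_ D); pose G := L2cl nu (g \_ D).
have ZL := Lfun_patch zL; have GL := Lfun_patch gL.
pose c := fourier (L2dot nu) e Z.
have zgj j : L2dot nu G (e j) = - sine_eigenvalue j * L2dot nu Z (e j).
  rewrite (L2cl_dot2 GL (sine_seqL j)) (L2cl_dot2 ZL (sine_seqL j)).
  have iz : mu.-integrable Q (EFin \o (fun x => (z \_ D) x * sine_seq j x)).
    apply/(integrable_mrestr mu mQ).
      apply/measurable_EFinP; apply: measurable_funM.
        by move: ZL => /andP[]; rewrite inE.
      by have := sine_seqL j => /andP[]; rewrite inE.
    by apply/Lfun1_integrable; exact: Lfun2_mul_Lfun1 ZL (sine_seqL j).
  rewrite -(RintegralZl _ mQ iz).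
  transitivity (\int[mu]_(x in Q) ((z \_ D) x * laplacian (sine_seq j) x)); last first.
    by apply: eq_Rintegral => x _; rewrite (sine_seq_smooth j).2; ring.
  rewrite (Rintegral_patch g) (Rintegral_patch z) /sine_seq.
  case: pickle_inv => [k|]; first by rewrite zg.
  rewrite (@smooth0_laplacian0 R d).2.
  by apply: eq_Rintegral => x _; rewrite !mulr0.
have cG j : fourier (L2dot nu) e G j = - sine_eigenvalue j * c j.
  by rewrite /c /fourier zgj mulrA.
have cvZ := fourier_sum_cvg sine_seq_orth sine_seq_total Z (@L2_complete _ _ _ nu).
have cvG := fourier_sum_cvg sine_seq_orth sine_seq_total G (@L2_complete _ _ _ nu).
pose phi N : 'rV[R]_d -> R^o := fun x => \sum_(j < N) c j * sine_seq j x.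
have ss N := smooth_sum c N (fun j => (sine_seq_smooth j).1).
have sumE (b : nat -> R) N :
    L2cl nu (fun x => \sum_(j < N) b j * sine_seq j x) = \sum_(j < N) b j *: e j.
  apply: L2clP.
    have [sb _] := smooth_sum b N (fun j => (sine_seq_smooth j).1).
    exact: (continuous_measurable_rV (smooth_continuous sb)).
  elim: N => [|N ih].
    by rewrite big_ord0; apply: filterS (L2_0E nu) => x ->; rewrite big_ord0.
  rewrite big_ord_recr/=; move: (\sum_(i < N) b i *: e i) ih => u ih.
  apply: filterS3 ih (L2_addE u (b N *: e N)) (filterI (L2_scaleE (b N) (e N)) (L2clE (sine_seqL N))).
  by move=> x h1 h2 [h3 h4]; rewrite h2 h3 h4 big_ord_recr/= h1.
have lapE N : laplacian (phi N) = fun x => \sum_(j < N) fourier (L2dot nu) e G j * sine_seq j x.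
  rewrite (ss N).2; apply/funext => x; apply: eq_bigr => j _.
  by rewrite (sine_seq_smooth j).2 cG; ring.
have lim (f : nat -> 'rV[R]_d -> R^o) w : (forall n, continuous (f n)) ->
    w \in Lfun (mrestr mu mD) 2%:E ->
    ip_cvg (L2dot nu) (fun n => L2cl nu (f n)) (L2cl nu (w \_ D)) ->
    (\int[mu]_(x in D) ((f n x - w x) ^+ 2)%:E)%E @[n --> \oo] --> 0%E.
  move=> cf wL fw; have wL' := Lfun_patch wL.
  have mw : measurable_fun setT (w \_ D) by move: wL' => /andP[]; rewrite inE.
  apply: (@squeeze_cvge _ _ _ _ (cst 0%E) _
      (fun n => (nsq (L2dot nu) (L2cl nu (f n) - L2cl nu (w \_ D)))%:E)).
  - apply: nearW => n; rewrite integral_ge0/=; last by move=> x _; rewrite lee_fin sqr_ge0.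
    rewrite -(L2cl_nsqB2 (Lfun_cube a l (cf n)) wL').
    rewrite (eq_integral (fun x => ((f n x - (w \_ D) x) ^+ 2)%:E)); last first.
      by move=> x xD; rewrite patchE xD.
    apply: ge0_subset_integral => //.
      apply/measurable_EFinP; apply: measurable_funX; apply: measurable_funB.
        exact: continuous_measurable_rV.
      exact: measurable_funS mw.
    by move=> x _; rewrite lee_fin sqr_ge0.
  - exact: cvg_cst.
  - by apply: cvg_EFin; [exact: nearW|exact: fw].
have sphi N : smooth (phi N) := (ss N).1.
split.
  exists phi; split => //.
    apply: lim => //; first by move=> n; exact: smooth_continuous.
    by rewrite (funext (sumE c)); exact: cvZ.
  apply: lim => //; first by move=> n; exact: continuous_laplacian.
  have -> : (fun n => L2cl nu (laplacian (phi n))) =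
      fun n => \sum_(j < n) fourier (L2dot nu) e G j *: e j.
    by apply/funext => n; rewrite lapE sumE.
  exact: cvG.
have nsqE w : w \in Lfun (mrestr mu mD) 2%:E ->
    nsq (L2dot nu) (L2cl nu (w \_ D)) = \int[mu]_(x in D) (w x * w x).
  move=> wL; have wL' := Lfun_patch wL; rewrite /nsq (L2cl_dot2 wL' wL') Rintegral_patch.
  by apply: eq_Rintegral => x xD; rewrite patchE xD.
rewrite -!nsqE//; have pl0 : 0 <= pi / l by rewrite divr_ge0 ?pi_ge0// ltW.
have c1 : (pi / l) ^+ 4 * nsq (L2dot nu) (fourier_sum (L2dot nu) e Z n) @[n --> \oo] -->
    (pi / l) ^+ 4 * nsq (L2dot nu) Z.
  by apply: cvgM; [exact: cvg_cst|exact: ip_cvg_nsq].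
apply: ler_cvg_to c1 (ip_cvg_nsq cvG) _; apply: nearW => n.
rewrite !(nsq_combination sine_seq_orth) mulr_sumr; apply: ler_sum => j _.
rewrite cG mulrA; apply: ler_wpM2r; first exact: nsq_ge0.
have -> : (- sine_eigenvalue j * c j) ^+ 2 = sine_eigenvalue j ^+ 2 * c j ^+ 2 by ring.
apply: ler_wpM2r; first exact: sqr_ge0.
rewrite -[4%N]/(2 * 2)%N exprM lerXn2r ?nnegrE ?exprn_ge0 ?sine_eigenvalue_ge//.
by apply: le_trans (sine_eigenvalue_ge _ d0); exact: exprn_ge0.
Qed.

End sine_expansion.

(** * Laplacians of elements of L_2(Omega) *)

Section laplacian_L2.
Context {R : realType} {d : nat} {Omega : lipschitz_domain R d}.

Let mu := lebesgue_rV d : {measure set 'rV[R]_d -> \bar R}.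
Let dot := L2dot (lebesgue_on Omega).

Lemma ip_dot (f g : L2dom Omega) : ip Omega f g = dot f g.
Proof.
rewrite /ip -(Rintegral_mrestr _ (measurable_dom Omega))//.
by apply: measurable_funM; exact: measurable_L2.
Qed.

Lemma dom_ae (P : 'rV[R]_d -> Prop) : (\forall x \ae lebesgue_on Omega, P x) ->
  {ae mu, forall x, dom_set Omega x -> P x}.
Proof. by move/ae_mrestr. Qed.

Section subdomain.
Variables (D : set 'rV[R]_d) (mD : measurable D).
Hypothesis DO : D `<=` Omega.

Lemma sub_ae (P : 'rV[R]_d -> Prop) : (\forall x \ae lebesgue_on Omega, P x) ->
  {ae mu, forall x, D x -> P x}.
Proof. by move=> /dom_ae; apply: filterS => x h /DO. Qed.

Lemma has_laplacian_L2_lin (z g z' g' : L2dom Omega) (a : R) :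
  has_laplacian D z g -> has_laplacian D z' g' ->
  has_laplacian D (a *: z + z' : L2dom Omega) (a *: g + g' : L2dom Omega).
Proof.
have mL (f : L2dom Omega) : measurable_fun D f by exact: measurable_funS (measurable_L2 f).
have mC (f f' : L2dom Omega) : measurable_fun D (fun x => a * f x + f' x).
  by apply: measurable_funD => //; apply: measurable_funM => //; exact: measurable_cst.
have ae (f f' : L2dom Omega) :
    {ae mu, forall x, D x -> a * f x + f' x = (a *: f + f' : L2dom Omega) x}.
  by apply: sub_ae; apply: filterS2 (L2_addE (a *: f) f') (L2_scaleE a f) => x -> ->.
move=> h h'; have := has_laplacian_lin mD a (mL z) (mL g) (mL z') (mL g') h h'.
exact: has_laplacian_ae (mC _ _) (mC _ _) (mL _) (mL _) (ae _ _) (ae _ _).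
Qed.

Lemma integral_sub_le (f g : L2dom Omega) :
  (\int[mu]_(x in D) ((f x - g x) ^+ 2)%:E <= (nsq dot (f - g))%:E)%E.
Proof.
rewrite -integral_sqr_diff.
have m : measurable_fun setT (fun x => ((f x - g x) ^+ 2)%:E).
  apply/measurable_EFinP; apply: measurable_funX; apply: measurable_funB; exact: measurable_L2.
rewrite (ge0_integral_mrestr _ (measurable_dom Omega))//.
  apply: ge0_subset_integral => //; [exact: measurable_dom|exact: measurable_funS m|].
  by move=> x _; rewrite lee_fin sqr_ge0.
by move=> x; rewrite lee_fin sqr_ge0.
Qed.

Lemma has_laplacian_L2_closed :
  ip_closed (prod_ip dot) [set x : L2dom Omega * L2dom Omega | has_laplacian D x.1 x.2].
Proof.
have mL (f : L2dom Omega) : measurable_fun D f by exact: measurable_funS (measurable_L2 f).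
move=> u x uL /prod_ip_cvg[c1 c2].
apply: has_laplacian_closed => // e e0.
have [n [n1 n2]] : exists n, nsq dot ((u n).1 - x.1) < e /\ nsq dot ((u n).2 - x.2) < e.
  apply: (@filter_ex _ \oo).
  by apply: filterI; [apply: cvgr_lt c1 _ e0|apply: cvgr_lt c2 _ e0].
exists (L2_fun (u n).1), (L2_fun (u n).2); split; [exact: mL|exact: mL|exact: uL| |].
- by apply: le_lt_trans (integral_sub_le _ _) _; rewrite lte_fin.
- by apply: le_lt_trans (integral_sub_le _ _) _; rewrite lte_fin.
Qed.

Lemma has_laplacian_L2_unique (z g g' : L2dom Omega) : open D ->
  has_laplacian D z g -> has_laplacian D z g' -> {ae mu, forall x, D x -> g x = g' x}.
Proof.
move=> oD h h'.
have LD (f : L2dom Omega) : (f : _ -> R) \in Lfun (mrestr mu mD) 2%:E.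
  exact: (@Lfun_mrestrS R d Omega D (open_measurable_rV (@dom_open _ _ Omega)) mD f DO (LfunP (L2_repr f))).
exact: (has_laplacian_unique oD (LD z) (LD g) (LD g') h h').
Qed.

End subdomain.

End laplacian_L2.

Section mesh_laplacian.
Context {R : realType} {d : nat} {Omega : lipschitz_domain R d}.

Let mu := lebesgue_rV d : {measure set 'rV[R]_d -> \bar R}.
Let nu := lebesgue_on Omega.
Let dot := L2dot nu.

Section piece.
Variables (D : set 'rV[R]_d) (mD : measurable D).
Hypothesis DO : D `<=` Omega.

(** Restriction to D followed by extension by zero, within L_2(Omega): it splits the inner product
    over the mesh and glues functions given on each element. *)
Definition piece (f : L2dom Omega) : L2dom Omega := L2cl nu (f \_ D).

Lemma Lfun_piece (f : L2dom Omega) : (f \_ D) \in Lfun nu 2%:E.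
Proof.
have mf : measurable_fun setT (f \_ D).
  by apply/(measurable_restrictT _ mD); exact: measurable_funS (measurable_L2 f).
apply: Lfun2P => //.
apply: (@le_lt_trans _ _ (nsq dot f)%:E); last exact: ltry.
rewrite -integral_sqr_nsq; apply: ge0_le_integral => //.
- by move=> x _; rewrite lee_fin sqr_ge0.
- by apply/measurable_EFinP; exact: measurable_funX.
- by apply/measurable_EFinP; apply: measurable_funX; exact: measurable_L2.
- by move=> x _; rewrite lee_fin patchE; case: ifP => // _; rewrite expr0n sqr_ge0.
Qed.

Lemma pieceE f : \forall x \ae nu, piece f x = (f \_ D) x.
Proof. exact: L2clE (Lfun_piece f). Qed.

Lemma piece_dot (f g : L2dom Omega) : dot (piece f) g = ip D f g.
Proof.
have mf : measurable_fun setT (f \_ D).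
  by apply/(measurable_restrictT _ mD); exact: measurable_funS (measurable_L2 f).
rewrite L2cl_dot; last exact: Lfun_piece.
rewrite Rintegral_mrestr; last by apply: measurable_funM => //; exact: measurable_L2.
rewrite /ip -[X in _ = \int[_]_(x in X) _](setIidr DO) Rintegral_mkcondr.
by apply: eq_Rintegral => x _; rewrite !patchE; case: ifP => //; rewrite mul0r.
Qed.

End piece.

Variable M : mesh Omega.

Let mM i : measurable (dom_set (M i)).
Proof. exact: measurable_dom. Qed.

Let MO i : dom_set (M i) `<=` Omega.
Proof. by move=> x; exact: mesh_sub. Qed.

Lemma sum_pieceE (f : 'I_(mesh_size M) -> L2dom Omega) : \forall x \ae nu,
  (\sum_j piece (M j) (f j) : L2dom Omega) x = \sum_j (f j \_ (M j)) x.
Proof.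
elim: (index_enum _) => [|j r ih].
  by apply: filterS (L2_0E nu) => x h; rewrite !big_nil.
have -> : \sum_(i <- j :: r) piece (M i) (f i) =
    piece (M j) (f j) + \sum_(i <- r) piece (M i) (f i) by rewrite big_cons.
set v := \sum_(i <- r) piece _ _ in ih *.
have h1 := L2_addE (piece (M j) (f j)) v.
have h2 := pieceE (mM j) (f j).
by apply: filterS3 ih h1 h2 => x h -> ->; rewrite big_cons h.
Qed.

Lemma sum_patch (f : 'I_(mesh_size M) -> 'rV[R]_d -> R) i x : dom_set (M i) x ->
  \sum_j (f j \_ (M j)) x = f i x.
Proof.
move=> xi; rewrite (bigD1 i)//= patchE mem_set// big1 ?addr0// => j ji.
rewrite patchE memNset// => xj.
by have /disjoints_subset/(_ _ xj) := mesh_disjoint ji; exact.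
Qed.

Lemma mesh_ae (P : 'rV[R]_d -> Prop) :
  (forall i, {ae mu, forall x, dom_set (M i) x -> P x}) -> \forall x \ae nu, P x.
Proof.
move=> h; apply/ae_mrestr.
have h' : {ae mu, forall x, forall i, dom_set (M i) x -> P x}.
  exact: filter_forall.
apply: negligibleS (negligibleU (mesh_null M) h') => x /= /not_implyP[Ox nP].
have [[i _ xi]|nM] := pselect ((\bigcup_i M i) x); last by left.
by right => /(_ i xi).
Qed.

Lemma mesh_ip (f g : L2dom Omega) : \sum_i ip (M i) f g = dot f g.
Proof.
rewrite -(eq_bigr _ (fun i _ => piece_dot (mM i) (@MO i) f g)) -ip_suml.
congr (dot _ g); apply: L2_ext; apply: mesh_ae => i.
apply: filterS (sub_ae (@MO i) (sum_pieceE (fun=> f))) => x h xi.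
by rewrite h// (sum_patch _ xi).
Qed.

(** [HDelta_mesh] supplies one Laplacian for each element, whereas [pwlap] selects a single function
    for all of them; the sum of the pieces is one. *)
Lemma HDelta_mesh_glue (z : L2dom Omega) : HDelta_mesh M z ->
  exists g : L2dom Omega, forall i, has_laplacian (M i) z g.
Proof.
move=> zM; have [g zg] := choice zM; exists (\sum_i piece (M i) (g i)) => i.
have mL (f : L2dom Omega) : measurable_fun (dom_set (M i)) f by exact: measurable_L2S.
apply: (has_laplacian_ae (mM i) (mL z) (mL (g i)) (mL z) (mL _) _ _ (zg i)).
  exact: nearW.
apply: filterS (sub_ae (@MO i) (sum_pieceE g)) => x h xi.
by rewrite h// (sum_patch _ xi).
Qed.

Lemma mesh_laplacian_unique (z g g' : L2dom Omega) :
  (forall i, has_laplacian (M i) z g) -> (forall i, has_laplacian (M i) z g') -> g = g'.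
Proof.
move=> h h'; apply: L2_ext; apply: mesh_ae => i.
exact: (has_laplacian_L2_unique (mM i) (@MO i) (@dom_open _ _ (M i)) (h i) (h' i)).
Qed.

Lemma laplacian_mesh (z g : L2dom Omega) : has_laplacian Omega z g ->
  forall i, has_laplacian (M i) z g.
Proof.
by move=> h i; apply: has_laplacianS h => //; [exact: measurable_dom|exact: measurable_L2S|exact: measurable_L2S].
Qed.

Lemma laplacian_unique (z g g' : L2dom Omega) :
  has_laplacian Omega z g -> has_laplacian Omega z g' -> g = g'.
Proof.
move=> h h'; apply: L2_ext; apply/ae_mrestr.
exact: (has_laplacian_L2_unique (measurable_dom Omega) (@subset_refl _ _) (@dom_open _ _ Omega) h h').
Qed.

Lemma lapE (z g : L2dom Omega) : has_laplacian Omega z g -> lap z = g.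
Proof. by move=> h; apply: xget_unique => // y /laplacian_unique; exact. Qed.

Lemma lapP (z : L2dom Omega) : HDelta z -> has_laplacian Omega z (lap z).
Proof. by move=> [g zg]; rewrite (lapE zg). Qed.

Lemma pwlapE (z g : L2dom Omega) : (forall i, has_laplacian (M i) z g) -> pwlap M z = g.
Proof. by move=> h; apply: xget_unique => // y /mesh_laplacian_unique; exact. Qed.

Lemma pwlapP (z : L2dom Omega) : HDelta_mesh M z -> forall i, has_laplacian (M i) z (pwlap M z).
Proof. by move=> /HDelta_mesh_glue[g zg]; rewrite (pwlapE zg). Qed.

Lemma HDelta_meshP (z g : L2dom Omega) : (forall i, has_laplacian (M i) z g) -> HDelta_mesh M z.
Proof. by move=> h i; exists g. Qed.

End mesh_laplacian.

(** * The adjoint of the Laplacian on Omega *)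

Section adjoint.
Context {R : realType} {d : nat} {Omega : lipschitz_domain R d}.

Let mu := lebesgue_rV d : {measure set 'rV[R]_d -> \bar R}.
Let nu := lebesgue_on Omega.
Let dot := L2dot nu.

Lemma bounded_sub_cube (A : set 'rV[R]_d) : bounded_set A ->
  exists (a : 'rV[R]_d) (l : R), 0 < l /\ A `<=` cube a l.
Proof.
move=> /pinfty_ex_gt0[N N0 AN]; exists (const_mx (- (N + 1))), (2 * (N + 1)).
split=> [|x /AN xN i]; first by rewrite mulr_gt0// addr_gt0.
have : `|x ord0 i| <= N.
  apply: le_trans xN; rewrite [leRHS]mx_normrE.
  exact: (le_bigmax _ (fun ij : 'I_1 * 'I_d => `|x ij.1 ij.2|) (ord0, i)).
by rewrite in_itv/= mxE ler_norml => /andP[h1 h2]; apply/andP; split; lra.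
Qed.

Lemma smooth_has_laplacian (phi : 'rV[R]_d -> R^o) : smooth phi ->
  phi \in Lfun nu 2%:E -> laplacian phi \in Lfun nu 2%:E ->
  has_laplacian Omega (L2cl nu phi) (L2cl nu (laplacian phi)).
Proof.
move=> sphi L1 L2; have mO := measurable_dom Omega.
have mD (f : L2dom Omega) : measurable_fun Omega f by exact: measurable_L2S.
have m1 : measurable_fun Omega phi.
  by move: L1 => /andP[]; rewrite inE => m _; exact: measurable_funS m.
have m2 : measurable_fun Omega (laplacian phi).
  by move: L2 => /andP[]; rewrite inE => m _; exact: measurable_funS m.
have ae1 : {ae mu, forall x, dom_set Omega x -> phi x = L2cl nu phi x}.
  by apply: dom_ae; apply: filterS (L2clE L1) => x ->.
have ae2 : {ae mu, forall x, dom_set Omega x -> laplacian phi x = L2cl nu (laplacian phi) x}.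
  by apply: dom_ae; apply: filterS (L2clE L2) => x ->.
apply: (has_laplacian_ae mO m1 m2 (mD _) (mD _) ae1 ae2).
have z (f : 'rV[R]_d -> R^o) :
    (\int[mu]_(x in Omega) ((f x - f x) ^+ 2)%:E @[n --> \oo] --> 0)%E.
  rewrite (_ : (fun _ : nat => _) = cst 0%E); first exact: cvg_cst.
  apply/funext => n; rewrite (_ : (fun x => _) = cst 0%E); first by rewrite integral0.
  by apply/funext => x; rewrite subrr expr0n.
by exists (fun=> phi); split => //; exact: z.
Qed.

(** The constant is read off a cube containing Omega, with no mesh in sight; the error constant
    inherits its independence of the mesh from here. *)
Lemma adjoint_dom : (0 < d)%N -> bounded_set Omega ->
  exists2 c : R, 0 < c & forall p r : L2dom Omega,
    (forall v g, has_laplacian Omega (v : L2dom Omega) (g : L2dom Omega) ->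
       dot p g = dot r v) ->
    has_laplacian Omega p r /\ c * nsq dot p <= nsq dot r.
Proof.
move=> d0 /bounded_sub_cube[a [l [l0 Oal]]].
exists ((pi / l) ^+ 4); first by rewrite exprn_gt0// divr_gt0// pi_gt0.
move=> p r pr; have mO := open_measurable_rV (@dom_open _ _ Omega).
have LC (f : 'rV[R]_d -> R^o) : continuous f -> f \in Lfun nu 2%:E.
  by move=> cf; exact: (Lfun_mrestrS _ Oal (Lfun_cube a l cf)).
have dotE (f : 'rV[R]_d -> R^o) (u : L2dom Omega) : continuous f ->
    dot u (L2cl nu f) = \int[mu]_(x in Omega) (u x * f x).
  move=> cf; rewrite ipC L2cl_dot; last exact: LC.
  rewrite Rintegral_mrestr; first by apply: eq_Rintegral => x _; rewrite mulrC.
  by apply: measurable_funM; [exact: continuous_measurable_rV|exact: measurable_L2].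
rewrite /nsq -!ip_dot /ip.
apply: (adjoint_laplacian l0 Oal d0 (LfunP (L2_repr p)) (LfunP (L2_repr r))) => k.
have sk : smooth (sine a l k) by exact: smooth_trig.
have cs := smooth_continuous sk; have cl := continuous_laplacian sk.
have := pr _ _ (smooth_has_laplacian sk (LC _ cs) (LC _ cl)).
by rewrite (dotE _ _ cs) (dotE _ _ cl).
Qed.

End adjoint.

(** * Stability *)

Section infsup.
Context {R : realType} {E : lmodType R} (b : inner_product E).

(** Expand |2 e x - y|^2 >= 0 and divide by 4 e. *)
Lemma ip_young (x y : E) (e : R) : 0 < e -> b x y <= e * nsq b x + (4 * e)^-1 * nsq b y.
Proof.
move=> e0; have := nsq_ge0 b (2 * e *: x - y).
rewrite nsqB nsqZ ipZl => h.
have -> : b x y = (4 * e)^-1 * (4 * e * b x y).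
  by rewrite mulKf// lt0r_neq0// mulr_gt0.
have -> : e * nsq b x = (4 * e)^-1 * (4 * e * (e * nsq b x)).
  by rewrite mulKf// lt0r_neq0// mulr_gt0.
rewrite -mulrDr; apply: ler_wpM2l; first by rewrite invr_ge0 mulr_ge0// ltW.
by move: h; move: (b x y) (nsq b x) (nsq b y) => p q r; nra.
Qed.

(** In [infsup_estimate], 2 / c + 4 bounds |s + t|^2, and a further division by c bounds |u - Lt|^2.
    These two quantities are collected 7 and 3 times, and 11 covers the remaining terms. *)
Definition infsup_const (c : R) : R := 3 * ((2 / c + 4) / c) + 7 * (2 / c + 4) + 11.

Lemma infsup_const_gt0 c : 0 < c -> 0 < infsup_const c.
Proof.
move=> c0; have k0 : 0 < 2 / c by rewrite divr_gt0.
have k1 : 0 < (2 / c + 4) / c by rewrite divr_gt0// addr_gt0.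
by rewrite /infsup_const; lra.
Qed.

(** Here u - Lt and s + t stand for z0 and Delta z0, while s - Lv and v stand for z1 and Delta z1.
    The two hypotheses are the Poincare inequality for z0 and the symmetry relation between z0 and
    z1. *)
Lemma infsup_estimate (c : R) (u s t v Lt Lv : E) : 0 < c ->
  c * nsq b (u - Lt) <= nsq b (s + t) ->
  b (s - Lv) (s + t) = b v (u - Lt) ->
  nsq b u + nsq b s + (nsq b (u - Lt) + nsq b (s + t)) + (nsq b (s - Lv) + nsq b v) <=
    infsup_const c * (nsq b v + nsq b Lv + (nsq b t + nsq b Lt)).
Proof.
move=> c0 poinc dual.
set eta := nsq b v + nsq b Lv + _.
have [v0 Lv0 t0 Lt0] : [/\ 0 <= nsq b v, 0 <= nsq b Lv, 0 <= nsq b t & 0 <= nsq b Lt].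
  by split; exact: nsq_ge0.
set Z := u - Lt in poinc dual *; set D := s + t in poinc dual *.
have DE : nsq b D = b v Z + b (Lv + t) D.
  rewrite -dual /nsq -ipDl; congr (b _ D).
  by rewrite /D addrA subrK.
(* The parameter 1 / c leaves c |Z|^2 / 4, at most |D|^2 / 4 by the Poincare inequality; with the
   same share from [h2], half of |D|^2 is absorbed. *)
have h1 : b v Z <= c^-1 * nsq b v + 4^-1 * (c * nsq b Z).
  have := @ip_young v Z c^-1; rewrite invr_gt0 => /(_ c0).
  by rewrite invfM invrK mulrA.
have h2 : b (Lv + t) D <= nsq b (Lv + t) + 4^-1 * nsq b D.
  by have := @ip_young (Lv + t) D 1 ltr01; rewrite mul1r mulr1.
have h3 := nsqD_le b Lv t.
have hv : c^-1 * nsq b v <= c^-1 * eta.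
  by rewrite ler_wpM2l ?invr_ge0 ?(ltW c0)// /eta; lra.
have [e1 e2 e3] : [/\ nsq b v <= eta, nsq b Lv + nsq b t <= eta & nsq b Lt <= eta].
  by rewrite /eta; split; lra.
have hD : nsq b D <= (2 / c + 4) * eta.
  have -> : (2 / c + 4) * eta = 2 * (c^-1 * eta) + 4 * eta by rewrite mulrDl mulrA.
  by move: (c^-1 * eta) (c^-1 * nsq b v) (c * nsq b Z) hv h1 poinc => x1 x2 x3; lra.
have hZ : nsq b Z <= (2 / c + 4) / c * eta.
  by rewrite mulrAC ler_pdivlMr// mulrC; exact: le_trans poinc hD.
have hu : nsq b u <= 2 * (nsq b Z + nsq b Lt).
  by have := nsqD_le b Z Lt; rewrite /Z subrK.
have hs : nsq b s <= 2 * (nsq b D + nsq b t).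
  by have := nsqD_le b D (- t); rewrite nsqN /D addrK.
have hz1 : nsq b (s - Lv) <= 2 * (nsq b s + nsq b Lv).
  by have := nsqD_le b s (- Lv); rewrite nsqN.
rewrite /infsup_const; set k1 := (2 / c + 4) / c in hZ *; set k2 := 2 / c + 4 in hD *.
have -> : (3 * k1 + 7 * k2 + 11) * eta = 3 * (k1 * eta) + 7 * (k2 * eta) + 11 * eta by ring.
move: (k1 * eta) (k2 * eta) (nsq b Z) (nsq b D) (nsq b (s - Lv)) hD hZ hu hs hz1.
by move=> x1 x2 x3 x4 x5; lra.
Qed.

End infsup.

Section spaces_theory.
Context {R : realType} {d : nat} {Omega : lipschitz_domain R d}.

Local Notation H := (L2dom Omega).
Let dot := L2dot (lebesgue_on Omega).

Variable M : mesh Omega.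

Let mM i : measurable (dom_set (M i)).
Proof. exact: measurable_dom. Qed.

Let MO i : dom_set (M i) `<=` Omega.
Proof. by move=> x; exact: mesh_sub. Qed.

Lemma mesh_laplacian0 i : has_laplacian (M i) (0 : H) (0 : H).
Proof.
have [g zg] := @HDelta_mesh0 _ _ _ M i.
have := has_laplacian_L2_lin (mM i) (@MO i) (-1) zg zg.
by rewrite scaler0 addr0 scaleN1r addNr.
Qed.

Lemma laplacian0 : has_laplacian Omega (0 : H) (0 : H).
Proof.
have [s0 l0] := @smooth0_laplacian0 R d.
have L0 : (fun _ : 'rV[R]_d => 0 : R^o) \in Lfun (lebesgue_on Omega) 2%:E.
  apply: Lfun2P; first exact: measurable_cst.
  by rewrite integral0_eq// => x _; rewrite expr0n.
have h := smooth_has_laplacian s0 L0; rewrite l0 in h.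
have := has_laplacian_L2_lin (measurable_dom Omega) (@subset_refl _ _) (-1) (h L0) (h L0).
by rewrite !scaleN1r !addNr.
Qed.

Lemma lapD (a : R) (z z' : H) : HDelta z -> HDelta z' ->
  HDelta (a *: z + z') /\ lap (a *: z + z') = a *: lap z + lap z'.
Proof.
move=> /lapP h /lapP h'.
have hh := has_laplacian_L2_lin (measurable_dom Omega) (@subset_refl _ _) a h h'.
by split; [exists (a *: lap z + lap z')|exact: lapE hh].
Qed.

Lemma lap_mesh (z : H) : HDelta z -> HDelta_mesh M z /\ pwlap M z = lap z.
Proof.
move=> /lapP h0; have h := @laplacian_mesh _ _ _ M _ _ h0; split; [exact: HDelta_meshP h|exact: pwlapE h].
Qed.

Lemma HDelta0_lin (a : R) (z z' : H) : HDelta0 z -> HDelta0 z' -> HDelta0 (a *: z + z').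
Proof.
move=> [hz h] [hz' h']; have [hh E] := lapD a hz hz'.
split=> [//|v hv]; rewrite E.
move: (lap z) (lap z') (lap v) (h v hv) (h' v hv) => lz lz' lv; rewrite !ip_dot => e1 e2.
rewrite (ipDl _ (a *: z)) (ipDl _ (a *: lz)) !ipZl.
by move: e1 e2; move: (ip_op _ z _) (ip_op _ z' _) (ip_op _ lz _) (ip_op _ lz' _) => x1 x2 x3 x4; nra.
Qed.

Lemma trE (z : H) (x : HDelta_mesh M) :
  tr z x = dot (pwlap M (val x)) z - dot (val x) (lap z).
Proof. by rewrite /tr sumrB !mesh_ip. Qed.

Lemma tr_lin (a : R) (z z' : H) : HDelta z -> HDelta z' ->
  tr (M := M) (a *: z + z') = a *: tr z + tr z'.
Proof.
move=> hz hz'; have [_ E] := lapD a hz hz'; apply/funext => x.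
transitivity (a * tr z x + tr z' x); last by [].
rewrite (trE z x) (trE z' x) trE E; move: (lap z) (lap z') (pwlap M (val x)) => lz lz' g.
rewrite (ipDr _ g) (ipZr _ a g) (ipDr _ (val x)) (ipZr _ a (val x)).
by move: (ip_op _ _ z) (ip_op _ _ z') (ip_op _ _ lz) (ip_op _ _ lz') => x1 x2 x3 x4; ring.
Qed.

Lemma HDelta_mesh_ipE (z w : H) :
  HDelta_mesh_ip M z w = dot z w + dot (pwlap M z) (pwlap M w).
Proof. by rewrite /HDelta_mesh_ip big_split/= !mesh_ip. Qed.

(** Riesz's theorem on the graph of the piecewise Laplacian, a closed subspace of L_2 x L_2.
    Computing [T1] splits into two such problems, one for each test component. *)
Lemma mesh_riesz (p q : H) : exists2 t : H, HDelta_mesh M t &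
  forall x, HDelta_mesh M x -> dot t x + dot (pwlap M t) (pwlap M x) = dot q x + dot p (pwlap M x).
Proof.
pose G := [set x : H * H | forall i, has_laplacian (M i) x.1 x.2].
have [||||[t g] /= tg tE] := @riesz_closed _ _ (prod_ip dot) G (fun x => prod_ip dot (q, p) x)
    (nsq (prod_ip dot) (q, p)) (prod_ip_complete (@L2_complete _ _ _ _)).
- split=> [i|a [x x'] [y y'] hx hy i]; first exact: mesh_laplacian0.
  exact: (has_laplacian_L2_lin (mM i) (@MO i) a (hx i) (hy i)).
- move=> u x Gu ux i; apply: (has_laplacian_L2_closed (mM i) (@MO i) _ ux) => n.
  exact: Gu.
- by move=> a x y _ _; rewrite ipDr ipZr.
- by move=> x _; exact: cauchy_schwarz_sqr.
exists t; first exact: HDelta_meshP tg.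
move=> x /pwlapP hx; rewrite (pwlapE tg).
exact: (tE (x, pwlap M x) hx).
Qed.

End spaces_theory.

(** * The trial-to-test operator and the energy form *)

Section trial_to_test.
Context {R : realType} {d : nat} {Omega : lipschitz_domain R d}.
Variable M : mesh Omega.

Local Notation H := (L2dom Omega).
Local Notation dot := (L2dot (lebesgue_on Omega)).
Local Notation L := (pwlap M).

Lemma U1P (w : trial M) : U1 w -> exists (u s z0 z1 : H),
  [/\ w = (u, s, tr z0, tr z1), HDelta0 z0 & HDelta z1].
Proof. by case: w => [[[u s] uh] sh] [/= [z0 h0 <-] [z1 h1 <-]]; exists u, s, z0, z1. Qed.

Lemma V1_ipE (x y : V1 M) : V1_ip x y =
  dot (val x.1) (val y.1) + dot (L (val x.1)) (L (val y.1)) +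
  (dot (val x.2) (val y.2) + dot (L (val x.2)) (L (val y.2))).
Proof. by rewrite /V1_ip !HDelta_mesh_ipE. Qed.

Lemma V1_ipC (x y : V1 M) : V1_ip x y = V1_ip y x.
Proof.
rewrite !V1_ipE; move: (L (val x.1)) (L (val x.2)) (L (val y.1)) (L (val y.2)) => x1 x2 y1 y2.
move: (val x.1) (val x.2) (val y.1) (val y.2) => x3 x4 y3 y4.
by rewrite (ipC _ x1) (ipC _ x2) (ipC _ x3) (ipC _ x4).
Qed.

Lemma V1_ip_ge0 (x : V1 M) : 0 <= V1_ip x x.
Proof. by rewrite V1_ipE !addr_ge0//; exact: ip_ge0. Qed.

(** Expanding the traces turns [b1] into L_2 products with each test component and its piecewise
    Laplacian, the form of right-hand side in [mesh_riesz]. *)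
Lemma b1E (u s z0 z1 : H) (x : V1 M) : b1 (u, s, tr z0, tr z1) x =
  dot (u - z0) (L (val x.2)) + dot (lap z0 - s) (val x.2) +
  (dot (s - z1) (L (val x.1)) + dot (lap z1) (val x.1)).
Proof.
case: x => [v t]; change (v, t).1 with v; change (v, t).2 with t.
rewrite /b1 !trE !ip_dot.
move: (lap z0) (lap z1) (L (val v)) (L (val t)) => l0 l1 Lv Lt; move: (val v) (val t) => v' t'.
rewrite ipBr !ipBl (ipC _ Lt z0) (ipC _ t' l0) (ipC _ Lv z1) (ipC _ v' l1).
move: (ip_op _ u Lt) (ip_op _ s Lv) (ip_op _ s t') (ip_op _ z0 Lt) (ip_op _ l0 t')
  (ip_op _ z1 Lv) (ip_op _ l1 v') => x1 x2 x3 x4 x5 x6 x7; ring.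
Qed.

Lemma b1_lin (a : R) (w w' : trial M) (x : V1 M) :
  b1 (a *: w + w') x = a * b1 w x + b1 w' x.
Proof.
case: w => [[[u s] uh] sh]; case: w' => [[[u' s'] uh'] sh']; case: x => [v t].
transitivity (ip Omega (a *: u + u' : H) (L (val t)) +
  ip Omega (a *: s + s' : H) (L (val v) - val t : H) -
  (a * uh t + uh' t) - (a * sh v + sh' v)); first by [].
rewrite /b1 !ip_dot; move: (L (val t)) (L (val v) - val t) => g1 g2.
rewrite !ipDl !ipZl.
by move: (ip_op _ u g1) (ip_op _ u' g1) (ip_op _ s g2) (ip_op _ s' g2) (uh t) (uh' t) (sh v) (sh' v)
  => x1 x2 x3 x4 x5 x6 x7 x8; ring.
Qed.

Lemma subspace_U1 : subspace (U1 (M := M)).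
Proof.
have tr0 : tr (M := M) (0 : H) = 0.
  have l0 := lapE (@laplacian0 _ _ Omega).
  apply/funext => x; rewrite trE l0 !ip0r subr0; by [].
have H0 : HDelta (0 : H) by exists 0; exact: laplacian0.
split; first split => /=.
- exists 0 => //; split=> // v hv; rewrite !ip_dot (lapE laplacian0) !ip0l subr0; by [].
- by exists 0.
move=> a w w' /U1P[u [s [z0 [z1 [-> h0 h1]]]]] /U1P[u' [s' [z0' [z1' [-> h0' h1']]]]].
split=> /=.
- exists (a *: z0 + z0'); first exact: HDelta0_lin.
  by rewrite tr_lin//; [exact: h0.1|exact: h0'.1].
- by exists (a *: z1 + z1'); [exact: (lapD a h1 h1').1|rewrite tr_lin].
Qed.

Lemma T1P (w : trial M) : U1 w -> forall x, V1_ip (T1 w) x = b1 w x.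
Proof.
move=> /U1P[u [s [z0 [z1 [wE h0 h1]]]]].
have [t ht tE] := mesh_riesz M (u - z0) (lap z0 - s).
have [v hv vE] := mesh_riesz M (s - z1) (lap z1).
apply: (@xgetPex _ _ [set t | forall x, V1_ip t x = b1 w x]).
exists (exist _ v (mem_set hv), exist _ t (mem_set ht)) => x.
have := tE _ (set_valP x.2); have := vE _ (set_valP x.1).
rewrite wE b1E; move: (val x.1) (val x.2) (V1_ipE (exist _ v (mem_set hv), exist _ t (mem_set ht)) x).
move=> x1 x2 -> e1 e2; rewrite [LHS]addrC.
transitivity (dot t x2 + dot (L t) (L x2) + (dot v x1 + dot (L v) (L x1))); first by [].
by rewrite e1 e2 (addrC (dot (lap z0 - s) x2)) (addrC (dot (lap z1) x1)).
Qed.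

Definition energy (w w' : trial M) : R := V1_ip (T1 w) (T1 w').

Lemma energyE w w' : U1 w -> energy w w' = b1 w (T1 w').
Proof. by move=> h; rewrite /energy T1P. Qed.

Lemma energyC w w' : energy w w' = energy w' w.
Proof. exact: V1_ipC. Qed.

(** Linearity is inherited from [b1] through the defining relation of [T1], which is available on
    [U1]; hence forms that are bilinear on a subspace in the projection lemma. *)
Lemma energy_lin (a : R) w w' w'' : U1 w -> U1 w' ->
  energy (a *: w + w') w'' = a * energy w w'' + energy w' w''.
Proof.
move=> h h'; have hh := subspace_U1.2 a _ _ h h'.
by rewrite !energyE// b1_lin.
Qed.

Lemma energy_ge0 w : 0 <= energy w w.
Proof. exact: V1_ip_ge0. Qed.

End trial_to_test.

(** * Boundedness of the bilinear form *)

Section stability.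
Context {R : realType} {d : nat} {Omega : lipschitz_domain R d}.
Variable M : mesh Omega.

Local Notation H := (L2dom Omega).
Local Notation dot := (L2dot (lebesgue_on Omega)).
Local Notation L := (pwlap M).

Lemma HDelta_norm_sqr (z : H) : HDelta_norm z ^+ 2 = nsq dot z + nsq dot (lap z).
Proof. by rewrite /HDelta_norm !ip_dot sqr_sqrtr// addr_ge0//; exact: ip_ge0. Qed.

Lemma ler_norm_sum5 (x1 x2 x3 x4 x5 m : R) : `|x1| <= m -> `|x2| <= m -> `|x3| <= m ->
  `|x4| <= m -> `|x5| <= m -> `|x1 + (x2 - x3) - x4 - x5| <= 5 * m.
Proof.
rewrite !ler_norml => /andP[? ?] /andP[? ?] /andP[? ?] /andP[? ?] /andP[? ?].
by apply/andP; split; lra.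
Qed.

Let norms_lb (h : functional M) :
  lbound [set HDelta_norm v | v in [set v | HDelta v /\ tr v = h]] 0.
Proof. by move=> _ [v _ <-]; exact: sqrtr_ge0. Qed.

Lemma trace_norm_le (z : H) : HDelta z -> trace_norm (tr (M := M) z) <= HDelta_norm z.
Proof. by move=> hz; apply: ge_inf; [exists 0; exact: norms_lb|exists z]. Qed.

Lemma trace_norm_ge0 (h : functional M) : trace_space h -> 0 <= trace_norm h.
Proof.
by move=> [z hz zh]; apply: lb_le_inf; [exists (HDelta_norm z), z|exact: norms_lb].
Qed.

(** Cauchy-Schwarz in L_2 x L_2 bounds |h x| through any z with trace h; the infimum over z gives
    the trace norm. *)
Lemma trace_norm_bound (h : functional M) (x : HDelta_mesh M) : trace_space h ->
  `|h x| <= trace_norm h * Num.sqrt (nsq dot (val x) + nsq dot (L (val x))).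
Proof.
move=> [z0 hz0 z0h]; set m := Num.sqrt _.
have bound z : HDelta z -> tr z = h -> `|h x| <= HDelta_norm z * m.
  move=> hz <-; have -> : tr z x = prod_ip dot (L (val x), val x) (z, - lap z).
    by rewrite trE -[RHS]/(dot (L (val x)) z + dot (val x) (- lap z)) ipNr.
  apply: le_trans (cauchy_schwarz _ _ _) _.
  have -> : nsq (prod_ip dot) (L (val x), val x) = nsq dot (val x) + nsq dot (L (val x)).
    by rewrite addrC.
  have -> : nsq (prod_ip dot) (z, - lap z) = nsq dot z + nsq dot (lap z).
    by rewrite -[LHS]/(nsq dot z + nsq dot (- lap z)) nsqN.
  by rewrite -HDelta_norm_sqr sqrtr_sqr ger0_norm ?sqrtr_ge0// mulrC.
(* For m = 0 the bound through one representative is already 0; otherwise m is divided out before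
   the infimum is taken. *)
have [m0|m0] := eqVneq m 0.
  by rewrite m0 mulr0; have := bound _ hz0 z0h; rewrite m0 mulr0.
have {}m0 : 0 < m by rewrite lt0r m0 sqrtr_ge0.
rewrite -ler_pdivrMr//; apply: lb_le_inf; first by exists (HDelta_norm z0), z0.
by move=> _ [z [hz zh] <-]; rewrite ler_pdivrMr//; exact: bound.
Qed.

Lemma U1_norm_sqr (u s : H) (uh sh : functional M) : U1_norm (u, s, uh, sh) ^+ 2 =
  nsq dot u + nsq dot s + trace_norm uh ^+ 2 + trace_norm sh ^+ 2.
Proof.
by rewrite /U1_norm !ip_dot sqr_sqrtr// !addr_ge0 ?sqr_ge0//; exact: ip_ge0.
Qed.

Lemma U1_norm_ge0 (w : trial M) : 0 <= U1_norm w.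
Proof. by case: w => [[[u s] uh] sh]; exact: sqrtr_ge0. Qed.

Lemma HDelta0_trace_space (h : functional M) : trace_space00 h -> trace_space h.
Proof. by move=> [z [hz _] <-]; exists z. Qed.

Lemma b1_bound (w : trial M) (x : V1 M) : U1 w ->
  `|b1 w x| <= 5 * (U1_norm w * Num.sqrt (V1_ip x x)).
Proof.
have le_sq (a b c : R) : 0 <= a -> 0 <= b -> a <= b ^+ 2 -> Num.sqrt a <= b.
  by move=> a0 b0 ab; rewrite -(ger0_norm b0) -sqrtr_sqr ler_wsqrtr.
case: w => [[[u s] uh] sh] hw.
have h0 : trace_space uh by exact: HDelta0_trace_space hw.1.
have h1 : trace_space sh by exact: hw.2.
set N := U1_norm _; set e := Num.sqrt (V1_ip x x).
have N0 : 0 <= N by exact: U1_norm_ge0.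
have e0 : 0 <= e by exact: sqrtr_ge0.
have n0 f : 0 <= nsq dot f := nsq_ge0 dot f.
have tuh := trace_norm_ge0 h0; have tsh := trace_norm_ge0 h1.
have [uN sN uhN shN] : [/\ Num.sqrt (nsq dot u) <= N, Num.sqrt (nsq dot s) <= N,
    trace_norm uh <= N & trace_norm sh <= N].
  have := U1_norm_sqr u s uh sh; rewrite -/N.
  have := sqr_ge0 (trace_norm uh); have := sqr_ge0 (trace_norm sh).
  have := n0 u; have := n0 s; move: (nsq dot u) (nsq dot s) => a b b0 a0 q1 q2 NE.
  split; [apply: le_sq => //; lra|apply: le_sq => //; lra| |].
  - by rewrite -ler_sqr ?nnegrE// NE; lra.
  - by rewrite -ler_sqr ?nnegrE// NE; lra.
have [e1 e2 e3 e4 e5] : [/\ Num.sqrt (nsq dot (L (val x.2))) <= e,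
    Num.sqrt (nsq dot (L (val x.1))) <= e, Num.sqrt (nsq dot (val x.2)) <= e,
    Num.sqrt (nsq dot (val x.2) + nsq dot (L (val x.2))) <= e &
    Num.sqrt (nsq dot (val x.1) + nsq dot (L (val x.1))) <= e].
  have : V1_ip x x = nsq dot (val x.1) + nsq dot (L (val x.1)) +
    (nsq dot (val x.2) + nsq dot (L (val x.2))) := V1_ipE x x.
  rewrite /e; move: (n0 (val x.1)) (n0 (val x.2)) (n0 (L (val x.1))) (n0 (L (val x.2))).
  move: (V1_ip x x) (nsq dot (L (val x.1))) (nsq dot (L (val x.2))) => q0 q1 q2.
  move: (nsq dot (val x.1)) (nsq dot (val x.2)) => q3 q4 p1 p2 p3 p4 qE.
  by split; apply: ler_wsqrtr; lra.
have sq0 (q : R) : 0 <= Num.sqrt q := sqrtr_ge0 q.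
have b1' : `|dot u (L (val x.2))| <= N * e.
  exact: le_trans (cauchy_schwarz _ _ _) (ler_pM (sq0 _) (sq0 _) uN e1).
have b2 : `|dot s (L (val x.1))| <= N * e.
  exact: le_trans (cauchy_schwarz _ _ _) (ler_pM (sq0 _) (sq0 _) sN e2).
have b3 : `|dot s (val x.2)| <= N * e.
  exact: le_trans (cauchy_schwarz _ _ _) (ler_pM (sq0 _) (sq0 _) sN e3).
have b4 : `|uh x.2| <= N * e.
  exact: le_trans (trace_norm_bound _ h0) (ler_pM tuh (sq0 _) uhN e4).
have b5 : `|sh x.1| <= N * e.
  exact: le_trans (trace_norm_bound _ h1) (ler_pM tsh (sq0 _) shN e5).
have -> : b1 (u, s, uh, sh) x = ip Omega u (L (val x.2)) +
    ip Omega s (L (val x.1) - val x.2 : H) - uh x.2 - sh x.1.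
  by case: (x).
rewrite (ip_dot u) (ip_dot s) (ipBr _ s).
exact: ler_norm_sum5.
Qed.

(** The energy of w equals b1 w (T1 w), at most 5 [U1_norm] w times the square root of that energy;
    cancelling the root and squaring gives 25. *)
Lemma energy_le (w : trial M) : U1 w -> energy w w <= 25 * U1_norm w ^+ 2.
Proof.
move=> hw; have := b1_bound (T1 w) hw; rewrite -energyE// -/(energy w w).
have e0 := energy_ge0 w; have N0 := U1_norm_ge0 w; rewrite ger0_norm//.
have E := sqr_sqrtr e0; have := sqrtr_ge0 (energy w w); rewrite -[X in X <= 5 * _]E -[X in X <= 25 * _]E.
by move: (Num.sqrt _) (U1_norm w) N0 => t N N0; nra.
Qed.

End stability.

(** * Coercivity of the energy form *)

Section inf_sup.
Context {R : realType} {d : nat} {Omega : lipschitz_domain R d}.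
Variable M : mesh Omega.

Local Notation H := (L2dom Omega).
Local Notation dot := (L2dot (lebesgue_on Omega)).
Local Notation L := (pwlap M).

Variable c : R.
Hypothesis c0 : 0 < c.
Hypothesis adjoint : forall p r : H,
  (forall v g : H, has_laplacian Omega v g -> dot p g = dot r v) ->
  has_laplacian Omega p r /\ c * nsq dot p <= nsq dot r.

Lemma adjoint_mesh (p r : H) :
  (forall x, HDelta_mesh M x -> dot p (L x) = dot r x) ->
  [/\ HDelta0 p, lap p = r & tr (M := M) p = 0].
Proof.
move=> pr; have [hp _] : has_laplacian Omega p r /\ c * nsq dot p <= nsq dot r.
  apply: adjoint => v g vg; have [vM vL] := lap_mesh M (ex_intro _ g vg : HDelta v).
  by rewrite -(lapE vg) -vL; exact: pr.
have lp := lapE hp; split=> //.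
  split=> [|v hv]; first by exists r.
  by have [vM vL] := lap_mesh M hv; rewrite !ip_dot lp -vL pr// subrr.
apply/funext => x; rewrite trE lp (ipC _ (L (val x))) (ipC _ (val x)) pr ?subrr//.
exact: set_valP.
Qed.

Lemma poincare_HDelta0 (z : H) : HDelta0 z -> c * nsq dot z <= nsq dot (lap z).
Proof.
move=> [hz h]; apply: (adjoint _).2 => v g vg.
have := h v (ex_intro _ g vg); rewrite !ip_dot (lapE vg) => /eqP.
by rewrite subr_eq0 => /eqP.
Qed.

Lemma U1_normal_form (w : trial M) : U1 w -> exists (u s z0 z1 : H),
  let v := val (T1 w).1 in let t := val (T1 w).2 in
  [/\ w = (u, s, tr z0, tr z1), HDelta0 z0 /\ HDelta z1,
      z0 = u - L t, lap z0 = s + t & z1 = s - L v /\ lap z1 = v].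
Proof.
move=> hw; have [u [s [z0 [z1 [wE h0 h1]]]]] := U1P hw.
have TP := T1P hw; exists u, s.
move: (T1 w) TP => [[v hv] [t ht]] TP.
have hv' := set_mem hv; have ht' := set_mem ht.
have h00 : HDelta_mesh M (0 : H) by exact: HDelta_mesh0.
have L0 : L 0 = 0 by apply: pwlapE; exact: mesh_laplacian0.
have eq1 x : HDelta_mesh M x -> dot (u - z0 - L t) (L x) = dot (s - lap z0 + t) x.
  move=> hx; have := TP (exist _ 0 (mem_set h00), exist _ x (mem_set hx)).
  rewrite V1_ipE wE b1E.
  change (dot v 0 + dot (L v) (L 0) + (dot t x + dot (L t) (L x)) =
    dot (u - z0) (L x) + dot (lap z0 - s) x + (dot (s - z1) (L 0) + dot (lap z1) 0) ->
    dot (u - z0 - L t) (L x) = dot (s - lap z0 + t) x).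
  rewrite L0 !ip0r !addr0 add0r (ipBl _ (u - z0)) (ipDl _ (s - lap z0)) -(opprB (lap z0) s) ipNl.
  by move: (dot t x) (dot (L t) (L x)) (dot (u - z0) (L x)) (dot (lap z0 - s) x) => x1 x2 x3 x4; lra.
have eq2 x : HDelta_mesh M x -> dot (s - z1 - L v) (L x) = dot (v - lap z1) x.
  move=> hx; have := TP (exist _ x (mem_set hx), exist _ 0 (mem_set h00)).
  rewrite V1_ipE wE b1E.
  change (dot v x + dot (L v) (L x) + (dot t 0 + dot (L t) (L 0)) =
    dot (u - z0) (L 0) + dot (lap z0 - s) 0 + (dot (s - z1) (L x) + dot (lap z1) x) ->
    dot (s - z1 - L v) (L x) = dot (v - lap z1) x).
  rewrite L0 !ip0r !addr0 add0r (ipBl _ (s - z1)) (ipBl _ v).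
  by move: (dot v x) (dot (L v) (L x)) (dot (s - z1) (L x)) (dot (lap z1) x) => x1 x2 x3 x4; lra.
have [p0 lp0 tp0] := adjoint_mesh eq1.
have [p1 lp1 tp1] := adjoint_mesh eq2.
have hz0 := HDelta0_lin 1 p0 h0; have [hz1 lz1] := lapD 1 p1.1 h1.
have [_ lz0] := lapD 1 p0.1 h0.1.
have tz0 := tr_lin M 1 p0.1 h0.1; have tz1 := tr_lin M 1 p1.1 h1.
have scale_add (p q r : H) : p = r - q -> 1 *: p + q = r by move=> ->; rewrite scale1r subrK.
have E0 : 1 *: (u - z0 - L t) + z0 = u - L t by apply: scale_add; rewrite addrAC.
have E1 : 1 *: (s - z1 - L v) + z1 = s - L v by apply: scale_add; rewrite addrAC.
have F0 : 1 *: (s - lap z0 + t) + lap z0 = s + t by apply: scale_add; rewrite [RHS]addrAC.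
have F1 : 1 *: (v - lap z1) + lap z1 = v by exact: scale_add.
rewrite lp0 F0 in lz0; rewrite lp1 F1 in lz1.
rewrite tp0 scaler0 add0r in tz0; rewrite tp1 scaler0 add0r in tz1.
rewrite E0 in hz0 lz0 tz0; rewrite E1 in hz1 lz1 tz1.
exists (u - L t), (s - L v).
split; [by rewrite wE tz0 tz1|exact: conj hz0 hz1|exact: erefl|exact: lz0|].
exact: conj (erefl _) lz1.
Qed.

(** Trace norms are infima, so the representatives of the normal form bound them from above, by
    exactly the terms in [infsup_estimate]. *)
Lemma energy_coercive (w : trial M) : U1 w ->
  U1_norm w ^+ 2 <= infsup_const c * energy w w.
Proof.
move=> hw; have [u [s [z0 [z1]]]] := U1_normal_form hw; cbv zeta; case=> wE [h0 h1].
rewrite /energy V1_ipE; move: (val (T1 w).1) (val (T1 w).2) => v t z0E lz0 [z1E lz1].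
rewrite wE U1_norm_sqr.
have n0 : trace_norm (tr (M := M) z0) ^+ 2 <= nsq dot (u - L t) + nsq dot (s + t).
  rewrite -z0E -lz0 -HDelta_norm_sqr ler_sqr ?nnegrE.
  - exact: trace_norm_le h0.1.
  - by apply: trace_norm_ge0; exists z0 => //; exact: h0.1.
  - exact: sqrtr_ge0.
have n1 : trace_norm (tr (M := M) z1) ^+ 2 <= nsq dot (s - L v) + nsq dot v.
  rewrite -z1E -lz1 -HDelta_norm_sqr ler_sqr ?nnegrE.
  - exact: trace_norm_le h1.
  - by apply: trace_norm_ge0; exists z1.
  - exact: sqrtr_ge0.
have P : c * nsq dot (u - L t) <= nsq dot (s + t).
  by rewrite -z0E -lz0; exact: poincare_HDelta0.
have D : dot (s - L v) (s + t) = dot v (u - L t).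
  rewrite -z0E -lz0 -z1E -lz1; have := h0.2 z1 h1; rewrite !ip_dot => /eqP.
  by rewrite subr_eq0 => /eqP e; rewrite (ipC _ z1) -e; exact: ipC.
apply: le_trans (infsup_estimate c0 P D).
by rewrite -[leLHS]addrA -[leRHS]addrA lerD2l lerD.
Qed.

End inf_sup.

(** * The discrete problem *)

Section galerkin.
Context {R : realType} {d : nat} {Omega : lipschitz_domain R d}.
Variable M : mesh Omega.

Variable K : R.
Hypothesis K0 : 0 < K.
Hypothesis coercive : forall w : trial M, U1 w -> U1_norm w ^+ 2 <= K * energy w w.

Lemma sqr_le_mul (x y : R) : 0 <= x -> 0 <= y -> x ^+ 2 <= y * x -> x <= y.
Proof. by move=> x0 y0 xy; nra. Qed.

Lemma le_sqrtM (k x y : R) : 0 <= k -> 0 <= x -> 0 <= y -> x ^+ 2 <= k * y ^+ 2 ->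
  x <= Num.sqrt k * y.
Proof.
move=> k0 x0 y0 xy; rewrite -ler_sqr ?nnegrE ?mulr_ge0 ?sqrtr_ge0//.
by rewrite exprMn sqr_sqrtr.
Qed.

(** The trace norm is definite because, by [trace_norm_bound], a trace of norm 0 vanishes on every
    test function. *)
Lemma U1_norm_eq0 (w : trial M) : U1 w -> U1_norm w = 0 -> w = 0.
Proof.
case: w => [[[u s] uh] sh] hw N0; have := U1_norm_sqr u s uh sh.
have h0 := HDelta0_trace_space hw.1; have h1 : trace_space sh by exact: hw.2.
rewrite N0 expr0n => /esym/eqP.
have u0 := nsq_ge0 (L2dot (lebesgue_on Omega)) u.
have s0 := nsq_ge0 (L2dot (lebesgue_on Omega)) s.
rewrite !paddr_eq0 ?addr_ge0 ?sqr_ge0// !sqrf_eq0 => /andP[/andP[/andP[/eqP ue /eqP se] /eqP he] /eqP ke].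
have hz (h : functional M) : trace_space h -> trace_norm h = 0 -> h = 0.
  move=> hh e; apply/funext => x; apply/eqP; rewrite -normr_le0.
  by have := trace_norm_bound x hh; rewrite e mul0r.
have -> : u = 0 := @ip_eq0 _ _ (L2dot (lebesgue_on Omega)) u ue.
have -> : s = 0 := @ip_eq0 _ _ (L2dot (lebesgue_on Omega)) s se.
by rewrite (hz uh h0 he) (hz sh h1 ke).
Qed.

Lemma U1_sub (w w' : trial M) : U1 w -> U1 w' -> U1 (w - w').
Proof.
move=> h h'; have := (subspace_U1 M).2 (-1) _ _ h' h.
by rewrite scaleN1r addrC.
Qed.

Lemma energyBl (w w' w'' : trial M) : U1 w -> U1 w' ->
  energy (w - w') w'' = energy w w'' - energy w' w''.
Proof.
move=> h h'; have := energy_lin (-1) w'' h' h.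
by rewrite scaleN1r (addrC (- w')) mulN1r [RHS]addrC.
Qed.

Section galerkin_solution.
Variables (u : trial M) (Uh : set (trial M)).
Hypotheses (hu : U1 u) (UhU : Uh `<=` U1 (M:=M)) (fin : finite_dim_subspace Uh).

Let UhB w w' : Uh w -> Uh w' -> Uh (w - w').
Proof.
by case: fin => _ h _ hw hw'; have := h (-1) _ _ hw' hw; rewrite scaleN1r addrC.
Qed.

Definition galerkin uh := Uh uh /\ forall w, Uh w -> energy uh w = energy u w.

Lemma galerkin_exists : exists uh, galerkin uh.
Proof.
have [uh h1 h2] := finite_dim_projection (subspace_U1 M) (fun x y _ _ => energyC x y)
  (fun a x y z hx hy _ => energy_lin a z hx hy) (fun x _ => energy_ge0 x) UhU fin hu.
by exists uh.
Qed.

Lemma galerkin_unique uh uh' : galerkin uh -> galerkin uh' -> uh = uh'.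
Proof.
move=> [h e] [h' e']; apply/eqP; rewrite -subr_eq0; apply/eqP.
have hd := UhB h h'; apply: U1_norm_eq0; first exact: UhU.
have := coercive (UhU hd); rewrite energyBl ?e ?e' ?subrr ?mulr0//; try exact: UhU.
by move=> le0; apply/eqP; rewrite -sqrf_eq0 eq_le le0 sqr_ge0.
Qed.

(** By symmetry of the form, uh is a best approximation of u in the energy norm. Passing to
    [U1_norm] costs the factors K and 25 for squared norms, hence the square root of their
    product. *)
Lemma galerkin_quasi_optimal uh w : galerkin uh -> Uh w ->
  U1_norm (u - uh) <= Num.sqrt (K * 25) * U1_norm (u - w).
Proof.
move=> [h e] hw; have Eu := U1_sub hu (UhU h); have Ew := U1_sub hu (UhU hw).
have orth v : Uh v -> energy (u - uh) v = 0.
  by move=> hv; rewrite energyBl ?e ?subrr//; exact: UhU.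
have eqE : energy (u - uh) (u - uh) = energy (u - w) (u - uh).
  have {1}-> : u - uh = (u - w) - (uh - w) by rewrite opprB addrA subrK.
  have hd := UhB h hw.
  by rewrite energyBl ?(energyC (uh - w)) ?orth ?subr0//; exact: UhU.
have := form_cauchy_schwarz (subspace_U1 M) (fun x y _ _ => energyC x y)
  (fun a x y z hx hy _ => energy_lin a z hx hy) (fun x _ => energy_ge0 x) Ew Eu.
rewrite -eqE => cs.
have le1 : energy (u - uh) (u - uh) <= energy (u - w) (u - w).
  exact: sqr_le_mul (energy_ge0 _) (energy_ge0 _) cs.
have le2 := ler_wpM2l (ltW K0) (le_trans le1 (energy_le Ew)); rewrite mulrA in le2.
have K25 : 0 <= K * 25 := mulr_ge0 (ltW K0) (ler0n _ _).
exact: le_sqrtM K25 (U1_norm_ge0 _) (U1_norm_ge0 _) (le_trans (coercive Eu) le2).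
Qed.

End galerkin_solution.
End galerkin.

Theorem theorem12 (R : realType) (d : nat) (hd : d = 2%N \/ d = 3%N)
    (Omega : lipschitz_domain R d)
    (hbounded : bounded_set (dom_set Omega))
    (hsimply : simply_connected (dom_set Omega)) :
  exists C : R, 0 < C /\
    forall (M : mesh Omega) (f : L2dom Omega) (u : trial M),
      U1 u ->
      (forall x : V1 M, b1 u x = ip (dom_set Omega) f (val x.1)) ->
      forall Uh : set (trial M), Uh `<=` U1 (M:=M) -> finite_dim_subspace Uh ->
        let is_dpg_solution (uh : trial M) :=
          Uh uh /\
          forall x : V1 M, (T1 (M:=M) @` Uh) x ->
            b1 uh x = ip (dom_set Omega) f (val x.1) in
        (exists! uh : trial M, is_dpg_solution uh) /\
        forall uh : trial M, is_dpg_solution uh ->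
          forall w : trial M, Uh w ->
            U1_norm (u - uh) <= C * U1_norm (u - w).
Proof.
have d0 : (0 < d)%N by case: hd => ->.
have [c c0 adj] := adjoint_dom d0 hbounded.
pose K := infsup_const c; have K0 : 0 < K := infsup_const_gt0 c0.
exists (Num.sqrt (K * 25)); split; first by rewrite sqrtr_gt0 mulr_gt0.
move=> M f u hu uf Uh UhU fin is_dpg_solution.
have coercive (w : trial M) : U1 w -> U1_norm w ^+ 2 <= K * energy w w := energy_coercive c0 adj (w := w).
(* On a test function T1 w the datum (f, v) equals b1 u (T1 w), so the discrete equations say that
   uh and u have the same energy product with every w in Uh. *)
have solE uh : is_dpg_solution uh <-> galerkin u Uh uh.
  split=> -[h e]; [split=> [|w hw]; first exact: h|split=> [|_ [w hw <-]]; first exact: h].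
  - have hx : (T1 (M := M) @` Uh) (T1 w) by exists w.
    have := e _ hx; rewrite -uf => b1w.
    exact: etrans (energyE w (UhU _ h)) (etrans b1w (esym (energyE w hu))).
  - rewrite -uf.
    exact: etrans (esym (energyE w (UhU _ h))) (etrans (e w hw) (energyE w hu)).
split=> [|uh /solE sol w hw]; last exact: (galerkin_quasi_optimal K0 coercive hu UhU fin sol hw).
have [uh sol] := galerkin_exists hu UhU fin.
exists uh; split=> [|uh' /solE sol']; first exact/solE.
exact: (galerkin_unique coercive UhU fin sol sol').
Qed.
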